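(* For every fixed $x\in\mathbb{R}$ the limit $$\Psi_d(x)=\lim_{N\to+\infty}\frac{1}{V_d(N)}\#\left\{\lambda\in\mathcal{V}_d(N):\ \frac{\mathrm{rk}(\lambda)}{(6N/\pi^2)^{1/4}}\le x\right\}$$ exists and equals the standard normal distribution function: $$\Psi_d(x)=\frac{1}{\sqrt{2\pi}}\int_{-\infty}^{x}e^{-t^2/2}\,dt.$$
   Context: A strongly concave composition of a nonnegative integer $n$ is a finite sequence of nonnegative integers $(a_1,\dots,a_s)$, $s\ge 1$, summing to $n$, such that for some index $k$ with $1\le k\le s$ one has $a_1>a_2>\dots>a_{k-1}>a_k<a_{k+1}<\dots<a_s$; $a_k$ is called the central part. Its rank is $\mathrm{rk}(\lambda)=s-2k+1$. $\mathcal{V}_d(n)$ denotes the set of strongly concave compositions of $n$ and $V_d(n)=\#\mathcal{V}_d(n)$. *)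

(* Defs.v *)
From Stdlib Require Import Reals Lra Lia ZArith Arith List.
Import ListNotations.
Open Scope R_scope.

Definition sum_list (l : list nat) : nat := fold_right Nat.add 0%nat l.

(* [scc_at n l j] : l = (a_1,...,a_s) is a strongly concave composition of n
   whose central part is a_k with k = j+1 (0-based index j into the list):
   a_1 > ... > a_k < ... < a_s, s >= 1, entries sum to n. *)
Definition scc_at (n : nat) (l : list nat) (j : nat) : Prop :=
  (1 <= length l)%nat /\ (j < length l)%nat /\ sum_list l = n /\
  (forall i, (i < j)%nat -> (nth (S i) l 0 < nth i l 0)%nat) /\
  (forall i, (j <= i)%nat -> (S i < length l)%nat -> (nth i l 0 < nth (S i) l 0)%nat).

Definition scc (n : nat) (l : list nat) : Prop := exists j, scc_at n l j.

Definition rank_at (l : list nat) (j : nat) : Z :=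
  (Z.of_nat (length l) - 2 * Z.of_nat (S j) + 1)%Z.

Definition is_card (P : list nat -> Prop) (c : nat) : Prop :=
  exists L : list (list nat), NoDup L /\ (forall l, In l L <-> P l) /\ length L = c.

Definition rk_scale (N : nat) : R := Rpower (6 * INR N / PI ^ 2) (1 / 4).

Definition gauss (t : R) : R := exp (- t ^ 2 / 2) / sqrt (2 * PI).

Definition improper_lower_integral (f : R -> R) (x I : R) : Prop :=
  (forall a, a <= x -> inhabited (Riemann_integrable f a x)) /\
  forall eps, eps > 0 -> exists M : R, forall a (pr : Riemann_integrable f a x),
      a < M -> Rabs (RiemannInt pr - I) < eps.

(* Main.v *)
Require Import Defs.
From Stdlib Require Import Reals ZArith List Lia Lra Sorting.
From Coquelicot Require Import Coquelicot.
Import ListNotations.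
Open Scope R_scope.

(** A strongly concave composition is a central part [c] together with two sets [A], [B] of
    integers larger than [c], and its rank is [#B - #A].  By the Jacobi triple product the pairs
    (set of nonnegative integers, set of positive integers) with total [n] and rank [r] are
    counted by [p (n - r (r + 1) / 2)], with [p] the partition function.  Removing the parts
    [0, 1, ..., c] from the two sets divides the cumulative counts asymptotically by [2 * 4 ^ c],
    because these counts are monotone in the total and in the rank.  So it suffices that
    [p (n - k) / p n] behaves like [exp (- pi k / sqrt (6 n))] for [k = O(sqrt n)].

    For this, [delta n = 1 - p (n - 1) / p n] is, up to [O(1 / n)], the average of
    [delta (n - k)] against the probability weights [sigma k * p (n - k) / (n * p n)].  Where
    [sqrt n * delta n] is close to its upper or lower limit [a], the same therefore holds for
    most [n - k] with [k = O(sqrt n)], so [p (n - k) / p n] is close to [exp (- a k / sqrt n)]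
    there, and the recursion [n * p n = sum_k sigma k * p (n - k)] forces [a ^ 2 = pi ^ 2 / 6]. *)

Local Open Scope Z_scope.

(** The normal law comes from the triangular exponent: [p (n - r (r + 1) / 2) / p n] is close to
    [exp (- r^2 / (2 s^2))] with [s^2 = sqrt (6 n) / pi], the square of [rk_scale n]. Counts are
    cumulative (rank at most [X]) because these are monotone in the rank, so a bounded change of the
    total or the rank can be sandwiched and disappears in the limit. The factor 2 comes from the
    part 0, which Jacobi's identity admits in only one of the two sets, and each factor 4 from the
    four ways in which a part [c >= 1] can occur in the two sets. Summed over the central part they
    give [2 / 3], which cancels in the quotient of the theorem.

    The obstacle is Tauberian: the recursion controls only weighted averages, and an upper or lower
    limit gives only a one-sided bound. A nonnegative quantity of small weighted average is small on
    average over a window, but to use this one must first know that [p (n - k)] is comparable with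
    [p n] on windows and exponentially small beyond them. Crude constants are enough there. *)

Fixpoint zsum (f : nat -> Z) (n : nat) : Z :=
  match n with O => 0 | S k => zsum f k + f k end.

Lemma zsum_ext f g n : (forall i, (i < n)%nat -> f i = g i) -> zsum f n = zsum g n.
Proof.
  induction n as [|n IH]; intros H; simpl; [reflexivity|].
  rewrite IH by (intros; apply H; lia). rewrite H by lia. reflexivity.
Qed.

Lemma zsum_plus f g n : zsum (fun i => f i + g i) n = zsum f n + zsum g n.
Proof. induction n; simpl; lia. Qed.

Lemma zsum_shift f n : zsum f (S n) = f O + zsum (fun i => f (S i)) n.
Proof. induction n; simpl in *; lia. Qed.

Lemma zsum_zero f n : (forall i, (i < n)%nat -> f i = 0) -> zsum f n = 0.
Proof.
  induction n as [|n IH]; intros H; simpl; [reflexivity|].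
  rewrite IH by (intros; apply H; lia). rewrite H by lia. reflexivity.
Qed.

Lemma zsum_nonneg f n : (forall i, (i < n)%nat -> 0 <= f i) -> 0 <= zsum f n.
Proof.
  induction n as [|n IH]; intros H; simpl; [lia|].
  assert (0 <= zsum f n) by (apply IH; intros; apply H; lia).
  specialize (H n); lia.
Qed.

Lemma zsum_extend f n m : (n <= m)%nat ->
  (forall i, (n <= i < m)%nat -> f i = 0) -> zsum f m = zsum f n.
Proof.
  intros Hnm. induction Hnm as [|m Hm IH]; intros H; [reflexivity|].
  simpl. rewrite IH by (intros; apply H; lia). rewrite H by lia. lia.
Qed.

(** * Partition numbers *)

(* [pp m n] is the number of partitions of [n] into parts at most [m]. *)
Fixpoint pp (m : nat) (n : Z) : Z :=
  match m with
  | O => if n =? 0 then 1 else 0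
  | S m' => zsum (fun j => pp m' (n - Z.of_nat j * Z.of_nat m)) (Z.to_nat (n + 1))
  end.

(** The argument lies in [Z] so that subtracting too much gives the count 0; truncated subtraction
    would give [pp m 0 = 1]. *)
Lemma pp_neg m n : n < 0 -> pp m n = 0.
Proof.
  intros Hn. destruct m; simpl.
  - destruct (Z.eqb_spec n 0); lia.
  - replace (Z.to_nat (n + 1)) with O by lia. reflexivity.
Qed.

(** Either [S m] is not a part, or one copy of it can be removed. The definition sums over the
    multiplicity of [S m] to stay structural in [m]; here multiplicity 0 is split off. *)
Lemma pp_S m n : pp (S m) n = pp m n + pp (S m) (n - Z.of_nat (S m)).
Proof.
  destruct (Z.lt_ge_cases n 0) as [Hn|Hn]; [now rewrite !pp_neg by lia|].
  assert (H : forall K n', n' <= Z.of_nat K ->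
    pp (S m) n' = zsum (fun j => pp m (n' - Z.of_nat j * Z.of_nat (S m))) (S K)).
  { intros K n' HK. change (pp (S m) n') with
      (zsum (fun j => pp m (n' - Z.of_nat j * Z.of_nat (S m))) (Z.to_nat (n' + 1))).
    symmetry. apply zsum_extend; [lia|]. intros i Hi. apply pp_neg. nia. }
  rewrite (H (S (Z.to_nat n)) n), (H (Z.to_nat n) (n - Z.of_nat (S m))) by lia.
  rewrite zsum_shift. f_equal.
  - f_equal. lia.
  - apply zsum_ext. intros i _. f_equal. lia.
Qed.

Lemma pp_stable m n : n <= Z.of_nat m -> pp m n = pp (Z.to_nat n) n.
Proof.
  intros H. remember (m - Z.to_nat n)%nat as k eqn:Hk.
  revert m H Hk. induction k as [|k IH]; intros m H Hk.
  - destruct (Z.lt_ge_cases n 0); [now rewrite !pp_neg by lia|].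
    f_equal. lia.
  - destruct m as [|m]; [lia|].
    rewrite pp_S, (pp_neg (S m)) by lia. rewrite <- (IH m) by lia. lia.
Qed.

(* Logarithmic derivative of the Euler product, in finite form. *)
Lemma pp_euler m : forall (J : nat) n, n <= Z.of_nat J ->
  n * pp m n =
  zsum (fun d => zsum (fun j => Z.of_nat (S d) * pp m (n - Z.of_nat (S d) * Z.of_nat (S j))) J) m.
Proof.
  induction m as [|m IHm]; intros J n.
  - intros _. simpl. destruct (Z.eqb_spec n 0); lia.
  - remember (Z.to_nat (n + 1)) as k eqn:Hk. revert n Hk.
    induction k as [k IHk] using lt_wf_ind. intros n Hk HJ.
    destruct (Z.lt_ge_cases n 0) as [Hn|Hn].
    { rewrite pp_neg by lia. symmetry. rewrite Z.mul_0_r. apply zsum_zero. intros d _.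
      apply zsum_zero. intros j _. rewrite pp_neg by nia. lia. }
    rewrite pp_S at 1. rewrite Z.mul_add_distr_l, (IHm J n HJ).
    (* Splitting [n] this way makes the induction on [n] applicable; the surplus is the term [j = 0]
       of the new row for the part [S m]. *)
    assert (E : n * pp (S m) (n - Z.of_nat (S m)) =
      (n - Z.of_nat (S m)) * pp (S m) (n - Z.of_nat (S m)) +
      Z.of_nat (S m) * pp (S m) (n - Z.of_nat (S m))) by ring.
    rewrite E, (IHk (Z.to_nat (n - Z.of_nat (S m) + 1))) by lia. clear E.
    cbn [zsum]. rewrite Z.add_assoc, Z.add_assoc, <- zsum_plus, <- Z.add_assoc. f_equal.
    + apply zsum_ext. intros d Hd. rewrite <- zsum_plus. apply zsum_ext. intros j Hj.
      rewrite (pp_S m (n - Z.of_nat (S d) * Z.of_nat (S j))), Z.mul_add_distr_l.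
      do 3 f_equal. ring.
    + destruct J as [|J].
      { assert (n = 0) by lia. subst. simpl zsum. rewrite pp_neg by lia. ring. }
      rewrite (zsum_shift (fun j => Z.of_nat (S m) * pp (S m) (n - Z.of_nat (S m) * Z.of_nat (S j)))).
      cbn [zsum]. rewrite (pp_neg _ (n - Z.of_nat (S m) - _)) by nia.
      rewrite Z.mul_0_r, Z.add_0_r, Z.add_comm. f_equal.
      * do 2 f_equal. lia.
      * apply zsum_ext. intros j Hj. do 2 f_equal. lia.
Qed.

Definition part (n : Z) : Z := pp (Z.to_nat n) n.

Lemma part_neg n : n < 0 -> part n = 0.
Proof. apply pp_neg. Qed.

(** This is [n p(n) = sum_k sigma(k) p(n - k)] with [sigma(k)] expanded over the factorizations
    [k = d j]. The free bound [J] lets the recursions for [n] and [n - 1] share one range and be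
    subtracted. *)
Lemma part_euler (n : Z) (J : nat) : n <= Z.of_nat J ->
  n * part n =
  zsum (fun d => zsum (fun j =>
    Z.of_nat (S d) * part (n - Z.of_nat (S d) * Z.of_nat (S j))) J) J.
Proof.
  intros H. unfold part at 1. rewrite <- (pp_stable J n H), (pp_euler J J n H).
  apply zsum_ext. intros d _. apply zsum_ext. intros j _. f_equal.
  apply pp_stable. nia.
Qed.

(** For [m >= 1] this counts the partitions of [n] into parts between 2 and [m]. *)
Definition pdiff (m : nat) (n : Z) : Z := pp m n - pp m (n - 1).

Lemma pdiff_S m n : pdiff (S m) n = pdiff m n + pdiff (S m) (n - Z.of_nat (S m)).
Proof.
  unfold pdiff. rewrite (pp_S m n), (pp_S m (n - 1)).
  replace (n - 1 - Z.of_nat (S m)) with (n - Z.of_nat (S m) - 1) by lia. lia.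
Qed.

Lemma pdiff_1 n : pdiff 1 n = if n =? 0 then 1 else 0.
Proof.
  unfold pdiff. rewrite pp_S. simpl (Z.of_nat 1). simpl pp at 1. lia.
Qed.

Lemma pdiff_nonneg m : forall n, 0 <= pdiff (S m) n.
Proof.
  induction m as [|m IH]; intros n.
  - rewrite pdiff_1. destruct (n =? 0); lia.
  - remember (Z.to_nat (n + 1)) as k eqn:Hk. revert n Hk.
    induction k as [k IHk] using lt_wf_ind. intros n Hk.
    destruct (Z.lt_ge_cases n 0) as [Hn|Hn].
    { unfold pdiff. rewrite !pp_neg by lia. lia. }
    rewrite pdiff_S. specialize (IH n).
    specialize (IHk (Z.to_nat (n - Z.of_nat (S (S m)) + 1)) ltac:(lia)
                    (n - Z.of_nat (S (S m))) eq_refl). lia.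
Qed.

(* Partitions without parts 1: adding 1 to the largest part is injective. *)
Lemma pdiff_incr m : forall n, 1 <= n -> pdiff (S m) n <= pdiff (S (S m)) (n + 1).
Proof.
  induction m as [|m IH]; intros n Hn.
  - rewrite pdiff_1. destruct (Z.eqb_spec n 0); [lia|]. apply pdiff_nonneg.
  - rewrite (pdiff_S (S m)), (pdiff_S (S (S m))). specialize (IH n Hn).
    replace (n + 1 - Z.of_nat (S (S (S m)))) with (n - Z.of_nat (S (S m))) by lia.
    set (q := n - Z.of_nat (S (S m))).
    assert (pdiff (S (S m)) q <= pdiff (S (S (S m))) q).
    { rewrite (pdiff_S (S (S m)) q).
      pose proof (pdiff_nonneg (S (S m)) (q - Z.of_nat (S (S (S m))))). lia. }
    lia.
Qed.

Lemma part_pdiff (m : nat) n : n <= Z.of_nat m -> part n - part (n - 1) = pdiff m n.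
Proof.
  intros H. unfold pdiff, part. rewrite <- (pp_stable m n), <- (pp_stable m (n - 1)) by lia. lia.
Qed.

Lemma part_mono1 n : part (n - 1) <= part n.
Proof.
  pose proof (part_pdiff (S (Z.to_nat n)) n ltac:(lia)).
  pose proof (pdiff_nonneg (Z.to_nat n) n). lia.
Qed.

Lemma part_convex n : 1 <= n -> part n - part (n - 1) <= part (n + 1) - part n.
Proof.
  intros H.
  pose proof (part_pdiff (S (Z.to_nat n)) n ltac:(lia)) as E1.
  pose proof (part_pdiff (S (S (Z.to_nat n))) (n + 1) ltac:(lia)) as E2.
  replace (n + 1 - 1) with n in E2 by lia.
  rewrite E1, E2. apply pdiff_incr; lia.
Qed.

Lemma part_0 : part 0 = 1.
Proof. reflexivity. Qed.

(** * Counting pairs of strict partitions *)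

(** On generating functions in [q^n z^r] these three operators are multiplication by [1 + z q^m], by
    [1 + q^m / z], and by their product. *)
Definition addR (m : Z) (f : Z -> Z -> Z) (n r : Z) : Z := f n r + f (n - m) (r - 1).
Definition addL (m : Z) (f : Z -> Z -> Z) (n r : Z) : Z := f n r + f (n - m) (r + 1).
Definition addLR (m : Z) (f : Z -> Z -> Z) (n r : Z) : Z :=
  f n r + f (n - m) (r - 1) + f (n - m) (r + 1) + f (n - 2 * m) r.

(* With [f] the indicator of (0, 0), counts the pairs (L, R) of sets of integers in (c, c+k]
   with total sum n and |R| - |L| = r. *)
Fixpoint prs (f : Z -> Z -> Z) (c : Z) (k : nat) : Z -> Z -> Z :=
  match k with O => f | S k' => addLR (c + Z.of_nat k) (prs f c k') end.

Definition ind (n r : Z) : Z := if ((n =? 0) && (r =? 0))%bool then 1 else 0.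
(** The sum of [ind n s] over [s <= r]. As [prs] is linear and commutes with translations of the
    rank, starting from it counts the pairs of rank at most [r]. *)
Definition indle (n r : Z) : Z := if ((n =? 0) && (0 <=? r))%bool then 1 else 0.

Lemma prs_first f c k : forall n r, prs f (c - 1) (S k) n r = addLR c (prs f c k) n r.
Proof.
  induction k as [|k IH]; intros n r.
  - simpl. replace (c - 1 + 1) with c by lia. reflexivity.
  - change (prs f (c - 1) (S (S k)) n r)
      with (addLR (c - 1 + Z.of_nat (S (S k))) (prs f (c - 1) (S k)) n r).
    replace (c - 1 + Z.of_nat (S (S k))) with (c + Z.of_nat (S k)) by lia.
    set (b := c + Z.of_nat (S k)).
    unfold addLR at 1. rewrite !IH. cbn [prs]. fold b. unfold addLR.
    replace (n - b - c) with (n - c - b) by lia.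
    replace (n - b - 2 * c) with (n - 2 * c - b) by lia.
    replace (n - 2 * b - c) with (n - c - 2 * b) by lia.
    replace (n - 2 * b - 2 * c) with (n - 2 * c - 2 * b) by lia.
    replace (r - 1 + 1) with r by lia. replace (r + 1 - 1) with r by lia. lia.
Qed.

Lemma prs_neg f c k : 0 <= c -> (forall n r, n < 0 -> f n r = 0) ->
  forall n r, n < 0 -> prs f c k n r = 0.
Proof.
  intros Hc Hf. induction k as [|k IH]; intros n r Hn; cbn [prs]; [auto|].
  unfold addLR. rewrite !IH by lia. lia.
Qed.

Lemma prs_nonneg f c k : (forall n r, 0 <= f n r) -> forall n r, 0 <= prs f c k n r.
Proof.
  intros Hf. induction k as [|k IH]; intros n r; cbn [prs]; [auto|].
  unfold addLR. pose proof (IH n r). pose proof (IH (n - (c + Z.of_nat (S k))) (r - 1)).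
  pose proof (IH (n - (c + Z.of_nat (S k))) (r + 1)).
  pose proof (IH (n - 2 * (c + Z.of_nat (S k))) r). lia.
Qed.

Lemma prs_stable f c k k' n r : 0 <= c -> (forall n r, n < 0 -> f n r = 0) ->
  n <= c + Z.of_nat k -> (k <= k')%nat -> prs f c k' n r = prs f c k n r.
Proof.
  intros Hc Hf Hn Hk. induction Hk as [|k' Hk IH]; [reflexivity|].
  cbn [prs]. unfold addLR. rewrite IH, !(prs_neg f c k') by (auto; lia). lia.
Qed.

(** Adding 1 to the largest part is injective and keeps the rank; if both sets contain that part,
    one fixed side is raised. The subtracted [f] is the contribution of the empty pair, which has no
    largest part. *)
Lemma prs_incr f c k : (forall n r, 0 <= f n r) -> forall n r,
  prs f c k n r - f n r <= prs f c (S k) (n + 1) r - f (n + 1) r.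
Proof.
  intros Hf. pose proof (fun k => prs_nonneg f c k Hf) as Hp.
  induction k as [|k IH]; intros n r.
  - cbn [prs]. unfold addLR. 
    pose proof (Hf (n + 1 - (c + Z.of_nat 1)) (r - 1)).
    pose proof (Hf (n + 1 - (c + Z.of_nat 1)) (r + 1)).
    pose proof (Hf (n + 1 - 2 * (c + Z.of_nat 1)) r). lia.
  - change (prs f c (S (S k)) (n + 1) r)
      with (addLR (c + Z.of_nat (S (S k))) (prs f c (S k)) (n + 1) r).
    unfold addLR. specialize (IH n r).
    set (m := c + Z.of_nat (S k)).
    replace (c + Z.of_nat (S (S k))) with (m + 1) by (unfold m; lia).
    replace (n + 1 - (m + 1)) with (n - m) by lia.
    assert (E1 : prs f c (S k) n r = addLR m (prs f c k) n r) by reflexivity.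
    assert (E2 : forall r, prs f c (S k) (n - m) r = addLR m (prs f c k) (n - m) r) by reflexivity.
    rewrite E1, !E2. unfold addLR.
    replace (n - m - m) with (n - 2 * m) by lia.
    replace (r - 1 + 1) with r by lia. replace (r + 1 - 1) with r by lia.
    pose proof (Hp k (n - 2 * m) (r - 1 - 1)). pose proof (Hp k (n - 2 * m) r).
    pose proof (Hp k (n - m - 2 * m) (r - 1)). pose proof (Hp k (n - 2 * m) (r + 1 + 1)).
    pose proof (Hp k (n - m - 2 * m) (r + 1)).
    pose proof (Hp (S k) (n + 1 - 2 * (m + 1)) r).
    lia.
Qed.

Lemma prs_indle_mono c k : forall n r r', r <= r' -> prs indle c k n r <= prs indle c k n r'.
Proof.
  induction k as [|k IH]; intros n r r' H; cbn [prs].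
  - unfold indle. destruct (n =? 0); simpl; [|lia].
    destruct (Z.leb_spec 0 r), (Z.leb_spec 0 r'); lia.
  - unfold addLR. pose proof (IH n r r' H).
    pose proof (IH (n - (c + Z.of_nat (S k))) (r - 1) (r' - 1) ltac:(lia)).
    pose proof (IH (n - (c + Z.of_nat (S k))) (r + 1) (r' + 1) ltac:(lia)).
    pose proof (IH (n - 2 * (c + Z.of_nat (S k))) r r' H). lia.
Qed.

Lemma prs_indle_diff c k : forall n r,
  prs indle c k n r - prs indle c k n (r - 1) = prs ind c k n r.
Proof.
  induction k as [|k IH]; intros n r; cbn [prs].
  - unfold indle, ind. destruct (n =? 0); simpl; [|lia].
    destruct (Z.leb_spec 0 r), (Z.leb_spec 0 (r - 1)), (Z.eqb_spec r 0); lia.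
  - unfold addLR. rewrite <- !IH. replace (r - 1 + 1) with (r + 1 - 1) by lia. lia.
Qed.

(** All parts are at least 1, so a pair of total [n] has rank at least [- n]. *)
Lemma prs_indle_low c k : 0 <= c -> forall n r, n + r < 0 -> prs indle c k n r = 0.
Proof.
  intros Hc. induction k as [|k IH]; intros n r H; cbn [prs].
  - unfold indle. destruct (Z.eqb_spec n 0), (Z.leb_spec 0 r); simpl; lia.
  - unfold addLR. rewrite !IH by lia. lia.
Qed.

(** * The Jacobi triple product *)

Fixpoint prsR (c : Z) (k : nat) : Z -> Z -> Z :=
  match k with O => ind | S k' => addR (c + Z.of_nat k) (prsR c k') end.

(** The left parts are [0, ..., k - 1]. Admitting 0 on this side only is what produces the exponent
    [r (r + 1) / 2]. *)
Fixpoint prsL (f : Z -> Z -> Z) (k : nat) : Z -> Z -> Z :=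
  match k with O => f | S k' => addL (Z.of_nat k') (prsL f k') end.

Definition tri (r : Z) : Z := r * (r + 1) / 2.

Lemma tri_spec r : 2 * tri r = r * (r + 1).
Proof.
  unfold tri. symmetry. apply Z_div_exact_full_2; [lia|].
  destruct (Z.Even_or_Odd r) as [[q ->]|[q ->]].
  - replace (2 * q * (2 * q + 1)) with (q * (2 * q + 1) * 2) by ring. apply Z_mod_mult.
  - replace ((2 * q + 1) * (2 * q + 1 + 1)) with ((2 * q + 1) * (q + 1) * 2) by ring.
    apply Z_mod_mult.
Qed.

Definition ppz (s n : Z) : Z := if s <? 0 then 0 else pp (Z.to_nat s) n.

Lemma ppz_rec s n : ppz s n = ppz (s - 1) n + (if s =? 0 then ppz s n else ppz s (n - s)).
Proof.
  unfold ppz. destruct (Z.ltb_spec s 0), (Z.ltb_spec (s - 1) 0), (Z.eqb_spec s 0); try lia.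
  replace (Z.to_nat s) with (S (Z.to_nat (s - 1))) by lia.
  rewrite pp_S at 1. repeat f_equal. lia.
Qed.

(** Subtract 1 from each of the [r] parts. *)
Lemma prsR_shift k : forall n r, prsR 1 k n r = prsR 0 k (n - r) r.
Proof.
  induction k as [|k IH]; intros n r; cbn [prsR].
  - unfold ind. destruct (Z.eqb_spec r 0); [subst; now rewrite Z.sub_0_r|].
    now rewrite !Bool.andb_false_r.
  - unfold addR. rewrite !IH. do 2 f_equal. lia.
Qed.

Lemma prsR_first k : forall n r, prsR 0 (S k) n r = addR 1 (prsR 1 k) n r.
Proof.
  induction k as [|k IH]; intros n r; [reflexivity|].
  change (prsR 0 (S (S k)) n r) with (addR (Z.of_nat (S (S k))) (prsR 0 (S k)) n r).
  unfold addR at 1. rewrite !IH. cbn [prsR].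
  replace (1 + Z.of_nat (S k)) with (Z.of_nat (S (S k))) by lia.
  unfold addR. replace (n - Z.of_nat (S (S k)) - 1) with (n - 1 - Z.of_nat (S (S k))) by lia. lia.
Qed.

Lemma prsR_neg k : forall n r, n < 0 \/ r < 0 \/ (r = 0 /\ n <> 0) -> prsR 0 k n r = 0.
Proof.
  induction k as [|k IH]; intros n r H; cbn [prsR].
  - unfold ind. destruct (Z.eqb_spec n 0), (Z.eqb_spec r 0); simpl; lia.
  - unfold addR. rewrite !IH by lia. lia.
Qed.

Lemma prsR_00 k : prsR 0 k 0 0 = 1.
Proof. induction k; [reflexivity|]. cbn [prsR]. unfold addR. rewrite IHk, prsR_neg; lia. Qed.

(** Removing the staircase [1, ..., r] from a set of [r] positive integers leaves a partition into
    at most [r] parts. In the proof, splitting by whether 1 is in the set gives the recursion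
    [ppz_rec]. *)
Lemma prsR_pp k : forall n r, n <= Z.of_nat k -> prsR 0 k n r = ppz r (n - tri r).
Proof.
  induction k as [|k IH]; intros n r Hn; pose proof (tri_spec r) as Hr.
  - cbn [prsR]. unfold ind, ppz.
    destruct (Z.ltb_spec r 0), (Z.eqb_spec n 0), (Z.eqb_spec r 0); simpl; try lia.
    + subst. reflexivity.
    + rewrite pp_neg; nia.
    + rewrite pp_neg; nia.
    + rewrite pp_neg; nia.
  - destruct (Z.lt_trichotomy r 0) as [H|[H|H]].
    + rewrite prsR_neg by lia. unfold ppz. destruct (Z.ltb_spec r 0); lia.
    + subst r. unfold ppz. simpl. rewrite Z.sub_0_r. destruct (Z.eqb_spec n 0).
      * subst; apply (prsR_00 (S k)).
      * apply (prsR_neg (S k)). lia.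
    + rewrite prsR_first. unfold addR. rewrite !prsR_shift.
      rewrite !IH by lia. rewrite (ppz_rec r (n - tri r)).
      destruct (Z.eqb_spec r 0); [lia|].
      pose proof (tri_spec (r - 1)).
      rewrite Z.add_comm. f_equal; f_equal; nia.
Qed.

(** A finite form of the triple product: admitting one more left part raises the bound on the parts
    of the partition by one, and [ppz_rec] is exactly that step. *)
Lemma prsL_pp K M : forall n r, n <= Z.of_nat K ->
  prsL (prsR 0 K) M n r = ppz (Z.of_nat M + r) (n - tri r).
Proof.
  induction M as [|M IH]; intros n r Hn; cbn [prsL].
  - rewrite prsR_pp by lia. f_equal.
  - unfold addL. rewrite !IH by lia.
    rewrite (ppz_rec (Z.of_nat (S M) + r)).
    pose proof (tri_spec r). pose proof (tri_spec (r + 1)).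
    replace (Z.of_nat (S M) + r - 1) with (Z.of_nat M + r) by lia.
    replace (Z.of_nat M + (r + 1)) with (Z.of_nat (S M) + r) by lia. f_equal.
    destruct (Z.eqb_spec (Z.of_nat (S M) + r) 0); f_equal; nia.
Qed.

(** The same product of factors, multiplied in two orders: symmetrically with the left part 0 last,
    or all right parts before all left parts. *)
Lemma prs_addL k : forall n r, addL 0 (prs ind 0 k) n r = prsL (prsR 0 k) (S k) n r.
Proof.
  assert (C : forall f m b n r, prsL (addR b f) m n r = addR b (prsL f m) n r).
  { intros f m b. induction m as [|m IH]; intros n r; cbn [prsL]; [reflexivity|].
    unfold addL. rewrite !IH. unfold addR. unfold addL.
    replace (n - Z.of_nat m - b) with (n - b - Z.of_nat m) by lia.
    replace (r + 1 - 1) with (r - 1 + 1) by lia. lia. }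
  induction k as [|k IH]; intros n r; [reflexivity|].
  change (prsL (prsR 0 (S k)) (S (S k)) n r)
    with (addL (Z.of_nat (S k)) (prsL (addR (Z.of_nat (S k)) (prsR 0 k)) (S k)) n r).
  unfold addL at 2. rewrite !C. unfold addR. rewrite <- !IH.
  change (prs ind 0 (S k)) with (addLR (Z.of_nat (S k)) (prs ind 0 k)).
  set (b := Z.of_nat (S k)). unfold addL, addLR. rewrite !Z.sub_0_r.
  replace (n - b - b) with (n - 2 * b) by lia.
  replace (r - 1 + 1) with r by lia. replace (r + 1 - 1) with r by lia. lia.
Qed.

(** The second summand stands for the left sets that contain 0: deleting the 0 keeps the total and
    raises the rank by 1. *)
Lemma jacobi_triple k n r : n <= Z.of_nat k ->
  prs ind 0 k n r + prs ind 0 k n (r + 1) = part (n - tri r).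
Proof.
  intros Hn. pose proof (prs_addL k n r) as E. unfold addL at 1 in E.
  rewrite Z.sub_0_r in E. rewrite E, prsL_pp by lia. unfold ppz.
  pose proof (tri_spec r).
  destruct (Z.ltb_spec (Z.of_nat (S k) + r) 0).
  (* Here [r <= - k - 2], so [tri r > n] and both sides vanish. *)
  - rewrite part_neg; nia.
  - unfold part. rewrite pp_stable; [reflexivity|]. nia.
Qed.

(** * Strongly concave compositions as triples *)

Lemma sorted_nth (L : list nat) : StronglySorted lt L <->
  (forall i, (S i < length L)%nat -> (nth i L 0 < nth (S i) L 0)%nat).
Proof.
  split.
  - intros H. apply StronglySorted_Sorted in H. induction H as [|a L HL IH Ha]; intros i Hi.
    + simpl in Hi. lia.
    + destruct i as [|i].
      * destruct Ha; simpl in *; lia.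
      * simpl in Hi. specialize (IH i ltac:(lia)). simpl. exact IH.
  - intros H. apply Sorted_StronglySorted; [intros x y z; lia|].
    induction L as [|a L IH]; constructor.
    + apply IH. intros i Hi. apply (H (S i)). simpl. lia.
    + destruct L as [|b L]; constructor. apply (H O). simpl. lia.
Qed.

Lemma sorted_snoc (L : list nat) b :
  StronglySorted lt (L ++ [b]) <-> StronglySorted lt L /\ List.Forall (fun x => (x < b)%nat) L.
Proof.
  induction L as [|a L IH]; simpl.
  - split; intros; [split; constructor|repeat constructor].
  - split.
    + intros H. inversion_clear H as [|? ? H1 H2]. apply IH in H1 as [H3 H4].
      apply Forall_app in H2 as [H5 H6]. inversion_clear H6.
      split; constructor; auto.
    + intros [H1 H2]. inversion_clear H1 as [|? ? H3 H4]. inversion_clear H2 as [|? ? H5 H6].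
      constructor; [now apply IH|]. apply Forall_app; auto.
Qed.

Lemma sum_list_app l1 l2 : sum_list (l1 ++ l2) = (sum_list l1 + sum_list l2)%nat.
Proof. unfold sum_list. induction l1; simpl; lia. Qed.

Lemma sum_list_rev l : sum_list (rev l) = sum_list l.
Proof.
  induction l; [reflexivity|]. simpl. rewrite sum_list_app, IHl. unfold sum_list. simpl. lia.
Qed.

(** The left side is stored from the centre outwards, hence the [rev]; both sides then obey the same
    sortedness condition. *)
Lemma scc_at_split n l j : scc_at n l j <->
  exists A c B, l = rev A ++ c :: B /\ j = length A /\
    StronglySorted lt (c :: A) /\ StronglySorted lt (c :: B) /\
    (sum_list A + c + sum_list B)%nat = n.
Proof.
  split.
  - intros (_ & Hj & Hs & Hd & Hi).
    destruct (nth_split l 0%nat Hj) as (A' & B & E & HA).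
    exists (rev A'), (nth j l 0%nat), B. rewrite rev_involutive, length_rev.
    set (c := nth j l 0%nat) in *.
    repeat split; auto.
    + apply sorted_nth. intros i Hlen. simpl in Hlen. rewrite length_rev in Hlen.
      assert (N : forall m, (m <= j)%nat -> nth m (c :: rev A') 0%nat = nth (j - m) l 0%nat).
      { intros m Hm. replace (c :: rev A') with (rev (A' ++ [c])) by (now rewrite rev_app_distr).
        rewrite rev_nth; rewrite length_app; simpl; [|lia].
        replace (length A' + 1 - S m)%nat with (j - m)%nat by lia.
        rewrite E. replace (A' ++ c :: B) with ((A' ++ [c]) ++ B) by (now rewrite <- app_assoc).
        rewrite (app_nth1 (A' ++ [c]) B); [reflexivity|]. rewrite length_app. simpl. lia. }
      rewrite !N by lia. replace (j - i)%nat with (S (j - S i)) by lia. apply Hd. lia.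
    + apply sorted_nth. intros i Hlen. simpl in Hlen.
      assert (N : forall m, nth m (c :: B) 0%nat = nth (j + m) l 0%nat).
      { intros m. rewrite E, app_nth2 by lia. f_equal. lia. }
      rewrite !N. replace (j + S i)%nat with (S (j + i)) by lia. apply Hi; [lia|].
      rewrite E, length_app. simpl. lia.
    + rewrite sum_list_rev, <- Hs, E, sum_list_app. unfold sum_list. simpl. lia.
  - intros (A & c & B & -> & -> & HA & HB & Hs).
    unfold scc_at. rewrite length_app, length_rev. simpl length.
    rewrite sum_list_app, sum_list_rev. change (sum_list (c :: B)) with (c + sum_list B)%nat.
    repeat split; try lia.
    + intros i Hi.
      assert (N : forall m, (m <= length A)%nat ->
        nth m (rev A ++ c :: B) 0%nat = nth (length A - m) (c :: A) 0%nat).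
      { intros m Hm. replace (rev A ++ c :: B) with (rev (c :: A) ++ B)
          by (simpl; now rewrite <- app_assoc).
        rewrite app_nth1 by (rewrite length_rev; simpl; lia).
        rewrite rev_nth by (simpl; lia). f_equal. }
      rewrite !N by lia. replace (length A - i)%nat with (S (length A - S i)) by lia.
      apply (proj1 (sorted_nth _) HA). simpl. lia.
    + intros i H1 H2.
      assert (N : forall m, (length A <= m)%nat ->
        nth m (rev A ++ c :: B) 0%nat = nth (m - length A) (c :: B) 0%nat).
      { intros m Hm. rewrite app_nth2 by (rewrite length_rev; lia).
        now rewrite length_rev. }
      rewrite !N by lia. replace (S i - length A)%nat with (S (i - length A)) by lia.
      apply (proj1 (sorted_nth _) HB). simpl. lia.
Qed.

(** Between two different centres the sequence would have to rise and fall at once. Hence the rank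
    belongs to the list alone, although it is computed from [j]. *)
Lemma scc_at_unique n n' l j j' : scc_at n l j -> scc_at n' l j' -> j = j'.
Proof.
  intros (_ & Hj & _ & Hd & Hi) (_ & Hj' & _ & Hd' & Hi').
  destruct (Nat.lt_trichotomy j j') as [H|[H|H]]; auto.
  - specialize (Hi j ltac:(lia) ltac:(lia)). specialize (Hd' j H). lia.
  - specialize (Hi' j' ltac:(lia) ltac:(lia)). specialize (Hd j' H). lia.
Qed.

Definition compose (t : nat * (list nat * list nat)) : list nat :=
  rev (fst (snd t)) ++ fst t :: snd (snd t).

(** The centre is at a unique position, so [A] and [A'] have the same length and the list splits in
    only one way. *)
Lemma compose_inj c A B c' A' B' :
  StronglySorted lt (c :: A) -> StronglySorted lt (c :: B) ->
  StronglySorted lt (c' :: A') -> StronglySorted lt (c' :: B') ->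
  compose (c, (A, B)) = compose (c', (A', B')) -> (c, (A, B)) = (c', (A', B')).
Proof.
  unfold compose; simpl. intros HA HB HA' HB' E.
  assert (H1 : scc_at (sum_list A + c + sum_list B) (rev A ++ c :: B) (length A))
    by (apply scc_at_split; exists A, c, B; auto).
  assert (H2 : scc_at (sum_list A' + c' + sum_list B') (rev A ++ c :: B) (length A'))
    by (rewrite E; apply scc_at_split; exists A', c', B'; auto).
  pose proof (scc_at_unique _ _ _ _ _ H1 H2) as EL.
  assert (E1 : rev A = rev A' /\ c :: B = c' :: B').
  { rewrite <- (length_rev A), <- (length_rev A') in EL.
    pose proof (f_equal (firstn (length (rev A))) E) as F1.
    pose proof (f_equal (skipn (length (rev A))) E) as F2.
    rewrite !firstn_app, !EL, !Nat.sub_diag, !firstn_all in F1.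
    rewrite <- EL, firstn_all in F1 at 1. simpl in F1. rewrite !app_nil_r in F1.
    rewrite !skipn_app, !EL, !Nat.sub_diag, !skipn_all in F2.
    rewrite <- EL, skipn_all in F2 at 1. simpl in F2. auto. }
  destruct E1 as [E1 E2]. apply (f_equal (@rev nat)) in E1. rewrite !rev_involutive in E1.
  congruence.
Qed.

(** * Enumeration of the pairs of sides and of the compositions *)

Definition extend (b : nat) (p : list nat * list nat) : list (list nat * list nat) :=
  [p; (fst p, snd p ++ [b]); (fst p ++ [b], snd p); (fst p ++ [b], snd p ++ [b])].

(** It follows the recursion of [prs], the four extensions matching the four terms of [addLR], so
    that [count_gen] is a direct induction. *)
Fixpoint gen (c k : nat) : list (list nat * list nat) :=
  match k with
  | O => [([], [])]
  | S k' => flat_map (extend (c + k)) (gen c k')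
  end.

Definition bnd (c k : nat) (A : list nat) : Prop :=
  StronglySorted lt (c :: A) /\ List.Forall (fun x => (x <= c + k)%nat) A.

Lemma bnd_S c k A : bnd c (S k) A <->
  bnd c k A \/ exists A', A = A' ++ [(c + S k)%nat] /\ bnd c k A'.
Proof.
  unfold bnd. split.
  - intros [H1 H2]. destruct A as [|a A0].
    + left. split; [auto|constructor].
    + destruct (@exists_last _ (a :: A0)) as [A' [b E]]; [discriminate|].
      rewrite E in *. clear E.
      assert (H1' : StronglySorted lt ((c :: A') ++ [b])) by exact H1.
      apply sorted_snoc in H1' as [H3 H4]. inversion_clear H4 as [|? ? H5 H6].
      apply Forall_app in H2 as [H7 H8]. inversion_clear H8 as [|? ? H9 _].
      destruct (Nat.eq_dec b (c + S k)) as [->|Hb].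
      * right. exists A'. split; [auto|]. split; [auto|].
        eapply Forall_impl; [|exact H6]. intros; simpl in *; lia.
      * left. split; [auto|]. apply Forall_app. split; [|constructor; [lia|constructor]].
        eapply Forall_impl; [|exact H6]. intros; simpl in *; lia.
  - intros [[H1 H2]|(A' & -> & H1 & H2)].
    + split; [auto|]. eapply Forall_impl; [|exact H2]. intros; simpl in *; lia.
    + split.
      * change (StronglySorted lt ((c :: A') ++ [(c + S k)%nat])). apply sorted_snoc.
        split; [auto|]. constructor; [lia|].
        eapply Forall_impl; [|exact H2]. intros; simpl in *; lia.
      * apply Forall_app. split; [|constructor; [lia|constructor]].
        eapply Forall_impl; [|exact H2]. intros; simpl in *; lia.
Qed.

Lemma in_gen c k : forall A B, In (A, B) (gen c k) <-> bnd c k A /\ bnd c k B.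
Proof.
  induction k as [|k IH]; intros A B.
  - simpl. unfold bnd. split.
    + intros [E|[]]. inversion E. repeat constructor.
    + intros [[HA HA'] [HB HB']]. left.
      destruct A as [|a A]; [destruct B as [|b B]; [reflexivity|]|].
      * inversion_clear HB' as [|? ? H1 H2]. inversion_clear HB as [|? ? H3 H4].
        inversion_clear H4. lia.
      * inversion_clear HA' as [|? ? H1 H2]. inversion_clear HA as [|? ? H3 H4].
        inversion_clear H4. lia.
  - cbn [gen]. rewrite in_flat_map, !bnd_S. split.
    + intros ([A' B'] & H & HE). apply IH in H as [HA HB].
      simpl in HE. destruct HE as [E|[E|[E|[E|[]]]]]; inversion E; subst; eauto 10.
    + intros [[HA|(A' & -> & HA)] [HB|(B' & -> & HB)]];
        [exists (A, B)|exists (A, B')|exists (A', B)|exists (A', B')];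
        (split; [apply IH; auto|simpl; auto]).
Qed.

Lemma nodup_flat_map {X Y} (g : X -> list Y) (l : list X) : NoDup l ->
  (forall x, In x l -> NoDup (g x)) ->
  (forall x x' y, In x l -> In x' l -> In y (g x) -> In y (g x') -> x = x') ->
  NoDup (flat_map g l).
Proof.
  induction 1 as [|a l Ha Hl IH]; intros H1 H2; simpl; [constructor|].
  apply NoDup_app.
  - apply H1; simpl; auto.
  - apply IH; intros; [apply H1|eapply H2]; simpl; eauto.
  - intros y Hy Hy'. apply in_flat_map in Hy' as (x & Hx & Hy').
    assert (a = x) by (eapply H2; simpl; eauto). subst. contradiction.
Qed.

(** The appended entry exceeds all earlier ones, so an extended pair reveals which lists were
    extended and from which pair. *)
Lemma gen_nodup c k : NoDup (gen c k).
Proof.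
  induction k as [|k IH]; cbn [gen]; [repeat constructor; simpl; tauto|].
  assert (F : forall A, bnd c k A -> ~ In (c + S k)%nat A).
  { intros A [_ HA] Hin. rewrite Forall_forall in HA. specialize (HA _ Hin). lia. }
  assert (G : forall A A' b, @app nat A [b] = A' -> In b A').
  { intros; subst. apply in_app_iff. simpl. auto. }
  assert (G' : forall (A : list nat) b, A = A ++ [b] -> False).
  { intros A b E. apply (f_equal (@length nat)) in E. rewrite length_app in E. simpl in E. lia. }
  apply nodup_flat_map; auto.
  - intros [A B] HAB. unfold extend; simpl.
    repeat constructor; simpl; intros HH; repeat destruct HH as [HH|HH]; auto;
      injection HH; intros; eauto.
  - intros [A B] [A' B'] y H1 H2. apply in_gen in H1 as [HA HB]. apply in_gen in H2 as [HA' HB'].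
    apply F in HA, HB, HA', HB'. unfold extend; simpl.
    intros [<-|[<-|[<-|[<-|[]]]]] [E|[E|[E|[E|[]]]]]; injection E; intros E1 E2; subst; auto;
      try (exfalso; eauto; fail);
      repeat match goal with H : _ ++ [_] = _ ++ [_] |- _ => apply app_inj_tail in H as [? _] end;
      subst; auto; exfalso; eauto using in_or_app, in_eq.
Qed.

Definition pair_ok (n X : Z) (p : list nat * list nat) : bool :=
  ((Z.of_nat (sum_list (fst p) + sum_list (snd p)) =? n)
   && (Z.of_nat (length (snd p)) - Z.of_nat (length (fst p)) <=? X))%bool.

Lemma count_gen (c k : nat) : forall n X,
  Z.of_nat (length (filter (pair_ok n X) (gen c k))) = prs indle (Z.of_nat c) k n X.
Proof.
  assert (H : forall b n X l, Z.of_nat (length (filter (pair_ok n X) (flat_map (extend b) l))) =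
    addLR (Z.of_nat b) (fun n X => Z.of_nat (length (filter (pair_ok n X) l))) n X).
  { intros b n X l. unfold addLR. induction l as [|[A B] l IH]; [reflexivity|].
    cbn [flat_map]. rewrite filter_app, length_app, Nat2Z.inj_add, IH. clear IH.
    set (bz := Z.of_nat b).
    assert (E : forall n X p, Z.of_nat (length (filter (pair_ok n X) (p :: l))) =
      (if pair_ok n X p then 1 else 0) + Z.of_nat (length (filter (pair_ok n X) l))).
    { intros n' X' p. simpl filter. destruct (pair_ok n' X' p); simpl length; lia. }
    rewrite !E. clear E.
    assert (E2 : pair_ok (n - bz) (X - 1) (A, B) = pair_ok n X (A, B ++ [b])).
    { unfold pair_ok; cbn [fst snd]. rewrite sum_list_app, length_app.
      change (sum_list [b]) with (b + 0)%nat. change (length [b]) with 1%nat. f_equal.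
      - apply Bool.eq_iff_eq_true. rewrite !Z.eqb_eq. unfold bz; lia.
      - apply Bool.eq_iff_eq_true. rewrite !Z.leb_le. lia. }
    assert (E3 : pair_ok (n - bz) (X + 1) (A, B) = pair_ok n X (A ++ [b], B)).
    { unfold pair_ok; cbn [fst snd]. rewrite sum_list_app, length_app.
      change (sum_list [b]) with (b + 0)%nat. change (length [b]) with 1%nat. f_equal.
      - apply Bool.eq_iff_eq_true. rewrite !Z.eqb_eq. unfold bz; lia.
      - apply Bool.eq_iff_eq_true. rewrite !Z.leb_le. lia. }
    assert (E4 : pair_ok (n - 2 * bz) X (A, B) = pair_ok n X (A ++ [b], B ++ [b])).
    { unfold pair_ok; cbn [fst snd]. rewrite !sum_list_app, !length_app.
      change (sum_list [b]) with (b + 0)%nat. change (length [b]) with 1%nat. f_equal.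
      - apply Bool.eq_iff_eq_true. rewrite !Z.eqb_eq. unfold bz; lia.
      - apply Bool.eq_iff_eq_true. rewrite !Z.leb_le. lia. }
    rewrite E2, E3, E4. unfold extend; simpl.
    destruct (pair_ok n X (A, B)), (pair_ok n X (A, B ++ [b])),
      (pair_ok n X (A ++ [b], B)), (pair_ok n X (A ++ [b], B ++ [b])); simpl length; lia. }
  induction k as [|k IH]; intros n X.
  - assert (E : pair_ok n X ([], []) = ((n =? 0) && (0 <=? X))%bool)
      by (unfold pair_ok; rewrite (Z.eqb_sym _ n); reflexivity).
    cbn [gen filter prs]. rewrite E. unfold indle. destruct (_ && _)%bool; reflexivity.
  - cbn [gen prs]. rewrite H. unfold addLR. rewrite !IH. rewrite !Nat2Z.inj_add. reflexivity.
Qed.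

Lemma is_card_unique P a b : is_card P a -> is_card P b -> a = b.
Proof.
  intros (L & H1 & H2 & <-) (L' & H1' & H2' & <-). apply Nat.le_antisymm.
  - apply NoDup_incl_length; auto. intros x Hx. apply H2', H2, Hx.
  - apply NoDup_incl_length; auto. intros x Hx. apply H2, H2', Hx.
Qed.

(** Entries above [c] are at least 1. This makes [gen c N] large enough for compositions of [N] and
    bounds their rank by [N]. *)
Lemma sorted_above c A : StronglySorted lt (c :: A) ->
  List.Forall (fun x => (x <= c + sum_list A)%nat) A /\ (length A <= sum_list A)%nat.
Proof.
  intros H. inversion_clear H as [|? ? _ HF]. induction HF as [|a A Ha HF [IH1 IH2]].
  - split; [constructor|]. simpl. lia.
  - unfold sum_list in *. simpl. split; [|lia]. constructor; [lia|].
    eapply Forall_impl; [|exact IH1]. intros; simpl in *; lia.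
Qed.

(** [P] is abstract because the theorem bounds the rank by a real inequality, which becomes [z <= X]
    only after taking an integer part. *)
Lemma scc_card (N : nat) (P : Z -> Prop) (X : Z) (m : nat) : (forall z, P z <-> z <= X) ->
  is_card (fun l => exists j, scc_at N l j /\ P (rank_at l j)) m ->
  Z.of_nat m = zsum (fun c => prs indle (Z.of_nat c) N (Z.of_nat N - Z.of_nat c) X) (S N).
Proof.
  intros HP Hm.
  set (tl := fun c => map (pair c)
    (filter (pair_ok (Z.of_nat N - Z.of_nat c) X) (gen c N))).
  set (T := flat_map tl (seq 0 (S N))).
  assert (HT : forall c A B, In (c, (A, B)) T <->
    (c <= N)%nat /\ bnd c N A /\ bnd c N B /\ (sum_list A + c + sum_list B)%nat = N /\
    Z.of_nat (length B) - Z.of_nat (length A) <= X).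
  { intros c A B. unfold T, tl. rewrite in_flat_map. split.
    - intros (c' & Hc & H). apply in_map_iff in H as (p & E & H). injection E as -> ->.
      apply in_seq in Hc. apply filter_In in H as [H1 H2]. apply in_gen in H1.
      unfold pair_ok in H2; cbn [fst snd] in H2. apply andb_prop in H2 as [H2 H3].
      rewrite Z.eqb_eq in H2. rewrite Z.leb_le in H3.
      split; [lia|]. split; [tauto|]. split; [tauto|]. split; lia.
    - intros (Hc & HA & HB & Hs & Hr). exists c. split; [apply in_seq; lia|].
      apply in_map. apply filter_In. split; [apply in_gen; auto|].
      unfold pair_ok; cbn [fst snd]. apply andb_true_intro. rewrite Z.eqb_eq, Z.leb_le. lia. }
  assert (HN : NoDup T).
  { apply nodup_flat_map; [apply seq_NoDup| |].
    - intros c _. apply FinFun.Injective_map_NoDup; [|apply NoDup_filter, gen_nodup].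
      intros x y E; congruence.
    - intros c c' y _ _ H H'. apply in_map_iff in H as (p & <- & _).
      apply in_map_iff in H' as (p' & E & _). congruence. }
  assert (HC : is_card (fun l => exists j, scc_at N l j /\ P (rank_at l j)) (length (map compose T))).
  { exists (map compose T). split; [|split; [|reflexivity]].
    - apply NoDup_map_NoDup_ForallPairs; auto.
      intros [c [A B]] [c' [A' B']] H H' E. apply HT in H, H'.
      apply compose_inj; auto; unfold bnd in *; tauto.
    - intros l. rewrite in_map_iff. split.
      + intros ([c [A B]] & <- & H). apply HT in H as (Hc & HA & HB & Hs & Hr).
        exists (length A). split.
        * apply scc_at_split. exists A, c, B. unfold bnd, compose in *; simpl. tauto.
        * apply HP. unfold rank_at, compose; simpl. rewrite length_app, length_rev. simpl. lia.
      + intros (j & H & HR). apply scc_at_split in H as (A & c & B & -> & -> & HA & HB & Hs).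
        exists (c, (A, B)). split; [reflexivity|]. apply HT.
        apply HP in HR. unfold rank_at in HR. rewrite length_app, length_rev in HR. simpl in HR.
        destruct (sorted_above _ _ HA) as [H1 H2], (sorted_above _ _ HB) as [H3 H4].
        unfold bnd. repeat split; auto; try lia.
        * eapply Forall_impl; [|exact H1]. intros; simpl in *; lia.
        * eapply Forall_impl; [|exact H3]. intros; simpl in *; lia. }
  rewrite (is_card_unique _ _ _ Hm HC), length_map. unfold T. clear.
  assert (G : forall s n, Z.of_nat (length (flat_map tl (seq s n))) =
    zsum (fun i => prs indle (Z.of_nat (s + i)) N (Z.of_nat N - Z.of_nat (s + i)) X) n).
  { intros s n. revert s. induction n as [|n IH]; intros s; [reflexivity|].
    rewrite zsum_shift. cbn [seq flat_map]. rewrite length_app, Nat2Z.inj_add, IH. f_equal.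
    - unfold tl. rewrite length_map, count_gen, Nat.add_0_r. reflexivity.
    - apply zsum_ext. intros i _. now rewrite Nat.add_succ_r. }
  rewrite G. apply zsum_ext. intros; reflexivity.
Qed.

(** No rank exceeds [N], so the full count is a cumulative count as well and needs no separate
    asymptotics. *)
Lemma scc_card_all (N m : nat) : is_card (scc N) m ->
  Z.of_nat m =
  zsum (fun c => prs indle (Z.of_nat c) N (Z.of_nat N - Z.of_nat c) (Z.of_nat N)) (S N).
Proof.
  intros (L & H1 & H2 & H3). apply (scc_card N (fun z => z <= Z.of_nat N)); [tauto|].
  exists L. split; [auto|split; [|auto]]. intros l. rewrite H2. unfold scc. split.
  - intros (j & Hj). exists j. split; [auto|].
    apply scc_at_split in Hj as (A & c & B & -> & -> & _ & HB & Hs).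
    apply sorted_above in HB. unfold rank_at. rewrite length_app, length_rev. simpl. lia.
  - intros (j & Hj & _). eauto.
Qed.

(** * Cumulative counts *)

(* [cum c n X]: pairs of strict partitions with parts > c, total n, rank <= X. *)
Definition cum (c n X : Z) : Z := prs indle c (Z.to_nat n) n X.

Lemma indle_neg n r : n < 0 -> indle n r = 0.
Proof. intros H. unfold indle. destruct (Z.eqb_spec n 0); [lia|reflexivity]. Qed.

Lemma indle_nonneg n r : 0 <= indle n r.
Proof. unfold indle. destruct (_ && _)%bool; lia. Qed.

Lemma cum_prs c n X (k : nat) : 0 <= c -> n <= Z.of_nat k -> prs indle c k n X = cum c n X.
Proof.
  intros Hc Hk. unfold cum. destruct (Z.lt_ge_cases n 0).
  - rewrite !prs_neg; auto using indle_neg.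
  - apply prs_stable; auto using indle_neg; lia.
Qed.

Lemma cum_nonneg c n X : 0 <= cum c n X.
Proof. apply prs_nonneg, indle_nonneg. Qed.

Lemma cum_neg c n X : 0 <= c -> n < 0 -> cum c n X = 0.
Proof. intros. apply prs_neg; auto using indle_neg. Qed.

Lemma cum_mono_rank c n X X' : X <= X' -> cum c n X <= cum c n X'.
Proof. apply prs_indle_mono. Qed.

(** Iterates [prs_incr]. The total 0 is excluded because of the empty pair: for [c >= 1] nothing has
    total 1. *)
Lemma cum_mono c n n' X X' : 0 <= c -> n <> 0 -> n <= n' -> X <= X' -> cum c n X <= cum c n' X'.
Proof.
  intros Hc Hn Hnn HX. destruct (Z.lt_ge_cases n 0).
  { rewrite cum_neg by auto. apply cum_nonneg. }
  apply Z.le_trans with (cum c n X'); [now apply cum_mono_rank|]. clear X HX.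
  replace n' with (n + Z.of_nat (Z.to_nat (n' - n))) by lia.
  induction (Z.to_nat (n' - n)) as [|i IH]; [rewrite Z.add_0_r; lia|].
  eapply Z.le_trans; [exact IH|].
  set (q := n + Z.of_nat i). replace (n + Z.of_nat (S i)) with (q + 1) by (unfold q; lia).
  pose proof (prs_incr indle c (Z.to_nat q) indle_nonneg q X') as H1.
  rewrite !cum_prs in H1 by lia.
  unfold indle in H1. destruct (Z.eqb_spec q 0), (Z.eqb_spec (q + 1) 0); simpl in H1; lia.
Qed.

(** Split by which of the two sets contain [c]. The four terms will turn out to be asymptotically
    equal. *)
Lemma cum_step c n X : 1 <= c ->
  cum (c - 1) n X =
  cum c n X + cum c (n - c) (X - 1) + cum c (n - c) (X + 1) + cum c (n - 2 * c) X.
Proof.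
  intros Hc. rewrite <- (cum_prs (c - 1) n X (S (Z.to_nat n))) by lia.
  rewrite prs_first. unfold addLR. rewrite !cum_prs by lia. reflexivity.
Qed.

(* Moving the central part into one of the two sides is injective. *)
Lemma central_tail (C j : nat) n X :
  zsum (fun i => cum (Z.of_nat (S C + i)) (n - Z.of_nat (S C + i)) X) j
    + cum (Z.of_nat (C + j)) n X <= cum (Z.of_nat C) n X.
Proof.
  induction j as [|j IH]; cbn [zsum].
  - rewrite Nat.add_0_r. lia.
  - replace (C + S j)%nat with (S C + j)%nat by lia.
    set (c := Z.of_nat (S C + j)) in *.
    assert (E : Z.of_nat (C + j) = c - 1) by (unfold c; lia). rewrite E in IH.
    rewrite (cum_step c) in IH by (unfold c; lia).
    pose proof (cum_nonneg c (n - c) (X - 1)). pose proof (cum_nonneg c (n - 2 * c) X).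
    (* The central part goes to the left set; this lowers the rank by 1, so the bound [X] is
       kept. *)
    pose proof (cum_mono_rank c (n - c) X (X + 1) ltac:(lia)). lia.
Qed.

Lemma cum_jacobi n X :
  cum 0 n X + cum 0 n (X + 1) = cum 0 n (X - 1) + cum 0 n X + part (n - tri X).
Proof.
  pose proof (jacobi_triple (Z.to_nat n) n X ltac:(lia)) as H.
  rewrite <- !prs_indle_diff in H. replace (X + 1 - 1) with X in H by lia.
  fold (cum 0 n X) (cum 0 n (X - 1)) (cum 0 n (X + 1)) in H. lia.
Qed.

Lemma cum_low n X : n + X < 0 -> cum 0 n X = 0.
Proof. apply prs_indle_low. lia. Qed.

Lemma scc_card_cum (N : nat) (P : Z -> Prop) (X : Z) (m : nat) : (forall z, P z <-> z <= X) ->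
  is_card (fun l => exists j, scc_at N l j /\ P (rank_at l j)) m ->
  Z.of_nat m = zsum (fun c => cum (Z.of_nat c) (Z.of_nat N - Z.of_nat c) X) (S N).
Proof.
  intros HP Hm. rewrite (scc_card N P X m HP Hm). apply zsum_ext. intros. apply cum_prs; lia.
Qed.

Lemma scc_card_all_cum (N m : nat) : is_card (scc N) m ->
  Z.of_nat m = zsum (fun c => cum (Z.of_nat c) (Z.of_nat N - Z.of_nat c) (Z.of_nat N)) (S N).
Proof.
  intros Hm. rewrite (scc_card_all N m Hm). apply zsum_ext. intros. apply cum_prs; lia.
Qed.

Close Scope Z_scope.

(** * Finite sums *)

Fixpoint rsum (f : nat -> R) (n : nat) : R :=
  match n with O => 0 | S k => rsum f k + f k end.

Lemma rsum_ext f g n : (forall i, (i < n)%nat -> f i = g i) -> rsum f n = rsum g n.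
Proof.
  induction n as [|n IH]; intros H; simpl; [reflexivity|].
  rewrite IH by (intros; apply H; lia). rewrite H by lia. reflexivity.
Qed.

Lemma rsum_plus f g n : rsum (fun i => f i + g i) n = rsum f n + rsum g n.
Proof. induction n; simpl; lra. Qed.

Lemma rsum_scal a f n : rsum (fun i => a * f i) n = a * rsum f n.
Proof. induction n; simpl; lra. Qed.

Lemma rsum_const a n : rsum (fun _ => a) n = INR n * a.
Proof. induction n; [simpl; lra|]. rewrite S_INR. simpl. lra. Qed.

Lemma rsum_le f g n : (forall i, (i < n)%nat -> f i <= g i) -> rsum f n <= rsum g n.
Proof.
  induction n as [|n IH]; intros H; simpl; [lra|].
  assert (rsum f n <= rsum g n) by (apply IH; intros; apply H; lia).
  specialize (H n ltac:(lia)). lra.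
Qed.

Lemma rsum_nonneg f n : (forall i, (i < n)%nat -> 0 <= f i) -> 0 <= rsum f n.
Proof.
  intros H. apply Rle_trans with (rsum (fun _ => 0) n).
  - rewrite rsum_const. lra.
  - now apply rsum_le.
Qed.

Lemma rsum_add f n m : rsum f (n + m) = rsum f n + rsum (fun i => f (n + i)%nat) m.
Proof.
  induction m as [|m IH]; simpl; [rewrite Nat.add_0_r; lra|].
  rewrite Nat.add_succ_r. simpl. lra.
Qed.

Lemma rsum_shift f n : rsum f (S n) = f O + rsum (fun i => f (S i)) n.
Proof. change (S n) with (1 + n)%nat. rewrite rsum_add. simpl. lra. Qed.

Lemma rsum_le_len f n m : (n <= m)%nat -> (forall i, (n <= i < m)%nat -> 0 <= f i) ->
  rsum f n <= rsum f m.
Proof.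
  intros Hn H. replace m with (n + (m - n))%nat by lia. rewrite rsum_add.
  assert (0 <= rsum (fun i => f (n + i)%nat) (m - n)) by (apply rsum_nonneg; intros; apply H; lia).
  lra.
Qed.

Lemma rsum_rev f n : rsum (fun i => f (n - 1 - i)%nat) n = rsum f n.
Proof.
  induction n as [|n IH]; [reflexivity|]. rewrite rsum_shift. simpl rsum at 2. rewrite <- IH.
  rewrite Rplus_comm. f_equal.
  - apply rsum_ext. intros i Hi. f_equal. lia.
  - f_equal. lia.
Qed.

Lemma IZR_zsum f n : IZR (zsum f n) = rsum (fun i => IZR (f i)) n.
Proof. induction n; simpl; [reflexivity|]. rewrite plus_IZR. lra. Qed.

(** * The Basel sum *)

Lemma sin_ge_xcos x : 0 < x < PI / 2 -> x * cos x <= sin x.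
Proof.
  intros Hx.
  destruct (MVT_gen (fun x => sin x - x * cos x) 0 x (fun x => x * sin x)) as (c & Hc & E).
  - intros y _. auto_derive; [auto|ring].
  - intros y _. apply continuity_pt_filterlim.
    apply (ex_derive_continuous (fun x => sin x - x * cos x)). auto_derive; auto.
  - rewrite Rmin_left, Rmax_right in Hc by lra.
    rewrite sin_0, Rmult_0_l in E.
    assert (0 <= sin c) by (apply sin_ge_0; lra).
    assert (0 <= c * sin c * (x - 0)) by (apply Rmult_le_pos; [apply Rmult_le_pos|]; lra).
    lra.
Qed.

(** The squares of [cot y <= 1 / y <= 1 / sin y]. *)
Lemma inv_sqr_bounds y : 0 < y < PI / 2 -> / (sin y)² - 1 <= / y² <= / (sin y)².
Proof.
  intros Hy. assert (Hs : 0 < sin y) by (apply sin_gt_0; lra).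
  pose proof (sin_lt_x y ltac:(lra)). pose proof (sin_ge_xcos y Hy).
  assert (0 < cos y) by (apply cos_gt_0; lra).
  pose proof (sin2_cos2 y) as HH. split.
  - assert (E : / (sin y)² - 1 = (cos y)² / (sin y)²).
    { replace ((cos y)²) with (1 - (sin y)²) by lra. field. apply Rgt_not_eq, Rlt_0_sqr. lra. }
    rewrite E. apply (Rmult_le_reg_r (y² * (sin y)²));
      [apply Rmult_lt_0_compat; apply Rlt_0_sqr; lra|].
    replace ((cos y)² / (sin y)² * (y² * (sin y)²)) with ((y * cos y)²)
      by (unfold Rsqr; field; lra).
    replace (/ y² * (y² * (sin y)²)) with ((sin y)²) by (unfold Rsqr; field; lra).
    apply Rsqr_incr_1; nra.
  - apply Rinv_le_contravar; [apply Rlt_0_sqr; lra|]. apply Rsqr_incr_1; lra.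
Qed.

Definition csc2 (x : R) : R := / (sin x)².

(** For [k < 2 ^ m] these are the odd multiples of [PI / 2 ^ (m + 2)] in the first quadrant. *)
Definition ang (m k : nat) : R := (2 * INR k + 1) * PI / 2 ^ (m + 2).

Lemma ang_bounds m k : (k < 2 ^ m)%nat -> 0 < ang m k < PI / 2.
Proof.
  intros H. unfold ang. assert (HP := PI_RGT_0). pose proof (pos_INR k).
  assert (H2 : INR k + 1 <= 2 ^ m).
  { rewrite <- S_INR. replace (2 ^ m) with (INR (2 ^ m)) by (rewrite pow_INR; reflexivity).
    apply le_INR. lia. }
  rewrite pow_add. assert (0 < 2 ^ m) by (apply pow_lt; lra). split.
  - apply Rdiv_lt_0_compat; nra.
  - apply (Rmult_lt_reg_r (2 ^ m * 2 ^ 2)); [nra|]. unfold Rdiv.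
    rewrite Rmult_assoc, Rinv_l by nra. nra.
Qed.

(** Pairing [y] with [PI / 2 - y] replaces two terms by [4 * csc2 (2 * y)]. The doubled angles of
    level [m + 1] run twice through the values of level [m], so each level multiplies the sum by
    4. *)
Lemma sum_csc2 m : rsum (fun k => csc2 (ang m k)) (2 ^ m) = 2 * 4 ^ m.
Proof.
  assert (D : forall y, 0 < y < PI / 2 -> csc2 y + csc2 (PI / 2 - y) = 4 * csc2 (2 * y)).
  { intros y Hy. unfold csc2. rewrite sin_shift, sin_2a.
    assert (0 < sin y) by (apply sin_gt_0; lra). assert (0 < cos y) by (apply cos_gt_0; lra).
    pose proof (sin2_cos2 y) as HH. unfold Rsqr in *. field_simplify; try lra.
    replace (sin y ^ 2 + cos y ^ 2) with 1 by lra. field. lra. }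
  assert (Rv : forall m k, (k < 2 ^ m)%nat -> ang m (2 ^ m - 1 - k) = PI / 2 - ang m k).
  { intros m0 k Hk. unfold ang. rewrite !minus_INR by lia. rewrite pow_INR. simpl (INR 2).
    simpl (INR 1). rewrite pow_add. simpl (2 ^ 2).
    replace (1 + 1) with 2 by ring. field. apply pow_nonzero. lra. }
  assert (Half : forall m, 2 * rsum (fun k => csc2 (ang m k)) (2 ^ m) =
            4 * rsum (fun k => csc2 (2 * ang m k)) (2 ^ m)).
  { intros m0. rewrite <- Rplus_diag. rewrite <- (rsum_rev (fun k => csc2 (ang m0 k))) at 2.
    rewrite <- rsum_plus, <- rsum_scal. apply rsum_ext. intros i Hi.
    rewrite Rv by auto. apply D. now apply ang_bounds. }
  induction m as [|m IH].
  - specialize (Half O). simpl rsum in *. unfold csc2, ang in *. simpl in *.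
    replace (2 * ((2 * 0 + 1) * PI / (2 * (2 * 1)))) with (PI / 2) in Half by field.
    rewrite sin_PI2 in Half. unfold Rsqr in Half at 2. lra.
  - assert (E : rsum (fun k => csc2 (2 * ang (S m) k)) (2 ^ S m) =
      2 * rsum (fun k => csc2 (ang m k)) (2 ^ m)).
    { replace (2 ^ S m)%nat with (2 ^ m + 2 ^ m)%nat by (simpl; lia).
      rewrite rsum_add, <- Rplus_diag. f_equal.
      - apply rsum_ext. intros i _. f_equal. unfold ang. simpl (S m + 2)%nat. simpl pow.
        field. apply pow_nonzero; lra.
      - rewrite <- (rsum_rev (fun k => csc2 (ang m k))). apply rsum_ext. intros i Hi.
        rewrite Rv by auto. unfold csc2. f_equal.
        replace (2 * ang (S m) (2 ^ m + i)) with (PI / 2 + ang m i).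
        + rewrite sin_plus, sin_minus, sin_PI2, cos_PI2. unfold Rsqr. ring.
        + unfold ang. rewrite plus_INR, pow_INR. simpl (INR 2). replace (1 + 1) with 2 by ring.
          simpl (S m + 2)%nat. rewrite <- tech_pow_Rmult, pow_add.
          field. apply pow_nonzero; lra. }
    specialize (Half (S m)). rewrite E, IH in Half. simpl pow. lra.
Qed.

Definition hsum (n : nat) : R := rsum (fun j => / (INR (S j))²) n.
Definition osum (n : nat) : R := rsum (fun k => / (2 * INR k + 1)²) n.

Lemma hsum_double n : hsum (2 * n) = osum n + hsum n / 4.
Proof.
  unfold hsum, osum. induction n as [|n IH]; [simpl; lra|].
  replace (2 * S n)%nat with (S (S (2 * n))) by lia. cbn [rsum]. rewrite IH.
  rewrite !S_INR, mult_INR. simpl (INR 2). pose proof (pos_INR n).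
  unfold Rsqr. field. repeat split; nra.
Qed.

(** [inv_sqr_bounds] loses at most 1 for each of the [2 ^ m] angles, against a total of
    [2 * 4 ^ m]. *)
Lemma osum_bounds m : PI² / 8 - PI² / 16 / 2 ^ m <= osum (2 ^ m) <= PI² / 8.
Proof.
  pose proof (sum_csc2 m) as H. pose proof PI_RGT_0.
  assert (H2 : 0 < 2 ^ m) by (apply pow_lt; lra).
  assert (H4 : 4 ^ m = 2 ^ m * 2 ^ m) by (rewrite <- Rpow_mult_distr; f_equal; lra).
  assert (E : osum (2 ^ m) = PI² / 16 / 4 ^ m * rsum (fun k => / (ang m k)²) (2 ^ m)).
  { unfold osum. rewrite <- rsum_scal. apply rsum_ext. intros k Hk.
    unfold ang. rewrite pow_add, H4. pose proof (pos_INR k). unfold Rsqr.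
    field. repeat split; nra. }
  assert (B1 : rsum (fun k => / (ang m k)²) (2 ^ m) <= 2 * 4 ^ m).
  { rewrite <- H. apply rsum_le. intros k Hk. apply inv_sqr_bounds. now apply ang_bounds. }
  assert (B2 : 2 * 4 ^ m - 2 ^ m <= rsum (fun k => / (ang m k)²) (2 ^ m)).
  { rewrite <- H.
    replace (2 ^ m) with (INR (2 ^ m) * 1) by (rewrite pow_INR; simpl (INR 2); rewrite Rmult_1_r; reflexivity).
    rewrite <- rsum_const.
    enough (rsum (fun k => csc2 (ang m k)) (2 ^ m) <=
      rsum (fun k => / (ang m k)²) (2 ^ m) + rsum (fun _ => 1) (2 ^ m)) by lra.
    rewrite <- rsum_plus. apply rsum_le. intros k Hk.
    pose proof (inv_sqr_bounds (ang m k) (ang_bounds m k Hk)). unfold csc2. lra. }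
  assert (P : 0 < PI² / 16 / 4 ^ m).
  { rewrite H4. unfold Rsqr. apply Rdiv_lt_0_compat; nra. }
  rewrite E. split.
  - apply Rle_trans with (PI² / 16 / 4 ^ m * (2 * 4 ^ m - 2 ^ m)).
    + apply Req_le. rewrite H4. unfold Rsqr. field. lra.
    + apply Rmult_le_compat_l; lra.
  - apply Rle_trans with (PI² / 16 / 4 ^ m * (2 * 4 ^ m)).
    + apply Rmult_le_compat_l; lra.
    + apply Req_le. rewrite H4. unfold Rsqr. field. lra.
Qed.

Definition zeta2 : R := PI² / 6.

Lemma zeta2_pos : 0 < zeta2.
Proof. unfold zeta2, Rsqr. pose proof PI_RGT_0. nra. Qed.

(** Monotonicity turns [hsum_double] into [3 / 4 * hsum n <= osum n], and [osum] is at most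
    [PI^2 / 8]. *)
Lemma hsum_le n : hsum n <= zeta2.
Proof.
  assert (M : forall n m, (n <= m)%nat -> osum n <= osum m).
  { intros a b Hab. apply rsum_le_len; auto. intros i _. left. apply Rinv_0_lt_compat.
    pose proof (pos_INR i). unfold Rsqr. nra. }
  assert (M' : hsum n <= hsum (2 * n)).
  { apply rsum_le_len; [lia|]. intros i _. left. apply Rinv_0_lt_compat.
    rewrite S_INR. pose proof (pos_INR i). unfold Rsqr. nra. }
  pose proof (M n (2 ^ n)%nat ltac:(pose proof (Nat.pow_gt_lin_r 2 n); lia)).
  pose proof (osum_bounds n). rewrite hsum_double in M'. unfold zeta2. lra.
Qed.

Lemma hsum_lim : is_lim_seq hsum zeta2.
Proof.
  assert (I : forall n, hsum n <= hsum (S n)).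
  { intros n. apply rsum_le_len; [lia|]. intros i _. left. apply Rinv_0_lt_compat.
    rewrite S_INR. pose proof (pos_INR i). unfold Rsqr. nra. }
  destruct (ex_finite_lim_seq_incr hsum zeta2 I hsum_le) as [h Hh].
  assert (HO : is_lim_seq (fun m => osum (2 ^ m)) (PI² / 8)).
  { apply is_lim_seq_le_le with (fun m => PI² / 8 - PI² / 16 * (/ 2) ^ m) (fun _ => PI² / 8).
    - intros m. pose proof (osum_bounds m). rewrite pow_inv. unfold Rdiv in *. lra.
    - replace (Finite (PI² / 8)) with (Finite (PI² / 8 - PI² / 16 * 0)) by (f_equal; lra).
      apply is_lim_seq_minus'; [apply is_lim_seq_const|].
      apply is_lim_seq_mult'; [apply is_lim_seq_const|].
      apply is_lim_seq_geom. rewrite Rabs_right; lra.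
    - apply is_lim_seq_const. }
  assert (P : filterlim (fun m => (2 ^ m)%nat) eventually eventually).
  { apply eventually_subseq. intros n. simpl. pose proof (Nat.pow_nonzero 2 n). lia. }
  assert (P2 : filterlim (fun m => (2 * 2 ^ m)%nat) eventually eventually).
  { apply eventually_subseq. intros n. simpl. pose proof (Nat.pow_nonzero 2 n). lia. }
  pose proof (is_lim_seq_subseq _ _ _ P Hh) as L1.
  pose proof (is_lim_seq_subseq _ _ _ P2 Hh) as L2.
  assert (L3 : is_lim_seq (fun m => hsum (2 * 2 ^ m)) (PI² / 8 + h * / 4)).
  { apply is_lim_seq_ext with (fun m => osum (2 ^ m) + hsum (2 ^ m) * / 4).
    - intros m. now rewrite hsum_double.
    - apply is_lim_seq_plus'; auto. apply is_lim_seq_mult'; auto. apply is_lim_seq_const. }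
  (* The limit satisfies [h = PI^2 / 8 + h / 4]. *)
  apply is_lim_seq_unique in L2, L3. rewrite L2 in L3. injection L3 as E.
  replace zeta2 with h by (unfold zeta2; lra). exact Hh.
Qed.

(** * Sums over pairs (d, j) weighted by d *)

(** For [F] vanishing beyond [n] this is the sum of [sigma(k) F(k)]. Keeping the pairs [(d, j)]
    apart allows summation over [d] for fixed [j]. *)
Definition dsum (F : nat -> R) (n : nat) : R :=
  rsum (fun d => rsum (fun j => INR (S d) * F (S d * S j)%nat) n) n.

Lemma dsum_le F G n : (forall k, (1 <= k)%nat -> F k <= G k) -> dsum F n <= dsum G n.
Proof.
  intros H. apply rsum_le. intros d _. apply rsum_le. intros j _.
  apply Rmult_le_compat_l; [apply pos_INR|]. apply H. nia.
Qed.

Lemma dsum_ext F G n : (forall k, F k = G k) -> dsum F n = dsum G n.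
Proof. intros H. apply Rle_antisym; apply dsum_le; intros; rewrite H; lra. Qed.

Lemma dsum_plus F G n : dsum (fun k => F k + G k) n = dsum F n + dsum G n.
Proof.
  unfold dsum. rewrite <- rsum_plus. apply rsum_ext. intros d _.
  rewrite <- rsum_plus. apply rsum_ext. intros. ring.
Qed.

Lemma dsum_scal a F n : dsum (fun k => a * F k) n = a * dsum F n.
Proof.
  unfold dsum. rewrite <- rsum_scal. apply rsum_ext. intros d _.
  rewrite <- rsum_scal. apply rsum_ext. intros. ring.
Qed.

(** Keeps only the cofactor 1, which amounts to [sigma(k) >= k]. *)
Lemma dsum_row F n L : (1 <= n)%nat -> (L <= n)%nat -> (forall k, (1 <= k)%nat -> 0 <= F k) ->
  rsum (fun d => INR (S d) * F (S d)) L <= dsum F n.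
Proof.
  intros Hn HL HF.
  assert (HF' : forall d j, 0 <= INR (S d) * F (S d * S j)%nat).
  { intros. apply Rmult_le_pos; [apply pos_INR|]. apply HF. nia. }
  apply Rle_trans with (rsum (fun d => rsum (fun j => INR (S d) * F (S d * S j)%nat) n) L).
  - apply rsum_le. intros d _. destruct n as [|n]; [lia|]. rewrite rsum_shift.
    rewrite Nat.mul_1_r. assert (0 <= rsum (fun i => INR (S d) * F (S d * S (S i))%nat) n)
      by (apply rsum_nonneg; intros; apply HF'). lra.
  - apply rsum_le_len; [auto|]. intros d _. apply rsum_nonneg. intros; apply HF'.
Qed.

Lemma geom_deriv x D :
  (1 - x)² * rsum (fun d => INR (S d) * x ^ S d) D = x - x ^ S D * (1 + INR D * (1 - x)).
Proof.
  induction D as [|D IH]; [simpl; unfold Rsqr; ring|].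
  cbn [rsum]. rewrite Rmult_plus_distr_l, IH, S_INR. unfold Rsqr. simpl. ring.
Qed.

Lemma exp_pow x n : exp x ^ n = exp (INR n * x).
Proof.
  induction n; [simpl; now rewrite Rmult_0_l, exp_0|].
  rewrite S_INR. simpl. rewrite IHn, <- exp_plus. f_equal. ring.
Qed.

(** With [x = exp (- v)] this reads [x / (1 - x)^2 <= 1 / v^2]; it amounts to
    [v <= 2 sinh (v / 2)]. *)
Lemma one_minus_exp v : 0 < v -> exp (- v) * v² <= (1 - exp (- v))².
Proof.
  intros Hv.
  assert (H : v <= exp (v / 2) - exp (- (v / 2))).
  { destruct (MVT_gen (fun x => exp x - exp (- x) - 2 * x) 0 (v / 2)
      (fun x => exp x + exp (- x) - 2)) as (c & Hc & E).
    - intros y _. auto_derive; [auto|ring].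
    - intros y _. apply continuity_pt_filterlim.
      apply (ex_derive_continuous (fun x => exp x - exp (- x) - 2 * x)). auto_derive; auto.
    - rewrite Ropp_0, exp_0 in E.
      pose proof (exp_pos c). assert (exp c * exp (- c) = 1) by (rewrite <- exp_plus, Rplus_opp_r; apply exp_0).
      assert (0 <= exp c + exp (- c) - 2) by (pose proof (Rle_0_sqr (exp c - 1)); unfold Rsqr in *; nra).
      nra. }
  assert (E : 1 - exp (- v) = exp (- (v / 2)) * (exp (v / 2) - exp (- (v / 2)))).
  { rewrite Rmult_minus_distr_l, <- !exp_plus. replace (- (v / 2) + v / 2) with 0 by ring.
    rewrite exp_0. do 2 f_equal. field. }
  rewrite E, Rsqr_mult. unfold Rsqr at 2. rewrite <- exp_plus.
  replace (- (v / 2) + - (v / 2)) with (- v) by field.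
  apply Rmult_le_compat_l; [left; apply exp_pos|]. apply Rsqr_incr_1; lra.
Qed.

Lemma dsum_swap F n :
  dsum F n = rsum (fun j => rsum (fun d => INR (S d) * F (S d * S j)%nat) n) n.
Proof.
  unfold dsum. generalize n at 2 3. intros m. induction m as [|m IH]; cbn [rsum].
  - induction n; cbn [rsum]; [reflexivity|lra].
  - rewrite IH, <- rsum_plus. apply rsum_ext. intros. reflexivity.
Qed.

Lemma dsum_exp_row u n j :
  rsum (fun d => INR (S d) * exp (- (u * INR (S d * S j)))) n =
  rsum (fun d => INR (S d) * exp (- (u * INR (S j))) ^ S d) n.
Proof.
  apply rsum_ext. intros d _. rewrite exp_pow, mult_INR. do 2 f_equal. ring.
Qed.

(** For fixed [j] the sum over [d] is at most [x / (1 - x)^2] with [x = exp (- u j)], hence at most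
    [1 / (u j)^2]. *)
Lemma dsum_exp_le u n : 0 < u -> dsum (fun k => exp (- (u * INR k))) n <= zeta2 / u².
Proof.
  intros Hu. rewrite dsum_swap.
  apply Rle_trans with (rsum (fun j => / u² * / (INR (S j))²) n).
  - apply rsum_le. intros j _. rewrite dsum_exp_row.
    assert (Hj : 0 < INR (S j)) by (apply lt_0_INR; lia).
    set (v := u * INR (S j)). assert (Hv : 0 < v) by (unfold v; nra).
    pose proof (geom_deriv (exp (- v)) n) as G. pose proof (one_minus_exp v Hv) as H1.
    set (x := exp (- v)) in *. assert (0 < x) by apply exp_pos.
    assert (Hx1 : x < 1) by (unfold x; rewrite <- exp_0; apply exp_increasing; lra).
    rewrite <- Rinv_mult, <- Rsqr_mult. fold v.
    assert (0 <= x ^ S n * (1 + INR n * (1 - x))).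
    { apply Rmult_le_pos; [apply pow_le; lra|]. pose proof (pos_INR n). nra. }
    set (s := rsum _ n) in *.
    assert (0 < v²) by (apply Rlt_0_sqr; lra).
    apply (Rmult_le_reg_r (v²)); [auto|]. rewrite Rinv_l by lra.
    assert (0 <= s) by (apply rsum_nonneg; intros; apply Rmult_le_pos; [apply pos_INR|apply pow_le; lra]).
    apply (Rmult_le_reg_l x); [auto|]. nra.
  - rewrite rsum_scal. fold (hsum n). pose proof (hsum_le n).
    assert (0 < / u²) by (apply Rinv_0_lt_compat, Rlt_0_sqr; lra). unfold Rdiv. nra.
Qed.

(** Controls the remainder left by cutting the sum over [d] at [n]. The reason is
    [exp (y / 2) >= 1 + y / 2], squared. *)
Lemma exp_quad y : 0 <= y -> exp (- y) * (1 + y) <= 4 / (y + 1).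
Proof.
  intros Hy. assert (H : 1 + y / 2 <= exp (y / 2)) by apply exp_ineq1_le.
  assert (E : exp y = (exp (y / 2))²) by (unfold Rsqr; rewrite <- exp_plus; f_equal; field).
  rewrite exp_Ropp. apply (Rmult_le_reg_r (exp y * (y + 1))).
  { apply Rmult_lt_0_compat; [apply exp_pos|lra]. }
  pose proof (exp_pos y).
  replace (/ exp y * (1 + y) * (exp y * (y + 1))) with ((1 + y)²) by (unfold Rsqr; field; lra).
  replace (4 / (y + 1) * (exp y * (y + 1))) with ((2 * exp (y / 2))²)
    by (rewrite Rsqr_mult, <- E; unfold Rsqr; field; lra).
  apply Rsqr_incr_1; lra.
Qed.

(** The converse of [dsum_exp_le] at [u = a / sqrt n]: finitely many [j] carry almost all of
    [zeta2], and for each of them the truncated sum over [d] is close to [1 / (u j)^2]. *)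
Lemma dsum_exp_ge a eps : 0 < a -> 0 < eps -> exists n0, forall n, (n0 <= n)%nat ->
  INR n * (zeta2 / a² - eps) <= dsum (fun k => exp (- (a / sqrt (INR n) * INR k))) n.
Proof.
  intros Ha He. assert (Ha2 : 0 < a²) by (apply Rlt_0_sqr; lra).
  pose proof hsum_lim as HL. apply is_lim_seq_spec in HL.
  assert (He2 : 0 < eps * a² / 2) by nra.
  destruct (HL (mkposreal _ He2)) as [J HJ]. specialize (HJ J (le_n _)). simpl in HJ.
  apply Rabs_def2 in HJ as [_ HJ].
  (* each of the first J rows is at least (n / (a j)^2) (x - e^{-y}(1+y)) with y >= a sqrt n *)
  assert (HB : exists n0, forall n, (n0 <= n)%nat -> (1 <= n)%nat /\ (J <= n)%nat /\
     a * INR J / sqrt (INR n) + 4 / (a * sqrt (INR n)) <= eps * a² / (2 * (zeta2 + 1))).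
  { pose proof zeta2_pos as Hz.
    assert (Hc : 0 < eps * a² / (2 * (zeta2 + 1))) by (apply Rdiv_lt_0_compat; nra).
    set (c := eps * a² / (2 * (zeta2 + 1))) in *.
    assert (HM : 0 <= (a * INR J + 4 / a) / c).
    { apply Rmult_le_pos; [|left; now apply Rinv_0_lt_compat].
      assert (0 < 4 / a) by (apply Rdiv_lt_0_compat; lra). pose proof (pos_INR J). nra. }
    destruct (INR_unbounded ((a * INR J + 4 / a) / c + 1)²) as [N0 HN0].
    exists (S (N0 + J)). intros n Hn. split; [lia|]. split; [lia|].
    assert (HS : (a * INR J + 4 / a) / c + 1 <= sqrt (INR n)).
    { rewrite <- (sqrt_Rsqr ((a * INR J + 4 / a) / c + 1)) by lra. apply sqrt_le_1_alt.
      left. eapply Rlt_le_trans; [exact HN0|]. apply le_INR. lia. }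
    set (s := sqrt (INR n)) in *. assert (0 < s) by lra.
    apply (Rmult_le_reg_r s); [auto|].
    replace ((a * INR J / s + 4 / (a * s)) * s) with ((a * INR J + 4 / a) / c * c) by (field; lra).
    rewrite (Rmult_comm c). apply Rmult_le_compat_r; lra. }
  destruct HB as [n0 HB]. exists n0. intros n Hn. destruct (HB n Hn) as (Hn1 & HJn & HS). clear HB.
  assert (HnR : 0 < INR n) by (apply lt_0_INR; lia).
  set (s := sqrt (INR n)) in *. assert (Hs : 0 < s) by (apply sqrt_lt_R0; auto).
  assert (Hss : s * s = INR n) by (apply sqrt_def; lra).
  (* The relative loss in a row: [1 - exp (- v) <= v <= a * J / s], and [4 / (a * s)] for the
     truncation. *)
  set (q := a * INR J / s + 4 / (a * s)) in *.
  rewrite dsum_swap.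
  apply Rle_trans with (rsum (fun j => INR n / a² * (1 - q) * / (INR (S j))²) J).
  - rewrite rsum_scal. fold (hsum J). pose proof (hsum_le J). pose proof zeta2_pos.
    assert (Hq : q * (zeta2 + 1) <= eps * a² / 2).
    { replace (eps * a² / 2) with (eps * a² / (2 * (zeta2 + 1)) * (zeta2 + 1)) by (field; lra).
      apply Rmult_le_compat_r; lra. }
    assert (0 <= q).
    { unfold q. apply Rplus_le_le_0_compat.
      - apply Rmult_le_pos; [|left; now apply Rinv_0_lt_compat]. pose proof (pos_INR J); nra.
      - apply Rlt_le, Rdiv_lt_0_compat; nra. }
    replace (INR n * (zeta2 / a² - eps)) with (INR n / a² * (zeta2 - eps * a²)) by (field; lra).
    rewrite Rmult_assoc. apply Rmult_le_compat_l.
    { left. apply Rdiv_lt_0_compat; auto. }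
    assert (0 <= hsum J) by (apply rsum_nonneg; intros; left; apply Rinv_0_lt_compat, Rlt_0_sqr, not_0_INR; lia).
    nra.
  - eapply Rle_trans; [|apply rsum_le_len; [exact HJn|]].
    2:{ intros j _. apply rsum_nonneg. intros. apply Rmult_le_pos; [apply pos_INR|left; apply exp_pos]. }
    apply rsum_le. intros j Hj. rewrite dsum_exp_row.
    assert (Hj1 : 1 <= INR (S j)) by (apply (le_INR 1); lia).
    assert (HjJ : INR (S j) <= INR J) by (apply le_INR; lia).
    set (v := a / s * INR (S j)).
    assert (Has : 0 < a / s) by (apply Rdiv_lt_0_compat; auto).
    assert (Hv : 0 < v) by (unfold v; nra).
    pose proof (geom_deriv (exp (- v)) n) as G.
    assert (Hx0 : 1 - v <= exp (- v)) by (pose proof (exp_ineq1_le (- v)); lra).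
    rewrite <- tech_pow_Rmult, (exp_pow (- v) n) in G.
    set (x := exp (- v)) in *. assert (0 < x) by apply exp_pos.
    assert (Hx1 : x < 1) by (unfold x; rewrite <- exp_0; apply exp_increasing; lra).
    set (y := INR n * v). assert (Hy : a * s <= y).
    { unfold y, v. replace (INR n * (a / s * INR (S j))) with (a * s * INR (S j)) by (rewrite <- Hss; field; lra).
      assert (0 < a * s) by nra. nra. }
    assert (0 < a * s) by nra.
    pose proof (exp_quad y ltac:(lra)) as HQ.
    replace (INR n * - v) with (- y) in G by (unfold y; ring).
    assert (H4 : 4 / (y + 1) <= 4 / (a * s)).
    { unfold Rdiv. apply Rmult_le_compat_l; [lra|]. apply Rinv_le_contravar; lra. }
    assert (Hvq : v <= a * INR J / s).
    { unfold v. replace (a * INR J / s) with (a / s * INR J) by (field; lra). nra. }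
    set (S1 := rsum _ n) in *.
    assert (HS1 : 1 - q <= v² * S1).
    { assert (HH : (1 - x)² * S1 <= v² * S1).
      { apply Rmult_le_compat_r.
        - apply rsum_nonneg. intros. apply Rmult_le_pos; [apply pos_INR|apply pow_le; lra].
        - apply Rsqr_incr_1; lra. }
      assert (x * exp (- y) * (1 + INR n * (1 - x)) <= exp (- y) * (1 + y)).
      { pose proof (exp_pos (- y)). assert (1 + INR n * (1 - x) <= 1 + y) by (unfold y; nra).
        assert (0 <= 1 + INR n * (1 - x)) by nra.
        apply Rle_trans with (1 * exp (- y) * (1 + INR n * (1 - x))).
        - apply Rmult_le_compat_r; [auto|]. apply Rmult_le_compat_r; lra.
        - rewrite Rmult_1_l. apply Rmult_le_compat_l; lra. }
      unfold q. lra. }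
    replace (INR n / a² * (1 - q) * / (INR (S j))²) with ((1 - q) / v²).
    + assert (0 < v²) by (apply Rlt_0_sqr; lra). apply (Rmult_le_reg_r (v²)); [auto|].
      replace ((1 - q) / v² * v²) with (1 - q) by (field; lra). lra.
    + unfold v. rewrite <- Hss. unfold Rsqr. field. repeat split; lra.
Qed.

(** * A priori bounds for partition numbers *)

(** Indexed by the distance below [n], since all estimates concern a window below a fixed [n]; zero
    for [k > n]. *)
Definition pn (n k : nat) : R := IZR (part (Z.of_nat n - Z.of_nat k)).
Definition dP (n k : nat) : R := pn n k - pn n (S k).

Lemma pn_S n k : pn n (S k) = pn n k - dP n k.
Proof. unfold dP. ring. Qed.

Lemma pn_D n k : pn n k = pn n 0 - rsum (dP n) k.
Proof. induction k; simpl; [ring|]. rewrite pn_S, IHk. ring. Qed.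

Lemma pn_shift n k h : pn (n + h) (k + h) = pn n k.
Proof. unfold pn. do 2 f_equal. lia. Qed.

Lemma dP_shift n k h : dP (n + h) (k + h) = dP n k.
Proof. unfold dP. rewrite <- !(pn_shift n _ h). reflexivity. Qed.

Lemma pn_sub n k i : (k <= n)%nat -> pn (n - k) i = pn n (i + k).
Proof. intros H. rewrite <- (pn_shift (n - k) i k). f_equal. lia. Qed.

Lemma dP_sub n k i : (k <= n)%nat -> dP (n - k) i = dP n (i + k).
Proof. intros H. rewrite <- (dP_shift (n - k) i k). f_equal. lia. Qed.

Lemma dP_nonneg n k : 0 <= dP n k.
Proof.
  unfold dP, pn. rewrite <- minus_IZR. apply (IZR_le 0).
  replace (Z.of_nat n - Z.of_nat (S k))%Z with (Z.of_nat n - Z.of_nat k - 1)%Z by lia.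
  pose proof (part_mono1 (Z.of_nat n - Z.of_nat k)). lia.
Qed.

Lemma pn_mono n k k' : (k <= k')%nat -> pn n k' <= pn n k.
Proof.
  induction 1 as [|k' _ IH]; [lra|]. rewrite pn_S. pose proof (dP_nonneg n k'). lra.
Qed.

Lemma pn_zero n k : (n < k)%nat -> pn n k = 0.
Proof. intros H. unfold pn. rewrite part_neg by lia. reflexivity. Qed.

Lemma pn_ge1 n k : (k <= n)%nat -> 1 <= pn n k.
Proof.
  intros H. apply Rle_trans with (pn n n); [|now apply pn_mono].
  unfold pn. rewrite Z.sub_diag. rewrite part_0. lra.
Qed.

Lemma pn_nonneg n k : 0 <= pn n k.
Proof.
  destruct (Nat.le_gt_cases k n); [pose proof (pn_ge1 n k H); lra|rewrite pn_zero by auto; lra].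
Qed.

Lemma pn0_pos n : 0 < pn n 0.
Proof. pose proof (pn_ge1 n 0 ltac:(lia)). lra. Qed.

(** From the argument 0 on, the differences are [1, 0, 1, 1, 2, ...]; the bound [2 <= m'] makes the
    isolated initial 1 harmless. *)
Lemma part_diff_mono m m' : (2 <= m')%Z -> (m <= m')%Z ->
  (part m - part (m - 1) <= part m' - part (m' - 1))%Z.
Proof.
  intros H2 Hm.
  assert (U : forall i m, (1 <= m)%Z ->
    (part m - part (m - 1) <= part (m + Z.of_nat i) - part (m + Z.of_nat i - 1))%Z).
  { intros i q Hq. induction i as [|i IH]; [rewrite Z.add_0_r; lia|].
    pose proof (part_convex (q + Z.of_nat i) ltac:(lia)).
    replace (q + Z.of_nat (S i))%Z with (q + Z.of_nat i + 1)%Z by lia.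
    replace (q + Z.of_nat i + 1 - 1)%Z with (q + Z.of_nat i)%Z by lia. lia. }
  destruct (Z.le_gt_cases 1 m).
  - specialize (U (Z.to_nat (m' - m)) m ltac:(lia)).
    replace (m + Z.of_nat (Z.to_nat (m' - m)))%Z with m' in U by lia. exact U.
  - specialize (U (Z.to_nat (m' - 2)) 2%Z ltac:(lia)).
    replace (2 + Z.of_nat (Z.to_nat (m' - 2)))%Z with m' in U by lia.
    assert (part 2 - part (2 - 1) = 1)%Z by reflexivity.
    destruct (Z.eq_dec m 0) as [->|].
    + assert (part 0 - part (0 - 1) = 1)%Z by reflexivity. lia.
    + rewrite !part_neg by lia. lia.
Qed.

Lemma dP_mono n k k' : (k + 2 <= n)%nat -> (k <= k')%nat -> dP n k' <= dP n k.
Proof.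
  intros H1 H2. unfold dP, pn. rewrite <- !minus_IZR. apply IZR_le.
  pose proof (part_diff_mono (Z.of_nat n - Z.of_nat k') (Z.of_nat n - Z.of_nat k)
    ltac:(lia) ltac:(lia)).
  replace (Z.of_nat n - Z.of_nat (S k'))%Z with (Z.of_nat n - Z.of_nat k' - 1)%Z by lia.
  replace (Z.of_nat n - Z.of_nat (S k))%Z with (Z.of_nat n - Z.of_nat k - 1)%Z by lia. lia.
Qed.

Lemma pn_euler n : INR n * pn n 0 = dsum (pn n) n.
Proof.
  unfold pn at 1. rewrite INR_IZR_INZ, Z.sub_0_r, <- mult_IZR, (part_euler _ n) by lia.
  rewrite IZR_zsum. apply rsum_ext. intros d _. rewrite IZR_zsum. apply rsum_ext. intros j _.
  rewrite mult_IZR, <- INR_IZR_INZ. unfold pn. do 3 f_equal. lia.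
Qed.

Lemma pn_euler1 n : (INR n - 1) * pn n 1 = dsum (fun k => pn n (S k)) n.
Proof.
  unfold pn at 1. change (Z.of_nat 1) with 1%Z.
  rewrite INR_IZR_INZ, <- minus_IZR, <- mult_IZR, (part_euler _ n) by lia.
  rewrite IZR_zsum. apply rsum_ext. intros d _. rewrite IZR_zsum. apply rsum_ext. intros j _.
  rewrite mult_IZR, <- INR_IZR_INZ. unfold pn. do 3 f_equal. lia.
Qed.

(** The recursions for [n] and [n - 1] subtracted. Divided by [n p(n)] it expresses the logarithmic
    difference as an average of earlier ones, with [pn n 1] as the error of order [1 / n]. *)
Lemma dP_euler n : dsum (dP n) n = INR n * dP n 0 + pn n 1.
Proof.
  rewrite (dsum_ext (dP n) (fun k => pn n k + (-1) * pn n (S k))) by (intros; unfold dP; ring).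
  rewrite dsum_plus, dsum_scal, <- pn_euler, <- pn_euler1. unfold dP. ring.
Qed.

Lemma nat_ceil x : 0 <= x -> exists h : nat, x <= INR h <= x + 1.
Proof.
  intros Hx. exists (Z.to_nat (up x)). destruct (archimed x) as [H1 H2].
  assert (0 <= up x)%Z by (apply le_IZR; simpl; lra).
  rewrite INR_IZR_INZ, Z2Nat.id by auto. lra.
Qed.

Lemma nat_floor x : 0 <= x -> exists h : nat, INR h <= x < INR h + 1.
Proof.
  intros Hx. exists (Z.to_nat (up x - 1)). destruct (archimed x) as [H1 H2].
  assert (0 < up x)%Z by (apply lt_IZR; simpl; lra).
  rewrite INR_IZR_INZ, Z2Nat.id, minus_IZR by lia. lra.
Qed.

Lemma sqrt_INR_ge1 n : (1 <= n)%nat -> 1 <= sqrt (INR n).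
Proof. intros H. rewrite <- sqrt_1. apply sqrt_le_1_alt, (le_INR 1), H. Qed.

Lemma sqrt_INR_sqr n : sqrt (INR n) * sqrt (INR n) = INR n.
Proof. apply sqrt_def, pos_INR. Qed.

Lemma sum_first h : rsum (fun d => INR (S d)) h = INR h * (INR h + 1) / 2.
Proof. induction h; [simpl; lra|]. cbn [rsum]. rewrite IHh, S_INR. field. Qed.

(** The terms [d p(n - d)] with [d <= h] sum to at least [p(n - h) h^2 / 2] and to at most
    [n p(n)]. *)
Lemma pn_half n h : (1 <= n)%nat -> 4 * INR n <= INR h * INR h -> 2 * pn n h <= pn n 0.
Proof.
  intros Hn Hh. destruct (Nat.le_gt_cases h n) as [Hhn|Hhn].
  - pose proof (dsum_row (pn n) n h Hn Hhn (fun k _ => pn_nonneg n k)) as H.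
    rewrite <- pn_euler in H.
    assert (H2 : rsum (fun d => pn n h * INR (S d)) h <= rsum (fun d => INR (S d) * pn n (S d)) h).
    { apply rsum_le. intros d Hd. rewrite Rmult_comm. apply Rmult_le_compat_l; [apply pos_INR|].
      apply pn_mono. lia. }
    rewrite rsum_scal, sum_first in H2. pose proof (pn_nonneg n h). pose proof (pos_INR h).
    assert (1 <= INR n) by (apply (le_INR 1); auto). 
    apply (Rmult_le_reg_l (INR n)); [lra|]. nra.
  - rewrite pn_zero by auto. pose proof (pn_nonneg n 0). lra.
Qed.

(** By [pn_half], half of [p(n)] is lost over at most [3 sqrt n] steps down, and by convexity the
    first of them loses most. *)
Lemma dP_lower n : (2 <= n)%nat -> pn n 0 <= 6 * sqrt (INR n) * dP n 0.
Proof.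
  intros Hn. pose proof (sqrt_INR_ge1 n ltac:(lia)) as Hs. pose proof (sqrt_INR_sqr n) as Hq.
  set (s := sqrt (INR n)) in *.
  destruct (nat_ceil (2 * s) ltac:(lra)) as [h Hh].
  pose proof (pn_half n h ltac:(lia) ltac:(nra)) as H1.
  assert (H2 : pn n 0 - pn n h <= INR h * dP n 0).
  { rewrite (pn_D n h), <- rsum_const.
    assert (rsum (dP n) h <= rsum (fun _ => dP n 0) h) by (apply rsum_le; intros; apply dP_mono; lia).
    lra. }
  pose proof (dP_nonneg n 0). nra.
Qed.

(** Iterates [dP_lower], which applies only down to the argument 2; the factor 2 pays for the last
    step, from 1 to 0. *)
Lemma pn_exp n k : (1 <= n)%nat ->
  pn n k <= 2 * exp (- (/ (6 * sqrt (INR n)) * INR k)) * pn n 0.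
Proof.
  intros Hn. pose proof (sqrt_INR_ge1 n Hn) as Hs. set (s := sqrt (INR n)) in *.
  set (u := / (6 * s)). assert (Hu : 0 < u <= / 6).
  { unfold u. split; [apply Rinv_0_lt_compat; lra|]. apply Rinv_le_contravar; lra. }
  pose proof (pn0_pos n) as H0.
  assert (H : forall k, (k + 1 <= n)%nat -> pn n k <= exp (- (u * INR k)) * pn n 0).
  { induction k0 as [|i IH]; intros Hi.
    - simpl INR. rewrite Rmult_0_r, Ropp_0, exp_0. lra.
    - specialize (IH ltac:(lia)).
      pose proof (dP_lower (n - i) ltac:(lia)) as HD.
      rewrite pn_sub, dP_sub in HD by lia. simpl in HD.
      assert (sqrt (INR (n - i)) <= s) by (apply sqrt_le_1_alt, le_INR; lia).
      pose proof (dP_nonneg n i).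
      assert (HD' : u * pn n i <= dP n i).
      { unfold u. apply (Rmult_le_reg_l (6 * s)); [lra|].
        rewrite <- Rmult_assoc, Rinv_r by lra. nra. }
      rewrite pn_S, S_INR, Rmult_plus_distr_l, Ropp_plus_distr, exp_plus, Rmult_1_r.
      pose proof (exp_ineq1_le (- u)). pose proof (pn_nonneg n i).
      apply Rle_trans with (exp (- u) * pn n i); [nra|].
      pose proof (exp_pos (- u)). nra. }
  pose proof (Rmult_lt_0_compat _ _ (exp_pos (- (u * INR k))) H0) as He.
  destruct (Nat.lt_trichotomy k n) as [Hk|[->|Hk]].
  - specialize (H k ltac:(lia)). lra.
  - destruct n as [|m]; [lia|]. specialize (H m ltac:(lia)).
    assert (pn (S m) (S m) <= pn (S m) m) by (apply pn_mono; lia).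
    rewrite S_INR in *.
    replace (- (u * INR m)) with (- (u * (INR m + 1)) + u) in H by ring.
    rewrite exp_plus in H.
    assert (exp u <= 2).
    { pose proof (exp_ineq1_le (- u)). rewrite exp_Ropp in H2. pose proof (exp_pos u).
      apply (Rmult_le_compat_r (exp u)) in H2; [|lra]. rewrite Rinv_l in H2 by lra. nra. }
    nra.
  - rewrite pn_zero by auto. nra.
Qed.

Lemma exp_le_mono x y : x <= y -> exp x <= exp y.
Proof. intros [H|H]; [left; now apply exp_increasing|rewrite H; lra]. Qed.

(** The terms with [k <= h] cannot carry the Euler recursion alone: they give at most half of
    [n p(n)]. The others give at most [384 n p(n - h)]. *)
Lemma pn_ratio n h : (1 <= n)%nat -> 4 * INR h <= sqrt (INR n) -> pn n 0 <= 768 * pn n h.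
Proof.
  intros Hn Hh. pose proof (sqrt_INR_ge1 n Hn) as Hs. pose proof (sqrt_INR_sqr n) as Hq.
  pose proof (pn0_pos n) as H0. set (s := sqrt (INR n)) in *.
  assert (Hhn : (h < n)%nat) by (apply INR_lt; nra).
  (* For [k <= h] the first term exceeds [p(n)], as [4 k / s <= 1] and [e <= 3]. For [k > h] the
     second comes from [pn_exp] at [n - h], with 4 in place of 2 to make up for the shift by [h]. *)
  assert (T : forall k, (1 <= k)%nat -> pn n k <=
    3 * pn n 0 * exp (- (4 / s * INR k)) + 4 * pn n h * exp (- (/ (6 * s) * INR k))).
  { intros k Hk.
    pose proof (exp_pos (- (4 / s * INR k))). pose proof (exp_pos (- (/ (6 * s) * INR k))).
    pose proof (pn_nonneg n h). pose proof (pn_nonneg n k).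
    destruct (Nat.le_gt_cases k h) as [Hkh|Hkh].
    - assert (pn n k <= pn n 0) by (apply pn_mono; lia).
      assert (1 <= 3 * exp (- (4 / s * INR k))).
      { assert (Hm1 : exp (Ropp 1) <= exp (- (4 / s * INR k))).
        { apply exp_le_mono.
          assert (HH : 4 * INR k <= s) by (apply le_INR in Hkh; lra).
          replace (4 / s * INR k) with (4 * INR k / s) by (field; lra).
          enough (4 * INR k / s <= 1) by lra. apply (Rmult_le_reg_r s); [lra|].
          replace (4 * INR k / s * s) with (4 * INR k) by (field; lra). lra. }
        pose proof exp_le_3. rewrite (exp_Ropp 1) in Hm1. pose proof (exp_pos 1).
        assert (/ 3 <= / exp 1) by (apply Rinv_le_contravar; lra). lra. }
      nra.
    - replace k with ((k - h) + h)%nat at 1 by lia.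
      replace n with ((n - h) + h)%nat at 1 by lia. rewrite pn_shift.
      pose proof (pn_exp (n - h) (k - h) ltac:(lia)) as HE.
      rewrite (pn_sub n h 0) in HE by lia. rewrite Nat.add_0_l in HE.
      assert (Hs' : 1 <= sqrt (INR (n - h)) <= s).
      { split; [apply sqrt_INR_ge1; lia|]. apply sqrt_le_1_alt, le_INR; lia. }
      assert (HX : exp (- (/ (6 * sqrt (INR (n - h))) * INR (k - h))) <=
        2 * exp (- (/ (6 * s) * INR k))).
      { assert (L : / (6 * s) <= / (6 * sqrt (INR (n - h)))) by (apply Rinv_le_contravar; lra).
        assert (M : / (6 * s) * INR h <= / 24).
        { apply (Rmult_le_reg_l (24 * s)); [lra|].
          replace (24 * s * (/ (6 * s) * INR h)) with (4 * INR h) by (field; lra).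
          replace (24 * s * / 24) with s by field. lra. }
        apply Rle_trans with (exp (/ 24 + - (/ (6 * s) * INR k))).
        - assert (HL : - (/ (6 * sqrt (INR (n - h))) * INR (k - h)) <= / 24 + - (/ (6 * s) * INR k)).
          { pose proof (Rmult_le_compat_r _ _ _ (pos_INR (k - h)) L) as HP.
            rewrite (minus_INR k h) in * by lia. lra. }
          now apply exp_le_mono.
        - rewrite exp_plus. apply Rmult_le_compat_r; [lra|].
          pose proof (exp_ineq1_le (- / 24)) as HH. rewrite exp_Ropp in HH.
          pose proof (exp_pos (/ 24)).
          apply (Rmult_le_compat_r (exp (/ 24))) in HH; [|lra]. rewrite Rinv_l in HH by lra. lra. }
      pose proof (Rmult_le_compat_r (pn n h) _ _ ltac:(auto) HX).
      assert (0 < pn n 0 * exp (- (4 / s * INR k))) by (apply Rmult_lt_0_compat; auto). lra. }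
  pose proof (dsum_le _ _ n T) as HS. rewrite dsum_plus, !dsum_scal, <- pn_euler in HS.
  assert (Hu1 : 0 < 4 / s) by (apply Rdiv_lt_0_compat; lra).
  assert (Hu2 : 0 < / (6 * s)) by (apply Rinv_0_lt_compat; lra).
  pose proof (dsum_exp_le _ n Hu1) as B1. pose proof (dsum_exp_le _ n Hu2) as B2.
  replace (zeta2 / (4 / s)²) with (zeta2 / 16 * INR n) in B1 by (rewrite <- Hq; unfold Rsqr; field; lra).
  replace (zeta2 / (/ (6 * s))²) with (36 * zeta2 * INR n) in B2 by (rewrite <- Hq; unfold Rsqr; field; lra).
  (* [PI <= 4] is precise enough: the two sums become at most [n / 6] and [96 n]. *)
  assert (Hz : 0 < zeta2 <= 8 / 3).
  { split; [apply zeta2_pos|]. unfold zeta2, Rsqr. pose proof PI_4. pose proof PI_RGT_0. nra. }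
  assert (HN : 1 <= INR n) by (apply (le_INR 1); auto).
  pose proof (pn_nonneg n h).
  set (X1 := dsum _ n) in *. set (X2 := dsum (fun k => exp (- (/ (6 * s) * INR k))) n) in *.
  assert (X1 <= INR n / 6) by nra. assert (X2 <= 96 * INR n) by nra.
  apply (Rmult_le_reg_l (INR n)); [lra|].
  assert (3 * pn n 0 * X1 <= INR n * pn n 0 / 2) by nra.
  assert (4 * pn n h * X2 <= 384 * (INR n * pn n h)) by nra. lra.
Qed.

(* 24576 = 16 * 2 * 768: a window of length at least sqrt n / 16, and the constants of
   [pn_exp] and [pn_ratio]. *)
Definition CD : R := 24576.

(** By convexity [dP n k] is at most the mean of the [h] differences above it, so [h * dP n k] is at
    most a value of [p] slightly higher up; [pn_exp] and [pn_ratio] relate that value to [p(n)]. *)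
Lemma dP_exp n k : (256 <= n)%nat ->
  sqrt (INR n) * dP n k <= CD * exp (- (/ (12 * sqrt (INR n)) * INR k)) * pn n 0.
Proof.
  intros Hn.
  assert (Hs : 16 <= sqrt (INR n)).
  { replace 16 with (sqrt (16 * 16)) by (apply sqrt_square; lra). apply sqrt_le_1_alt.
    apply le_INR in Hn. replace (INR 256) with 256 in Hn by (simpl; lra). lra. }
  pose proof (sqrt_INR_sqr n) as Hq. pose proof (pn0_pos n) as H0. set (s := sqrt (INR n)) in *.
  destruct (nat_floor (s / 8) ltac:(lra)) as [h Hh].
  (* The extra 1 keeps the larger differences at arguments at least 2, as [dP_mono] requires, even
     for [k = n]. *)
  set (N := (n + (h + 1))%nat).
  assert (HNR : INR N = INR n + INR h + 1) by (unfold N; rewrite !plus_INR; simpl; ring).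
  pose proof (sqrt_INR_sqr N) as HqN. pose proof (sqrt_pos (INR N)).
  assert (HsN : s <= sqrt (INR N) <= 2 * s).
  { split; [apply sqrt_le_1_alt; rewrite HNR; pose proof (pos_INR h); lra|].
    rewrite <- (sqrt_Rsqr (2 * s)) by lra. apply sqrt_le_1_alt. unfold Rsqr. nra. }
  assert (HN : (1 <= N)%nat) by (unfold N; lia).
  assert (R1 : pn N 0 <= 768 * pn n 0).
  { replace (pn n 0) with (pn N (h + 1)) by (unfold N; apply (pn_shift n 0)).
    apply pn_ratio; [auto|]. rewrite plus_INR. simpl. lra. }
  assert (R2 : INR h * dP n k <= pn N k).
  { destruct (Nat.le_gt_cases k n) as [Hk|Hk].
    - apply Rle_trans with (pn N k - pn N (k + h)).
      + rewrite (pn_D N (k + h)), (pn_D N k), <- rsum_const, rsum_add.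
        assert (rsum (fun _ => dP n k) h <= rsum (fun i => dP N (k + i)) h).
        { apply rsum_le. intros i Hi. rewrite <- (dP_shift n k (h + 1)). fold N.
          apply dP_mono; unfold N; lia. }
        lra.
      + pose proof (pn_nonneg N (k + h)). lra.
    - unfold dP. rewrite !pn_zero by lia. pose proof (pn_nonneg N k). lra. }
  pose proof (pn_exp N k HN) as R3.
  assert (R4 : exp (- (/ (6 * sqrt (INR N)) * INR k)) <= exp (- (/ (12 * s) * INR k))).
  { assert (L : / (12 * s) <= / (6 * sqrt (INR N))) by (apply Rinv_le_contravar; lra).
    assert (HL : - (/ (6 * sqrt (INR N)) * INR k) <= - (/ (12 * s) * INR k))
      by (pose proof (pos_INR k); nra).
    now apply exp_le_mono. }
  pose proof (exp_pos (- (/ (12 * s) * INR k))) as He.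
  set (e1 := exp (- (/ (12 * s) * INR k))) in *.
  assert (R5 : pn N k <= 1536 * e1 * pn n 0).
  { eapply Rle_trans; [exact R3|]. pose proof (pn0_pos N).
    apply Rle_trans with (2 * e1 * pn N 0); [nra|]. nra. }
  pose proof (dP_nonneg n k). unfold CD. nra.
Qed.

Lemma one_minus_ge_exp x : 0 <= x <= 1 / 2 -> exp (- (x + 2 * x²)) <= 1 - x.
Proof.
  intros Hx. apply Rle_trans with (exp (- (x / (1 - x)))).
  - apply exp_le_mono, Ropp_le_contravar. unfold Rsqr.
    apply (Rmult_le_reg_r (1 - x)); [lra|].
    replace (x / (1 - x) * (1 - x)) with x by (field; lra). nra.
  - rewrite exp_Ropp. pose proof (exp_ineq1_le (x / (1 - x))) as H.
    replace (1 + x / (1 - x)) with (/ (1 - x)) in H by (field; lra).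
    pose proof (exp_pos (x / (1 - x))). set (E := exp _) in *.
    apply (Rmult_le_compat_r (1 - x)) in H; [|lra]. rewrite Rinv_l in H by lra.
    apply (Rmult_le_reg_l E); [auto|]. rewrite Rinv_r by lra. lra.
Qed.

(** [p(n - k) / p(n)] is a telescoping product of factors [1 - x] with [x = dP n i / pn n i]. The
    reverse bound [pn_prod_ge] costs a term quadratic in [x]. *)
Lemma pn_prod_le n k : (k <= n)%nat -> pn n k <= exp (- rsum (fun i => dP n i / pn n i) k) * pn n 0.
Proof.
  induction k as [|k IH]; intros Hk.
  - simpl. rewrite Ropp_0, exp_0. lra.
  - specialize (IH ltac:(lia)). cbn [rsum]. rewrite Ropp_plus_distr, exp_plus, pn_S.
    pose proof (pn_ge1 n k ltac:(lia)) as Hp.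
    set (x := dP n k / pn n k). pose proof (exp_ineq1_le (- x)).
    replace (pn n k - dP n k) with ((1 - x) * pn n k) by (unfold x; field; lra).
    apply Rle_trans with (exp (- x) * pn n k); [apply Rmult_le_compat_r; lra|].
    pose proof (exp_pos (- x)). nra.
Qed.

Lemma pn_prod_ge n k : (k <= n)%nat -> (forall i, (i < k)%nat -> dP n i / pn n i <= 1 / 2) ->
  exp (- rsum (fun i => dP n i / pn n i + 2 * (dP n i / pn n i)²) k) * pn n 0 <= pn n k.
Proof.
  induction k as [|k IH]; intros Hk HD.
  - simpl. rewrite Ropp_0, exp_0. lra.
  - specialize (IH ltac:(lia) ltac:(intros; apply HD; lia)).
    cbn [rsum]. rewrite Ropp_plus_distr, exp_plus, pn_S.
    pose proof (pn_ge1 n k ltac:(lia)) as Hp. specialize (HD k ltac:(lia)).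
    assert (Hx0 : 0 <= dP n k / pn n k).
    { apply Rmult_le_pos; [apply dP_nonneg|left; apply Rinv_0_lt_compat; lra]. }
    set (x := dP n k / pn n k) in *. pose proof (one_minus_ge_exp x ltac:(lra)).
    replace (pn n k - dP n k) with ((1 - x) * pn n k) by (unfold x; field; lra).
    pose proof (exp_pos (- (x + 2 * x²))).
    apply Rle_trans with (exp (- (x + 2 * x²)) * pn n k); [|apply Rmult_le_compat_r; lra].
    nra.
Qed.

(** * The logarithmic derivative of the partition function *)

Definition theta (n : nat) : R := sqrt (INR n) * (dP n 0 / pn n 0).

Lemma sqrt_unbounded M : exists N, forall n, (N <= n)%nat -> M <= sqrt (INR n).
Proof.
  destruct (INR_unbounded M²) as [N HN]. exists N. intros n Hn.
  destruct (Rle_lt_dec M 0) as [H|H]; [pose proof (sqrt_pos (INR n)); lra|].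
  rewrite <- (sqrt_Rsqr M) by lra. apply sqrt_le_1_alt. apply le_INR in Hn. lra.
Qed.

Lemma CD_pos : 0 < CD.
Proof. unfold CD. lra. Qed.

Lemma theta_upper n : (256 <= n)%nat -> theta n <= CD.
Proof.
  intros Hn. unfold theta. pose proof (dP_exp n 0 Hn) as H. pose proof (pn0_pos n).
  simpl INR in H. rewrite Rmult_0_r, Ropp_0, exp_0 in H.
  apply (Rmult_le_reg_r (pn n 0)); [auto|].
  replace (sqrt (INR n) * (dP n 0 / pn n 0) * pn n 0) with (sqrt (INR n) * dP n 0) by (field; lra).
  lra.
Qed.

Lemma theta_lower n : (2 <= n)%nat -> / 6 <= theta n.
Proof.
  intros Hn. unfold theta. pose proof (dP_lower n Hn) as H. pose proof (pn0_pos n).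
  apply (Rmult_le_reg_r (6 * pn n 0)); [lra|].
  replace (sqrt (INR n) * (dP n 0 / pn n 0) * (6 * pn n 0)) with (6 * sqrt (INR n) * dP n 0)
    by (field; lra). lra.
Qed.

Lemma theta_sub n k : (k <= n)%nat -> theta (n - k) * pn n k = sqrt (INR (n - k)) * dP n k.
Proof.
  intros Hk. unfold theta. rewrite pn_sub, dP_sub, Nat.add_0_l by auto.
  pose proof (pn_ge1 n k Hk). field. lra.
Qed.

(** The second [e] pays for replacing [sqrt (n - k)] by [sqrt n]; in [window_theta_ge] this
    replacement goes in the favourable direction. *)
Lemma window_theta_le a e K N : 0 < a -> 0 < e -> 0 < K ->
  (forall n, (N <= n)%nat -> theta n <= a + e) ->
  exists M, forall n, M <= sqrt (INR n) -> forall k, INR k <= K * sqrt (INR n) ->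
    sqrt (INR n) * dP n k <= (a + 2 * e) * pn n k.
Proof.
  intros Ha He HK H.
  (* [2 * e * (a + e)] lies below [(a + 2 * e)^2 - (a + e)^2], so the last term gives [(a + e) *
     sqrt n <= (a + 2 * e) * sqrt (n - k)]. *)
  exists (K + 1 + INR N + (a + 2 * e)² * K / (2 * e * (a + e))). intros n Hn k Hk.
  assert (Hc : 0 < 2 * e * (a + e)) by nra.
  assert (0 <= (a + 2 * e)² * K / (2 * e * (a + e))).
  { apply Rmult_le_pos; [pose proof (Rle_0_sqr (a + 2 * e)); nra|left; now apply Rinv_0_lt_compat]. }
  pose proof (pos_INR N) as HN0. pose proof (sqrt_INR_sqr n) as Hq. set (s := sqrt (INR n)) in *.
  assert (Hkn : (k <= n)%nat) by (apply INR_le; nra).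
  assert (HNk : (N <= n - k)%nat) by (apply INR_le; rewrite minus_INR by auto; nra).
  specialize (H _ HNk). pose proof (theta_sub n k Hkn) as HT.
  pose proof (dP_nonneg n k). pose proof (pn_ge1 n k Hkn).
  assert (HR : (a + e) * s <= (a + 2 * e) * sqrt (INR (n - k))).
  { apply Rsqr_incr_0_var; [|apply Rmult_le_pos; [lra|apply sqrt_pos]].
    rewrite !Rsqr_mult, (Rsqr_sqrt (INR (n - k))) by apply pos_INR.
    rewrite minus_INR by auto. unfold Rsqr at 2. rewrite Hq.
    assert ((a + 2 * e)² * K <= 2 * e * (a + e) * s).
    { replace ((a + 2 * e)² * K) with (2 * e * (a + e) * ((a + 2 * e)² * K / (2 * e * (a + e))))
        by (field; lra). apply Rmult_le_compat_l; lra. }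
    assert ((a + 2 * e)² * INR k <= (a + 2 * e)² * (K * s))
      by (apply Rmult_le_compat_l; [apply Rle_0_sqr|auto]).
    assert (0 <= s) by apply sqrt_pos.
    assert ((a + 2 * e)² * (K * s) <= 2 * e * (a + e) * INR n) by nra.
    unfold Rsqr in *. nra. }
  apply (Rmult_le_reg_l (a + e)); [lra|].
  apply Rle_trans with ((a + 2 * e) * (sqrt (INR (n - k)) * dP n k)); [nra|].
  rewrite <- HT. assert (theta (n - k) * pn n k <= (a + e) * pn n k) by (apply Rmult_le_compat_r; lra).
  nra.
Qed.

Lemma window_theta_ge b K N : 0 < K -> 
  (forall n, (N <= n)%nat -> b <= theta n) ->
  exists M, forall n, M <= sqrt (INR n) -> forall k, INR k <= K * sqrt (INR n) ->
    b * pn n k <= sqrt (INR n) * dP n k.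
Proof.
  intros HK H. exists (K + 1 + INR N). intros n Hn k Hk.
  pose proof (pos_INR N) as HN0. pose proof (sqrt_INR_sqr n) as Hq. set (s := sqrt (INR n)) in *.
  assert (Hkn : (k <= n)%nat) by (apply INR_le; nra).
  assert (HNk : (N <= n - k)%nat) by (apply INR_le; rewrite minus_INR by auto; nra).
  specialize (H _ HNk). pose proof (theta_sub n k Hkn) as HT.
  pose proof (dP_nonneg n k). pose proof (pn_ge1 n k Hkn).
  assert (sqrt (INR (n - k)) <= s) by (apply sqrt_le_1_alt, le_INR; lia).
  nra.
Qed.

(** The summand [2 * K] keeps [n - i] above [n / 4], 64 then keeps it above 256 for [theta_upper],
    and [4 * CD] makes the resulting ratio at most [1 / 2]. *)
Lemma window_P K n i : 0 < K -> 2 * K + 64 + 4 * CD <= sqrt (INR n) -> INR i <= K * sqrt (INR n) ->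
  (i <= n)%nat /\ dP n i / pn n i <= 2 * CD / sqrt (INR n).
Proof.
  intros HK Hn Hi. pose proof CD_pos. pose proof (sqrt_INR_sqr n) as Hq.
  set (s := sqrt (INR n)) in *.
  assert (Hin : (i <= n)%nat) by (apply INR_le; nra). split; [auto|].
  assert (H4 : INR n / 4 <= INR (n - i)) by (rewrite minus_INR by auto; nra).
  assert (H256 : (256 <= n - i)%nat).
  { apply INR_le. replace (INR 256) with 256 by (simpl; lra). nra. }
  assert (Hs : s <= 2 * sqrt (INR (n - i))).
  { apply Rsqr_incr_0_var; [|pose proof (sqrt_pos (INR (n - i))); lra].
    rewrite Rsqr_mult, (Rsqr_sqrt (INR (n - i))) by apply pos_INR. unfold Rsqr. lra. }
  pose proof (theta_upper _ H256) as HT. pose proof (theta_sub n i Hin) as HE.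
  pose proof (pn_ge1 n i Hin). pose proof (dP_nonneg n i).
  apply (Rmult_le_reg_r (pn n i * s)); [nra|].
  replace (dP n i / pn n i * (pn n i * s)) with (s * dP n i) by (field; lra).
  replace (2 * CD / s * (pn n i * s)) with (2 * (CD * pn n i)) by (field; lra). nra.
Qed.

Lemma window_P_low K n k : 0 < K -> 2 * K + 64 + 4 * CD <= sqrt (INR n) ->
  INR k <= K * sqrt (INR n) -> exp (- (4 * CD * K)) * pn n 0 <= pn n k.
Proof.
  intros HK Hn Hk. pose proof CD_pos as HC. destruct (window_P K n k HK Hn Hk) as [Hkn _].
  assert (W : forall i, (i < k)%nat -> 0 <= dP n i / pn n i <= 2 * CD / sqrt (INR n)).
  { intros i Hi. assert (INR i <= K * sqrt (INR n)) by (apply lt_INR in Hi; lra). split.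
    - pose proof (pn_ge1 n i ltac:(lia)). apply Rmult_le_pos; [apply dP_nonneg|].
      left. apply Rinv_0_lt_compat. lra.
    - now apply (window_P K). }
  set (s := sqrt (INR n)) in *.
  assert (He : 2 * CD / s <= 1 / 2).
  { apply (Rmult_le_reg_r s); [lra|].
    replace (2 * CD / s * s) with (2 * CD) by (field; lra). lra. }
  eapply Rle_trans; [|apply pn_prod_ge; [auto|intros i Hi; specialize (W i Hi); lra]].
  apply Rmult_le_compat_r; [apply pn_nonneg|]. apply exp_le_mono, Ropp_le_contravar.
  apply Rle_trans with (rsum (fun _ => 4 * CD / s) k).
  - apply rsum_le. intros i Hi. specialize (W i Hi). unfold Rsqr.
    replace (4 * CD / s) with (2 * (2 * CD / s)) by (field; lra). nra.
  - rewrite rsum_const. apply Rle_trans with (K * s * (4 * CD / s)).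
    + apply Rmult_le_compat_r; [|auto]. apply Rlt_le, Rdiv_lt_0_compat; lra.
    + apply Req_le. field. lra.
Qed.

(** * From weighted averages to averages over windows *)

Lemma count_le y L : 0 <= y ->
  rsum (fun d => if Rle_dec (INR (S d)) y then 1 else 0) L <= y.
Proof.
  intros Hy.
  enough (forall L, rsum (fun d => if Rle_dec (INR (S d)) y then 1 else 0) L <= y /\
    rsum (fun d => if Rle_dec (INR (S d)) y then 1 else 0) L <= INR L) by apply H.
  clear L. induction L as [|L [IH1 IH2]]; [simpl; lra|].
  rewrite S_INR. cbn [rsum]. destruct (Rle_dec (INR (S L)) y) as [H|H]; [|lra].
  rewrite S_INR in H. lra.
Qed.

Lemma exp_neg_le X : 0 < X -> exp (- X) <= / X.
Proof.
  intros H. rewrite exp_Ropp. apply Rinv_le_contravar; [auto|].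
  pose proof (exp_ineq1_le X). lra.
Qed.

(* If B is nonnegative up to a tail and its weighted average over the Euler recursion is small,
   then its plain average over a window of length K sqrt n is small. *)
Lemma window_sum K eps C : 0 < K -> 0 < eps -> 0 < C ->
  exists E1 K' M, 0 < E1 /\ 0 < K' /\ forall n B, M <= sqrt (INR n) ->
    dsum B n <= E1 * INR n * pn n 0 ->
    (forall k, - (C * exp (- (/ (12 * sqrt (INR n)) * INR k)) * pn n 0) <= B k) ->
    (forall k, INR k <= K' * sqrt (INR n) -> 0 <= B k) ->
    (forall k, B k <= C * pn n 0) ->
    forall k, INR k <= K * sqrt (INR n) -> rsum (fun i => B i / pn n i) k <= eps * sqrt (INR n).
Proof.
  intros HK He HC. pose proof CD_pos as HCD. pose proof zeta2_pos as Hz.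
  (* [rho] bounds [p(n - i) / p(n)] below on the window, so the aim is
     [rsum B k <= e0 * sqrt n * p(n)]. Indices up to [eta * sqrt n] contribute a quarter of it
     through [B <= C * p(n)]; beyond them the weight exceeds [eta * sqrt n], and the weighted bound
     [E' * n * p(n)] gives another quarter. [X] keeps the tail correction below half of [E']. *)
  set (rho := exp (- (4 * CD * K))). assert (Hrho : 0 < rho) by apply exp_pos.
  set (e0 := rho * eps). assert (He0 : 0 < e0) by (unfold e0; nra).
  set (eta := e0 / (4 * C)). assert (Heta : 0 < eta) by (apply Rdiv_lt_0_compat; lra).
  set (E' := e0 * eta / 4). assert (HE' : 0 < E') by (unfold E'; nra).
  set (X := C * 576 * zeta2 / (E' / 2)). assert (HX : 0 < X) by (apply Rdiv_lt_0_compat; nra).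
  set (K' := K + 24 * X).
  exists (E' / 2), K', (2 * K + 64 + 4 * CD + 4 * C / e0).
  split; [lra|]. split; [unfold K'; lra|].
  intros n B Hn H1 H2 H3 H4 k Hk.
  assert (Hpos4 : 0 < 4 * C / e0) by (apply Rdiv_lt_0_compat; lra).
  assert (Hn' : 2 * K + 64 + 4 * CD <= sqrt (INR n)) by lra.
  destruct (window_P K n k HK Hn' Hk) as [Hkn _].
  pose proof (fun i Hi => window_P_low K n i HK Hn' Hi) as Hlow. fold rho in Hlow.
  pose proof (sqrt_INR_sqr n) as Hq. pose proof (pn0_pos n) as HP. set (s := sqrt (INR n)) in *.
  assert (Hs : 1 <= s) by lra.
  assert (Hn1 : (1 <= n)%nat) by (apply INR_le; simpl; nra).
  assert (HC4 : C / s <= e0 / 4).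
  { apply (Rmult_le_reg_r (s * (4 / e0))); [apply Rmult_lt_0_compat; [lra|apply Rdiv_lt_0_compat; lra]|].
    replace (C / s * (s * (4 / e0))) with (4 * C / e0) by (field; lra).
    replace (e0 / 4 * (s * (4 / e0))) with s by (field; lra). lra. }
  (* [B] is raised just enough to be nonnegative in the tail too, since [dsum_row] discards
     terms. *)
  set (B' := fun k => B k + C * exp (- X) * pn n 0 * exp (- (/ (24 * s) * INR k))).
  assert (HB' : forall k, 0 <= B' k).
  { intros i. unfold B'. pose proof (exp_pos (- (/ (24 * s) * INR i))) as Hei.
    pose proof (exp_pos (- X)) as HeX.
    destruct (Rle_lt_dec (INR i) (K' * s)) as [Hi|Hi].
    - apply Rplus_le_le_0_compat; [now apply H3|].
      apply Rlt_le. repeat apply Rmult_lt_0_compat; auto.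
    - specialize (H2 i).
      assert (HH : exp (- (/ (12 * s) * INR i)) <= exp (- X) * exp (- (/ (24 * s) * INR i))).
      { rewrite <- exp_plus. apply exp_le_mono.
        enough (X <= / (24 * s) * INR i).
        { replace (/ (12 * s) * INR i) with (2 * (/ (24 * s) * INR i)) by (field; lra). lra. }
        apply (Rmult_le_reg_l (24 * s)); [lra|]. rewrite <- Rmult_assoc, Rinv_r by lra.
        unfold K' in Hi. nra. }
      assert (C * pn n 0 * exp (- (/ (12 * s) * INR i)) <=
        C * pn n 0 * (exp (- X) * exp (- (/ (24 * s) * INR i))))
        by (apply Rmult_le_compat_l; [nra|auto]). lra. }
  assert (HD' : dsum B' n <= E' * INR n * pn n 0).
  { unfold B'. rewrite dsum_plus, dsum_scal.
    assert (Hu : 0 < / (24 * s)) by (apply Rinv_0_lt_compat; lra).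
    pose proof (dsum_exp_le _ n Hu) as HE.
    replace (zeta2 / (/ (24 * s))²) with (576 * zeta2 * INR n) in HE
      by (rewrite <- Hq; unfold Rsqr; field; lra).
    pose proof (exp_neg_le X HX) as HeX. pose proof (exp_pos (- X)).
    assert (HE2 : C * exp (- X) * pn n 0 * (576 * zeta2 * INR n) <= E' / 2 * INR n * pn n 0).
    { replace (C * exp (- X) * pn n 0 * (576 * zeta2 * INR n)) with
        (C * 576 * zeta2 * exp (- X) * (INR n * pn n 0)) by ring.
      rewrite (Rmult_assoc (E' / 2)).
      apply Rmult_le_compat_r; [pose proof (pos_INR n); nra|].
      apply Rle_trans with (C * 576 * zeta2 * / X).
      - apply Rmult_le_compat_l; [nra|auto].
      - apply Req_le. unfold X. field. lra. }
    assert (C * exp (- X) * pn n 0 * dsum (fun k => exp (- (/ (24 * s) * INR k))) n <=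
      C * exp (- X) * pn n 0 * (576 * zeta2 * INR n)).
    { apply Rmult_le_compat_l; [|auto]. apply Rlt_le. repeat apply Rmult_lt_0_compat; auto. }
    lra. }
  pose proof (dsum_row B' n k Hn1 Hkn (fun i _ => HB' i)) as HR.
  assert (HR2 : rsum (fun d => INR (S d) * B (S d)) k <= E' * INR n * pn n 0).
  { eapply Rle_trans; [|exact HD']. eapply Rle_trans; [|exact HR]. apply rsum_le. intros d _.
    apply Rmult_le_compat_l; [apply pos_INR|]. unfold B'.
    assert (0 < C * exp (- X) * pn n 0 * exp (- (/ (24 * s) * INR (S d)))).
    { repeat apply Rmult_lt_0_compat; auto; apply exp_pos. }
    lra. }
  assert (Hin : forall i, (i <= k)%nat -> 0 <= B i).
  { intros i Hi. apply H3. apply le_INR in Hi. unfold K'. nra. }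
  assert (HS : rsum B k <= e0 * s * pn n 0).
  { apply Rle_trans with (rsum B (S k)); [apply rsum_le_len; [lia|intros i Hi; apply Hin; lia]|].
    rewrite rsum_shift.
    assert (HT : rsum (fun d => B (S d)) k <=
      rsum (fun d => / (eta * s) * (INR (S d) * B (S d)) +
        C * pn n 0 * (if Rle_dec (INR (S d)) (eta * s) then 1 else 0)) k).
    { apply rsum_le. intros d Hd. pose proof (Hin (S d) ltac:(lia)) as Hb.
      assert (0 < eta * s) by nra. assert (0 < / (eta * s)) by (now apply Rinv_0_lt_compat).
      pose proof (pos_INR (S d)).
      destruct (Rle_dec (INR (S d)) (eta * s)) as [Hd2|Hd2].
      - specialize (H4 (S d)).
        assert (0 <= / (eta * s) * (INR (S d) * B (S d))) by (apply Rmult_le_pos; nra). lra.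
      - apply Rnot_le_lt in Hd2. rewrite Rmult_0_r, Rplus_0_r.
        apply (Rmult_le_reg_l (eta * s)); [auto|].
        rewrite <- (Rmult_assoc (eta * s)), Rinv_r by lra. nra. }
    rewrite rsum_plus, !rsum_scal in HT.
    pose proof (count_le (eta * s) k ltac:(nra)) as HCnt.
    assert (T1 : / (eta * s) * rsum (fun d => INR (S d) * B (S d)) k <= e0 / 4 * s * pn n 0).
    { apply Rle_trans with (/ (eta * s) * (E' * INR n * pn n 0)).
      - apply Rmult_le_compat_l; [left; apply Rinv_0_lt_compat; nra|auto].
      - apply Req_le. unfold E'. rewrite <- Hq. field. lra. }
    assert (T2 : C * pn n 0 * rsum (fun d => if Rle_dec (INR (S d)) (eta * s) then 1 else 0) k
      <= e0 / 4 * s * pn n 0).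
    { apply Rle_trans with (C * pn n 0 * (eta * s)).
      - apply Rmult_le_compat_l; [nra|auto].
      - apply Req_le. unfold eta. field. lra. }
    assert (T3 : B O <= e0 / 4 * s * pn n 0).
    { eapply Rle_trans; [apply H4|]. apply Rmult_le_compat_r; [lra|].
      replace C with (C / s * s) by (field; lra). apply Rmult_le_compat_r; lra. }
    assert (0 < e0 * s * pn n 0) by (repeat apply Rmult_lt_0_compat; lra). lra. }
  apply Rle_trans with (rsum (fun i => / (rho * pn n 0) * B i) k).
  - apply rsum_le. intros i Hi. unfold Rdiv. rewrite Rmult_comm.
    apply Rmult_le_compat_r; [apply Hin; lia|]. apply Rinv_le_contravar; [nra|].
    apply Hlow. apply lt_INR in Hi. lra.
  - rewrite rsum_scal. apply (Rmult_le_reg_l (rho * pn n 0)); [nra|].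
    rewrite <- Rmult_assoc, Rinv_r by nra. unfold e0 in HS. nra.
Qed.

(** Inserted in the Euler recursion, the hypothesis yields [n p(n) <= (zeta2 / a^2 + small) n p(n)].
    One [n] for each [K] and [eps] is enough, so it can be taken where the upper limit is nearly
    attained. *)
Lemma rate_upper a : 0 < a ->
  (forall K eps, 0 < K -> 0 < eps -> exists n, 1 <= sqrt (INR n) /\
    forall k, INR k <= K * sqrt (INR n) ->
      pn n k <= exp (eps - a / sqrt (INR n) * INR k) * pn n 0) ->
  a² <= zeta2.
Proof.
  intros Ha H. apply Rnot_lt_le. intros Hlt. pose proof zeta2_pos as Hz.
  assert (Ha2 : 0 < a²) by lra.
  set (r := zeta2 / a²). assert (Hr : 0 < r < 1).
  { unfold r. split; [now apply Rdiv_lt_0_compat|]. apply (Rmult_lt_reg_r (a²)); [auto|].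
    replace (zeta2 / a² * a²) with zeta2 by (field; lra). lra. }
  (* The tail contributes [288 * zeta2 / X = g / 3], and [(1 + g / 3) * (1 - g) + g / 3 < 1]. *)
  set (g := 1 - r). set (X := 864 * zeta2 / g).
  assert (HX : 0 < X) by (apply Rdiv_lt_0_compat; unfold g; lra).
  assert (Hln : 0 < ln (1 + g / 3)) by (rewrite <- ln_1; apply ln_increasing; unfold g; lra).
  destruct (H (12 * X) (ln (1 + g / 3)) ltac:(lra) Hln) as (n & Hs & Hn).
  assert (Hn1 : (1 <= n)%nat).
  { destruct n; [simpl in Hs; rewrite sqrt_0 in Hs; lra|lia]. }
  pose proof (sqrt_INR_sqr n) as Hq. pose proof (pn0_pos n) as HP.
  pose proof (fun k => pn_exp n k Hn1) as HE. set (s := sqrt (INR n)) in *.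
  assert (T : forall k, (1 <= k)%nat -> pn n k <=
    (1 + g / 3) * pn n 0 * exp (- (a / s * INR k)) +
    2 * exp (- X) * pn n 0 * exp (- (/ (12 * s) * INR k))).
  { intros k _. pose proof (exp_pos (- (a / s * INR k))). pose proof (exp_pos (- X)).
    pose proof (exp_pos (- (/ (12 * s) * INR k))).
    destruct (Rle_lt_dec (INR k) (12 * X * s)) as [Hk|Hk].
    - specialize (Hn k Hk). unfold Rminus in Hn. rewrite exp_plus, exp_ln in Hn by (unfold g; lra).
      assert (0 < exp (- X) * pn n 0 * exp (- (/ (12 * s) * INR k)))
        by (repeat apply Rmult_lt_0_compat; auto). lra.
    - specialize (HE k).
      assert (HH : exp (- (/ (6 * s) * INR k)) <= exp (- X) * exp (- (/ (12 * s) * INR k))).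
      { rewrite <- exp_plus. apply exp_le_mono.
        enough (X <= / (12 * s) * INR k).
        { replace (/ (6 * s) * INR k) with (2 * (/ (12 * s) * INR k)) by (field; lra). lra. }
        apply (Rmult_le_reg_l (12 * s)); [lra|]. rewrite <- Rmult_assoc, Rinv_r by lra. lra. }
      apply (Rmult_le_compat_r (2 * pn n 0)) in HH; [|lra].
      assert (0 < (1 + g / 3) * pn n 0 * exp (- (a / s * INR k)))
        by (repeat apply Rmult_lt_0_compat; auto; unfold g; lra). lra. }
  pose proof (dsum_le _ _ n T) as HS. rewrite dsum_plus, !dsum_scal, <- pn_euler in HS.
  assert (Hu1 : 0 < a / s) by (apply Rdiv_lt_0_compat; lra).
  assert (Hu2 : 0 < / (12 * s)) by (apply Rinv_0_lt_compat; lra).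
  pose proof (dsum_exp_le _ n Hu1) as B1. pose proof (dsum_exp_le _ n Hu2) as B2.
  replace (zeta2 / (a / s)²) with (r * INR n) in B1
    by (unfold r; rewrite <- Hq; unfold Rsqr; field; lra).
  replace (zeta2 / (/ (12 * s))²) with (144 * zeta2 * INR n) in B2
    by (rewrite <- Hq; unfold Rsqr; field; lra).
  assert (HN : 1 <= INR n) by (apply (le_INR 1); auto).
  assert (T1 : (1 + g / 3) * pn n 0 * dsum (fun k => exp (- (a / s * INR k))) n <=
    (1 + g / 3) * pn n 0 * (r * INR n))
    by (apply Rmult_le_compat_l; [apply Rmult_le_pos; unfold g; lra|auto]).
  assert (T2 : 2 * exp (- X) * pn n 0 * dsum (fun k => exp (- (/ (12 * s) * INR k))) n <=
    g / 3 * (INR n * pn n 0)).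
  { apply Rle_trans with (2 * exp (- X) * pn n 0 * (144 * zeta2 * INR n)).
    - apply Rmult_le_compat_l; [|auto]. pose proof (exp_pos (- X)). nra.
    - replace (2 * exp (- X) * pn n 0 * (144 * zeta2 * INR n)) with
        (288 * zeta2 * exp (- X) * (INR n * pn n 0)) by ring.
      apply Rmult_le_compat_r; [nra|]. pose proof (exp_neg_le X HX).
      apply Rle_trans with (288 * zeta2 * / X); [apply Rmult_le_compat_l; lra|].
      apply Req_le. unfold X. field. unfold g. lra. }
  assert (HF : INR n * pn n 0 <= ((1 + g / 3) * r + g / 3) * (INR n * pn n 0)) by lra.
  assert (0 < INR n * pn n 0) by nra.
  assert ((1 + g / 3) * r + g / 3 < 1) by (unfold g in *; nra). nra.
Qed.

Lemma rate_lower a : 0 < a ->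
  (forall K eps M, 0 < K -> 0 < eps -> exists n, M <= sqrt (INR n) /\
    forall k, INR k <= K * sqrt (INR n) ->
      exp (- eps - a / sqrt (INR n) * INR k) * pn n 0 <= pn n k) ->
  zeta2 <= a².
Proof.
  intros Ha H. apply Rnot_lt_le. intros Hlt. pose proof zeta2_pos as Hz.
  assert (Ha2 : 0 < a²) by (apply Rlt_0_sqr; lra).
  set (r := zeta2 / a²). assert (Hr : 1 < r).
  { unfold r. apply (Rmult_lt_reg_r (a²)); [auto|].
    replace (zeta2 / a² * a²) with zeta2 by (field; lra). lra. }
  set (g := r - 1). set (X := 16 * r / g).
  assert (HX : 0 < X) by (apply Rdiv_lt_0_compat; unfold g; lra).
  assert (Hln : 0 < ln (1 + g / 4)) by (rewrite <- ln_1; apply ln_increasing; unfold g; lra).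
  destruct (dsum_exp_ge a (g / 4) Ha ltac:(unfold g; lra)) as [n0 Hn0].
  destruct (H (2 * X / a) (ln (1 + g / 4)) (sqrt (INR n0) + 1)) as (n & Hs & Hn);
    [apply Rdiv_lt_0_compat; lra|auto|].
  pose proof (sqrt_pos (INR n0)) as Hs0.
  specialize (Hn0 n). 
  assert (Hnn : (n0 <= n)%nat).
  { apply INR_le. apply sqrt_le_0; try apply pos_INR. lra. }
  specialize (Hn0 Hnn).
  pose proof (sqrt_INR_sqr n) as Hq. pose proof (pn0_pos n) as HP. set (s := sqrt (INR n)) in *.
  assert (HN : 1 <= INR n) by nra.
  assert (Has : 0 < a / s) by (apply Rdiv_lt_0_compat; lra).
  set (e := / (1 + g / 4)). assert (He : 0 < e) by (apply Rinv_0_lt_compat; unfold g; lra).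
  (* Outside the window only [0 <= p(n - k)] is available, so a term is subtracted that makes the
     bound nonpositive there; its sum is small for large [X]. *)
  assert (T : forall k, (1 <= k)%nat ->
    e * pn n 0 * exp (- (a / s * INR k)) +
    (- (e * pn n 0 * exp (- X))) * exp (- (a / s / 2 * INR k)) <= pn n k).
  { intros k _. pose proof (exp_pos (- (a / s * INR k))). pose proof (exp_pos (- X)).
    pose proof (exp_pos (- (a / s / 2 * INR k))).
    assert (0 < e * pn n 0) by nra.
    destruct (Rle_lt_dec (INR k) (2 * X / a * s)) as [Hk|Hk].
    - specialize (Hn k Hk). unfold Rminus in Hn.
      rewrite exp_plus, (exp_Ropp (ln _)), exp_ln in Hn by (unfold g; lra). fold e in Hn.
      assert (0 < e * pn n 0 * exp (- X) * exp (- (a / s / 2 * INR k)))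
        by (repeat apply Rmult_lt_0_compat; auto). lra.
    - assert (HH : exp (- (a / s * INR k)) <= exp (- X) * exp (- (a / s / 2 * INR k))).
      { rewrite <- exp_plus. apply exp_le_mono.
        enough (X <= a / s / 2 * INR k) by lra.
        apply (Rmult_le_reg_l (2 * s / a)); [apply Rdiv_lt_0_compat; lra|].
        replace (2 * s / a * X) with (2 * X / a * s) by (field; lra).
        replace (2 * s / a * (a / s / 2 * INR k)) with (INR k) by (field; lra). lra. }
      apply (Rmult_le_compat_l (e * pn n 0)) in HH; [|lra].
      pose proof (pn_nonneg n k). lra. }
  pose proof (dsum_le _ _ n T) as HS. rewrite dsum_plus, !dsum_scal, <- pn_euler in HS.
  assert (Hu2 : 0 < a / s / 2) by lra.
  pose proof (dsum_exp_le _ n Hu2) as B2.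
  replace (zeta2 / (a / s / 2)²) with (4 * r * INR n) in B2
    by (unfold r; rewrite <- Hq; unfold Rsqr; field; lra).
  fold r in Hn0.
  assert (HeP : 0 < e * pn n 0) by nra.
  assert (T1 : e * pn n 0 * (INR n * (r - g / 4)) <=
    e * pn n 0 * dsum (fun k => exp (- (a / s * INR k))) n)
    by (apply Rmult_le_compat_l; lra).
  assert (T2 : e * pn n 0 * exp (- X) * dsum (fun k => exp (- (a / s / 2 * INR k))) n <=
    e * pn n 0 * (INR n * (g / 4))).
  { rewrite Rmult_assoc. apply Rmult_le_compat_l; [lra|].
    apply Rle_trans with (exp (- X) * (4 * r * INR n)).
    - apply Rmult_le_compat_l; [left; apply exp_pos|auto].
    - pose proof (exp_neg_le X HX).
      apply Rle_trans with (/ X * (4 * r * INR n)); [apply Rmult_le_compat_r; nra|].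
      apply Req_le. unfold X. field. unfold g. lra. }
  assert (HF : e * (INR n * pn n 0) * (1 + g / 2) <= INR n * pn n 0) by (unfold g in *; nra).
  assert (0 < INR n * pn n 0) by nra.
  assert (e * (1 + g / 2) <= 1) by nra.
  assert (e * (1 + g / 4) = 1) by (unfold e; field; unfold g; lra).
  assert (0 < g) by (unfold g; lra). nra.
Qed.

Lemma rsum_ratio_le n k c : rsum (fun i => dP n i / pn n i) k <= c -> (k <= n)%nat ->
  (forall i, (i < k)%nat -> dP n i / pn n i <= 2 * CD / sqrt (INR n)) ->
  4 * CD <= sqrt (INR n) ->
  exp (- (c + INR k * (2 * (2 * CD / sqrt (INR n))²))) * pn n 0 <= pn n k.
Proof.
  intros Hc Hk W Hs. pose proof CD_pos.
  set (s := sqrt (INR n)) in *.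
  assert (He : 2 * CD / s <= 1 / 2).
  { apply (Rmult_le_reg_r s); [lra|].
    replace (2 * CD / s * s) with (2 * CD) by (field; lra). lra. }
  eapply Rle_trans; [|apply pn_prod_ge; [auto|intros i Hi; specialize (W i Hi); lra]].
  apply Rmult_le_compat_r; [apply pn_nonneg|]. apply exp_le_mono, Ropp_le_contravar.
  rewrite rsum_plus, <- rsum_const. apply Rplus_le_compat; [auto|].
  apply rsum_le. intros i Hi. apply Rmult_le_compat_l; [lra|].
  apply Rsqr_incr_1; [now apply W| |apply Rlt_le, Rdiv_lt_0_compat; lra].
  pose proof (pn_ge1 n i ltac:(lia)). apply Rmult_le_pos; [apply dP_nonneg|].
  left. apply Rinv_0_lt_compat. lra.
Qed.

Lemma limsup_theta a : 0 < a ->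
  (forall e N, 0 < e -> exists n, (N <= n)%nat /\ a - e < theta n) ->
  (forall e, 0 < e -> exists N, forall n, (N <= n)%nat -> theta n < a + e) ->
  a² <= zeta2.
Proof.
  intros Ha Hio Hev. apply rate_upper; [auto|]. intros K eps HK Heps. pose proof CD_pos as HCD.
  destruct (window_sum K eps (CD + a + 2) HK Heps ltac:(lra)) as (E1 & K' & M1 & HE1 & HK' & HW).
  set (e := Rmin 1 (E1 / 3)). assert (He : 0 < e <= 1 /\ 3 * e <= E1).
  { unfold e. pose proof (Rmin_l 1 (E1 / 3)). pose proof (Rmin_r 1 (E1 / 3)).
    assert (0 < Rmin 1 (E1 / 3)) by (apply Rmin_glb_lt; lra). lra. }
  destruct (Hev e ltac:(lra)) as [N HN].
  destruct (window_theta_le a e K' N Ha ltac:(lra) HK') as [M2 HM2].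
  { intros n Hn. left. now apply HN. }
  destruct (sqrt_unbounded (Rmax M1 (Rmax M2 (2 * K + 64 + 4 * CD)))) as [N1 HN1].
  destruct (Hio e (N1 + 256)%nat ltac:(lra)) as (n & Hn & Hth).
  specialize (HN1 n ltac:(lia)).
  assert (M1 <= sqrt (INR n) /\ M2 <= sqrt (INR n) /\ 2 * K + 64 + 4 * CD <= sqrt (INR n)) as (HA & HB & HC).
  { pose proof (Rmax_l M1 (Rmax M2 (2 * K + 64 + 4 * CD))).
    pose proof (Rmax_r M1 (Rmax M2 (2 * K + 64 + 4 * CD))).
    pose proof (Rmax_l M2 (2 * K + 64 + 4 * CD)). pose proof (Rmax_r M2 (2 * K + 64 + 4 * CD)). lra. }
  exists n. split; [lra|].
  specialize (HM2 n HB). pose proof (pn0_pos n) as HP.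
  pose proof (fun k => dP_exp n k ltac:(lia)) as HD.
  pose proof (fun k Hk => window_P K n k HK HC Hk) as HWP.
  pose proof (theta_sub n 0 ltac:(lia)) as HT. rewrite Nat.sub_0_r in HT.
  (* The gap below the ceiling [a + 2 * e], nonnegative on the window. By [dP_euler] and
     [theta n > a - e] its weighted sum is at most [3 * e * n * p(n)]. *)
  specialize (HW n (fun k => (a + 2 * e) * pn n k + - sqrt (INR n) * dP n k) HA).
  set (s := sqrt (INR n)) in *.
  assert (Hsum : forall k, INR k <= K * s ->
    rsum (fun i => ((a + 2 * e) * pn n i + - s * dP n i) / pn n i) k <= eps * s).
  { apply HW.
    - rewrite dsum_plus, !dsum_scal, <- pn_euler, dP_euler.
      assert (0 <= s * pn n 1) by (apply Rmult_le_pos; [lra|apply pn_nonneg]).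
      assert (HTn : (a - e) * pn n 0 <= s * dP n 0) by (rewrite <- HT; apply Rmult_le_compat_r; lra).
      pose proof (pos_INR n).
      assert (INR n * ((a - e) * pn n 0) <= INR n * (s * dP n 0)) by (apply Rmult_le_compat_l; auto).
      assert (0 <= (E1 - 3 * e) * (INR n * pn n 0)) by (apply Rmult_le_pos; nra). nra.
    - intros k. specialize (HD k). pose proof (pn_nonneg n k).
      pose proof (Rmult_lt_0_compat _ _ (exp_pos (- (/ (12 * s) * INR k))) HP).
      assert (0 <= (a + 2 * e) * pn n k) by (apply Rmult_le_pos; lra). nra.
    - intros k Hk. specialize (HM2 k Hk). lra.
    - intros k. pose proof (dP_nonneg n k). pose proof (pn_nonneg n k).
      assert (pn n k <= pn n 0) by (apply pn_mono; lia). nra. }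
  clear HW. intros k Hk. destruct (HWP k Hk) as [Hkn _].
  eapply Rle_trans; [apply pn_prod_le; auto|]. apply Rmult_le_compat_r; [lra|].
  apply exp_le_mono. specialize (Hsum k Hk).
  rewrite (rsum_ext _ (fun i => (a + 2 * e) + - s * (dP n i / pn n i))) in Hsum.
  2:{ intros i Hi. pose proof (pn_ge1 n i ltac:(lia)). field. lra. }
  rewrite rsum_plus, rsum_const, rsum_scal in Hsum.
  set (S1 := rsum _ k) in *. pose proof (pos_INR k).
  assert (a / s * INR k - eps <= S1).
  { apply (Rmult_le_reg_r s); [lra|].
    replace ((a / s * INR k - eps) * s) with (a * INR k - eps * s) by (field; lra). nra. }
  lra.
Qed.

Lemma liminf_theta a : 0 < a ->
  (forall e N, 0 < e -> exists n, (N <= n)%nat /\ theta n < a + e) ->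
  (forall e, 0 < e -> exists N, forall n, (N <= n)%nat -> a - e < theta n) ->
  zeta2 <= a².
Proof.
  intros Ha Hio Hev. apply rate_lower; [auto|]. intros K eps M HK Heps. pose proof CD_pos as HCD.
  destruct (window_sum K (eps / 2) (CD + 2 * a) HK ltac:(lra) ltac:(lra))
    as (E1 & K' & M1 & HE1 & HK' & HW).
  set (e := Rmin a (E1 / 3)). assert (He : 0 < e <= a /\ 3 * e <= E1).
  { unfold e. pose proof (Rmin_l a (E1 / 3)). pose proof (Rmin_r a (E1 / 3)).
    assert (0 < Rmin a (E1 / 3)) by (apply Rmin_glb_lt; lra). lra. }
  destruct (Hev e ltac:(lra)) as [N HN].
  destruct (window_theta_ge (a - e) K' N HK') as [M2 HM2].
  { intros n Hn. left. now apply HN. }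
  set (M3 := 2 * K + 64 + 4 * CD + 1 / e + 16 * CD² * K / eps).
  assert (Hpos1 : 0 < 1 / e) by (apply Rdiv_lt_0_compat; lra).
  assert (Hpos2 : 0 < 16 * CD² * K / eps).
  { apply Rdiv_lt_0_compat; [|lra]. assert (0 < CD²) by (apply Rlt_0_sqr; lra). nra. }
  destruct (sqrt_unbounded (Rmax M (Rmax M1 (Rmax M2 M3)))) as [N1 HN1].
  destruct (Hio e (N1 + 256)%nat ltac:(lra)) as (n & Hn & Hth).
  specialize (HN1 n ltac:(lia)).
  assert (M <= sqrt (INR n) /\ M1 <= sqrt (INR n) /\ M2 <= sqrt (INR n) /\ M3 <= sqrt (INR n))
    as (H0 & HA & HB & H3).
  { pose proof (Rmax_l M (Rmax M1 (Rmax M2 M3))). pose proof (Rmax_r M (Rmax M1 (Rmax M2 M3))).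
    pose proof (Rmax_l M1 (Rmax M2 M3)). pose proof (Rmax_r M1 (Rmax M2 M3)).
    pose proof (Rmax_l M2 M3). pose proof (Rmax_r M2 M3). lra. }
  assert (HC : 2 * K + 64 + 4 * CD <= sqrt (INR n)) by (unfold M3 in H3; lra).
  exists n. split; [lra|].
  specialize (HM2 n HB). pose proof (pn0_pos n) as HP.
  pose proof (fun k => dP_exp n k ltac:(lia)) as HD.
  pose proof (fun k => pn_exp n k ltac:(lia)) as HPE.
  pose proof (fun k Hk => window_P K n k HK HC Hk) as HWP.
  pose proof (theta_sub n 0 ltac:(lia)) as HT. rewrite Nat.sub_0_r in HT.
  pose proof (fun k c H1 H2 H3 => rsum_ratio_le n k c H1 H2 H3 ltac:(lra)) as HLow.
  (* The gap above the floor [a - e]. The error [pn n 1] in [dP_euler] now has the wrong sign and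
     costs one more [e], whence [1 / e] in [M3]. *)
  specialize (HW n (fun k => sqrt (INR n) * dP n k + - (a - e) * pn n k) HA).
  pose proof (sqrt_INR_sqr n) as Hq.
  set (s := sqrt (INR n)) in *.
  assert (Hsum : forall k, INR k <= K * s ->
    rsum (fun i => (s * dP n i + - (a - e) * pn n i) / pn n i) k <= eps / 2 * s).
  { apply HW.
    - rewrite dsum_plus, !dsum_scal, <- pn_euler, dP_euler.
      assert (pn n 1 <= pn n 0) by (apply pn_mono; lia).
      assert (HTn : s * dP n 0 <= (a + e) * pn n 0) by (rewrite <- HT; apply Rmult_le_compat_r; lra).
      pose proof (pos_INR n).
      assert (INR n * (s * dP n 0) <= INR n * ((a + e) * pn n 0)) by (apply Rmult_le_compat_l; auto).
      assert (Hse : 1 <= e * s).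
      { replace 1 with (e * (1 / e)) by (field; lra). apply Rmult_le_compat_l; unfold M3 in H3; lra. }
      assert (s * pn n 1 <= e * (INR n * pn n 0)).
      { rewrite <- Hq. apply Rle_trans with (s * pn n 0); [apply Rmult_le_compat_l; lra|].
        replace (e * (s * s * pn n 0)) with (e * s * (s * pn n 0)) by ring.
        assert (0 <= s * pn n 0) by (apply Rmult_le_pos; lra).
        rewrite <- (Rmult_1_l (s * pn n 0)) at 1. apply Rmult_le_compat_r; lra. }
      assert (0 <= (E1 - 3 * e) * (INR n * pn n 0)) by (apply Rmult_le_pos; nra). nra.
    - intros k. specialize (HPE k). pose proof (dP_nonneg n k). pose proof (pn_nonneg n k).
      assert (HH : exp (- (/ (6 * s) * INR k)) <= exp (- (/ (12 * s) * INR k))).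
      { apply exp_le_mono, Ropp_le_contravar. apply Rmult_le_compat_r; [apply pos_INR|].
        apply Rinv_le_contravar; lra. }
      set (e12 := exp (- (/ (12 * s) * INR k))) in *. set (e6 := exp _) in *.
      assert (pn n k <= 2 * e12 * pn n 0) by nra.
      assert (0 < e12 * pn n 0) by (apply Rmult_lt_0_compat; [apply exp_pos|auto]).
      assert ((a - e) * pn n k <= a * (2 * e12 * pn n 0)) by (apply Rmult_le_compat; lra).
      assert (0 <= s * dP n k) by (apply Rmult_le_pos; lra). nra.
    - intros k Hk. specialize (HM2 k Hk). lra.
    - intros k. specialize (HD k). pose proof (pn_nonneg n k).
      assert (exp (- (/ (12 * s) * INR k)) <= 1).
      { rewrite <- exp_0. apply exp_le_mono. pose proof (pos_INR k).
        assert (0 < / (12 * s)) by (apply Rinv_0_lt_compat; lra). nra. }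
      assert (0 <= (a - e) * pn n k) by (apply Rmult_le_pos; lra).
      assert (CD * exp (- (/ (12 * s) * INR k)) * pn n 0 <= CD * pn n 0)
        by (apply Rmult_le_compat_r; nra). nra. }
  clear HW. intros k Hk. destruct (HWP k Hk) as [Hkn _]. specialize (Hsum k Hk).
  rewrite (rsum_ext _ (fun i => s * (dP n i / pn n i) + - (a - e))) in Hsum.
  2:{ intros i Hi. pose proof (pn_ge1 n i ltac:(lia)). field. lra. }
  rewrite rsum_plus, rsum_const, rsum_scal in Hsum. pose proof (pos_INR k).
  eapply Rle_trans; [|apply (HLow k (a / s * INR k + eps / 2)); [|auto|]].
  - apply Rmult_le_compat_r; [lra|]. apply exp_le_mono.
    enough (INR k * (2 * (2 * CD / s)²) <= eps / 2) by lra.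
    apply Rle_trans with (K * s * (2 * (2 * CD / s)²)).
    { apply Rmult_le_compat_r; [|auto]. pose proof (Rle_0_sqr (2 * CD / s)). lra. }
    replace (K * s * (2 * (2 * CD / s)²)) with (eps / 2 * ((16 * CD² * K / eps) / s))
      by (unfold Rsqr; field; lra).
    rewrite <- (Rmult_1_r (eps / 2)) at 2. apply Rmult_le_compat_l; [lra|].
    apply (Rmult_le_reg_r s); [lra|].
    replace (16 * CD² * K / eps / s * s) with (16 * CD² * K / eps) by (field; lra).
    unfold M3 in H3. lra.
  - set (S1 := rsum _ k) in *. apply (Rmult_le_reg_l s); [lra|].
    replace (s * (a / s * INR k + eps / 2)) with (a * INR k + eps / 2 * s) by (field; lra). nra.
  - intros i Hi. apply HWP. apply lt_INR in Hi. lra.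
Qed.

Definition alpha : R := sqrt zeta2.

Lemma alpha_pos : 0 < alpha.
Proof. apply sqrt_lt_R0, zeta2_pos. Qed.

(** The upper limit is at most [alpha] and the lower limit at least [alpha]. *)
Lemma theta_lim : is_lim_seq theta alpha.
Proof.
  assert (Hup : exists N, forall n, (N <= n)%nat -> / 6 <= theta n <= CD).
  { exists 256%nat. intros n Hn. split; [apply theta_lower; lia|now apply theta_upper]. }
  destruct Hup as [N0 HN0].
  destruct (ex_LimSup_seq theta) as [ls Hls]. destruct (ex_LimInf_seq theta) as [li Hli].
  assert (Hs : exists a, ls = Finite a).
  { destruct ls as [a| |]; [eauto| |]; simpl in Hls; exfalso.
    - destruct (Hls CD N0) as (n & Hn & H). specialize (HN0 n Hn). lra.
    - destruct (Hls (/ 6)) as (N & H). specialize (H (N + N0)%nat ltac:(lia)).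
      specialize (HN0 (N + N0)%nat ltac:(lia)). lra. }
  assert (Hi : exists a, li = Finite a).
  { destruct li as [a| |]; [eauto| |]; simpl in Hli; exfalso.
    - destruct (Hli CD) as (N & H). specialize (H (N + N0)%nat ltac:(lia)).
      specialize (HN0 (N + N0)%nat ltac:(lia)). lra.
    - destruct (Hli (/ 6) N0) as (n & Hn & H). specialize (HN0 n Hn). lra. }
  destruct Hs as [a ->]. destruct Hi as [b ->]. simpl in Hls, Hli.
  assert (S1 : forall e N, 0 < e -> exists n, (N <= n)%nat /\ a - e < theta n).
  { intros e N He. destruct (Hls (mkposreal e He)) as [H _]. destruct (H N) as (n & Hn & H').
    exists n. simpl in H'. auto. }
  assert (S2 : forall e, 0 < e -> exists N, forall n, (N <= n)%nat -> theta n < a + e).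
  { intros e He. destruct (Hls (mkposreal e He)) as [_ H]. exact H. }
  assert (I1 : forall e N, 0 < e -> exists n, (N <= n)%nat /\ theta n < b + e).
  { intros e N He. destruct (Hli (mkposreal e He)) as [H _]. destruct (H N) as (n & Hn & H').
    exists n. simpl in H'. auto. }
  assert (I2 : forall e, 0 < e -> exists N, forall n, (N <= n)%nat -> b - e < theta n).
  { intros e He. destruct (Hli (mkposreal e He)) as [_ H]. exact H. }
  assert (Ha : 0 < a).
  { destruct (S2 (/ 12) ltac:(lra)) as [N H]. specialize (H (N + N0)%nat ltac:(lia)).
    specialize (HN0 (N + N0)%nat ltac:(lia)). lra. }
  assert (Hb : 0 < b).
  { destruct (I1 (/ 12) N0 ltac:(lra)) as (n & Hn & H). specialize (HN0 n Hn). lra. }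
  pose proof (limsup_theta a Ha S1 S2) as Ea. pose proof (liminf_theta b Hb I1 I2) as Eb.
  assert (a <= alpha) by (unfold alpha; rewrite <- (sqrt_Rsqr a) by lra; now apply sqrt_le_1_alt).
  assert (alpha <= b) by (unfold alpha; rewrite <- (sqrt_Rsqr b) by lra; now apply sqrt_le_1_alt).
  apply is_lim_seq_spec. intros [e He]. simpl.
  destruct (S2 e He) as [N1 H1]. destruct (I2 e He) as [N2 H2].
  exists (N1 + N2)%nat. intros n Hn. specialize (H1 n ltac:(lia)). specialize (H2 n ltac:(lia)).
  apply Rabs_def1; lra.
Qed.

Lemma pn_window K eps : 0 < K -> 0 < eps -> exists N, forall n, (N <= n)%nat ->
  1 <= sqrt (INR n) /\ forall k, INR k <= K * sqrt (INR n) ->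
    exp (- eps - alpha / sqrt (INR n) * INR k) * pn n 0 <= pn n k <=
    exp (eps - alpha / sqrt (INR n) * INR k) * pn n 0.
Proof.
  intros HK Heps. pose proof CD_pos as HCD. pose proof alpha_pos as Hal.
  (* An error of [2 * e / sqrt n] per step adds up to [eps / 2] over the window; the quadratic term
     of [pn_prod_ge] takes the other half. *)
  set (e := eps / (4 * K)). assert (He : 0 < e) by (apply Rdiv_lt_0_compat; lra).
  pose proof theta_lim as HL. apply is_lim_seq_spec in HL.
  destruct (HL (mkposreal e He)) as [N HN]. simpl in HN.
  destruct (window_theta_le alpha e K N Hal He HK) as [M1 HM1].
  { intros n Hn. specialize (HN n Hn). apply Rabs_def2 in HN. lra. }
  destruct (window_theta_ge (alpha - e) K N HK) as [M2 HM2].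
  { intros n Hn. specialize (HN n Hn). apply Rabs_def2 in HN. lra. }
  set (M3 := 2 * K + 64 + 4 * CD + 16 * CD² * K / eps).
  assert (Hpos2 : 0 < 16 * CD² * K / eps).
  { apply Rdiv_lt_0_compat; [|lra]. assert (0 < CD²) by (apply Rlt_0_sqr; lra). nra. }
  destruct (sqrt_unbounded (Rmax M1 (Rmax M2 M3))) as [N1 HN1].
  exists N1. intros n Hn. specialize (HN1 n Hn).
  assert (M1 <= sqrt (INR n) /\ M2 <= sqrt (INR n) /\ M3 <= sqrt (INR n)) as (HA & HB & H3).
  { pose proof (Rmax_l M1 (Rmax M2 M3)). pose proof (Rmax_r M1 (Rmax M2 M3)).
    pose proof (Rmax_l M2 M3). pose proof (Rmax_r M2 M3). lra. }
  assert (HC : 2 * K + 64 + 4 * CD <= sqrt (INR n)) by (unfold M3 in H3; lra).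
  split; [lra|]. intros k Hk. specialize (HM1 n HA). specialize (HM2 n HB).
  pose proof (fun k Hk => window_P K n k HK HC Hk) as HWP. destruct (HWP k Hk) as [Hkn _].
  pose proof (fun k c H1 H2 H3 => rsum_ratio_le n k c H1 H2 H3 ltac:(lra)) as HLow.
  pose proof (pn0_pos n) as HP. set (s := sqrt (INR n)) in *. pose proof (pos_INR k) as Hk0.
  assert (HR : forall i, (i < k)%nat -> (alpha - e) / s <= dP n i / pn n i <= (alpha + 2 * e) / s).
  { intros i Hi. assert (Hik : INR i <= K * s) by (apply lt_INR in Hi; lra).
    specialize (HM1 i Hik). specialize (HM2 i Hik). pose proof (pn_ge1 n i ltac:(lia)).
    split; apply (Rmult_le_reg_r (s * pn n i)); try nra.
    - replace ((alpha - e) / s * (s * pn n i)) with ((alpha - e) * pn n i) by (field; lra).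
      replace (dP n i / pn n i * (s * pn n i)) with (s * dP n i) by (field; lra). lra.
    - replace ((alpha + 2 * e) / s * (s * pn n i)) with ((alpha + 2 * e) * pn n i) by (field; lra).
      replace (dP n i / pn n i * (s * pn n i)) with (s * dP n i) by (field; lra). lra. }
  assert (HeK : e / s * INR k <= eps / 4).
  { apply Rle_trans with (e / s * (K * s)).
    - apply Rmult_le_compat_l; [apply Rlt_le, Rdiv_lt_0_compat; lra|auto].
    - apply Req_le. unfold e. field. lra. }
  assert (Hup : rsum (fun i => dP n i / pn n i) k <= alpha / s * INR k + eps / 2).
  { apply Rle_trans with (rsum (fun _ => (alpha + 2 * e) / s) k).
    - apply rsum_le. intros i Hi. now apply HR.
    - rewrite rsum_const. unfold Rdiv in *. lra. }
  assert (Hlo : alpha / s * INR k - eps <= rsum (fun i => dP n i / pn n i) k).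
  { apply Rle_trans with (rsum (fun _ => (alpha - e) / s) k).
    - rewrite rsum_const. unfold Rdiv in *. lra.
    - apply rsum_le. intros i Hi. now apply HR. }
  split.
  - eapply Rle_trans; [|apply (HLow k _ Hup Hkn)].
    + apply Rmult_le_compat_r; [lra|]. apply exp_le_mono.
      enough (INR k * (2 * (2 * CD / s)²) <= eps / 2) by lra.
      apply Rle_trans with (K * s * (2 * (2 * CD / s)²)).
      { apply Rmult_le_compat_r; [|auto]. pose proof (Rle_0_sqr (2 * CD / s)). lra. }
      replace (K * s * (2 * (2 * CD / s)²)) with (eps / 2 * ((16 * CD² * K / eps) / s))
        by (unfold Rsqr; field; lra).
      rewrite <- (Rmult_1_r (eps / 2)) at 2. apply Rmult_le_compat_l; [lra|].
      apply (Rmult_le_reg_r s); [lra|].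
      replace (16 * CD² * K / eps / s * s) with (16 * CD² * K / eps) by (field; lra).
      unfold M3 in H3. lra.
    + intros i Hi. apply HWP. apply lt_INR in Hi. lra.
  - eapply Rle_trans; [apply pn_prod_le; auto|]. apply Rmult_le_compat_r; [lra|].
    apply exp_le_mono. lra.
Qed.

(** * The Gaussian integral *)

(* Coquelicot equalities live in a canonical structure that [ring] does not see through. *)
Ltac eqR := match goal with |- ?a = ?b => change (@eq R a b) end.

Definition gs (t : R) : R := exp (- t ^ 2 / 2).
Definition Gi (x : R) : R := RInt gs 0 x.

Lemma gs_continuous t : continuous gs t.
Proof. apply (ex_derive_continuous gs). unfold gs. auto_derive; auto. Qed.

Lemma gs_pos t : 0 < gs t.
Proof. apply exp_pos. Qed.

Lemma gs_decr a b : 0 <= a <= b -> gs b <= gs a.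
Proof. intros H. unfold gs. apply exp_le_mono. nra. Qed.

Lemma ex_RInt_gs a b : ex_RInt gs a b.
Proof. apply (ex_RInt_continuous gs). intros; apply gs_continuous. Qed.

Lemma is_derive_Gi x : is_derive Gi x (gs x).
Proof.
  apply (is_derive_RInt gs Gi 0 x).
  - exists (mkposreal 1 Rlt_0_1). intros y _. apply (RInt_correct gs), ex_RInt_gs.
  - apply gs_continuous.
Qed.

Lemma Gi_0 : Gi 0 = 0.
Proof. unfold Gi. now rewrite RInt_point. Qed.

Lemma Gi_diff a b : Gi b - Gi a = RInt gs a b.
Proof.
  unfold Gi. rewrite <- (RInt_Chasles gs 0 a b) by apply ex_RInt_gs.
  unfold plus; simpl. ring.
Qed.

Lemma Gi_odd x : Gi (- x) = - Gi x.
Proof.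
  enough (H : Gi (- x) + Gi x = Gi (- 0) + Gi 0) by (rewrite Ropp_0, Gi_0 in H; lra).
  destruct (MVT_gen (fun x => Gi (- x) + Gi x) 0 x (fun _ => 0)) as (c & _ & E).
  - intros y _. replace 0 with (- 1 * gs (- y) + gs y).
    + apply (is_derive_plus (fun y => Gi (- y)) Gi).
      * apply (is_derive_comp Gi Ropp); [apply is_derive_Gi|]. auto_derive; auto.
      * apply is_derive_Gi.
    + unfold gs. replace ((- y) ^ 2) with (y ^ 2) by ring. ring.
  - intros y _. apply continuity_pt_filterlim.
    apply (ex_derive_continuous (fun x => Gi (- x) + Gi x)).
    eexists. apply (is_derive_plus (fun y => Gi (- y)) Gi).
    + apply (is_derive_comp Gi Ropp); [apply is_derive_Gi|]. auto_derive; auto.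
    + apply is_derive_Gi.
  - lra.
Qed.

(** Classical device for the Gaussian integral: [Gi^2 + 2 * Ji] has derivative 0 and equals [PI / 2]
    at 0, while [Ji] tends to 0 at infinity. *)
Definition Jf (x t : R) : R := exp (- x ^ 2 * (1 + t ^ 2) / 2) / (1 + t ^ 2).
Definition Ji (x : R) : R := RInt (Jf x) 0 1.

Lemma Jf_derive x t : is_derive (fun u => Jf u t) x (- x * exp (- x ^ 2 * (1 + t ^ 2) / 2)).
Proof.
  unfold Jf. assert (1 + t ^ 2 <> 0) by (pose proof (pow2_ge_0 t); lra).
  auto_derive; [auto|].
  match goal with |- context [exp ?y] => replace y with (- x ^ 2 * (1 + t ^ 2) / 2) by (simpl; field) end.
  field. intros E. apply H. simpl. lra.
Qed.

Lemma Jf_continuous x t : continuous (Jf x) t.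
Proof.
  apply (ex_derive_continuous (Jf x)). unfold Jf.
  assert (1 + t * (t * 1) <> 0) by (pose proof (Rle_0_sqr t); unfold Rsqr in *; lra).
  auto_derive; auto.
Qed.

Lemma ex_RInt_Jf x : ex_RInt (Jf x) 0 1.
Proof. apply (ex_RInt_continuous (Jf x)). intros; apply Jf_continuous. Qed.

Lemma is_derive_Ji x : is_derive Ji x (- (gs x * Gi x)).
Proof.
  replace (- (gs x * Gi x)) with (RInt (fun t => Derive (fun u => Jf u t) x) 0 1).
  - apply (is_derive_RInt_param Jf 0 1 x).
    + apply filter_forall. intros y t _. eexists. apply Jf_derive.
    + intros t _.
      apply continuity_2d_pt_ext with (fun u v => - u * exp (- u ^ 2 * (1 + v ^ 2) / 2)).
      { intros u v. symmetry. apply is_derive_unique, Jf_derive. }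
      apply continuity_2d_pt_mult.
      * apply continuity_2d_pt_opp, continuity_2d_pt_id1.
      * apply (continuity_1d_2d_pt_comp exp (fun u v => - u ^ 2 * (1 + v ^ 2) / 2)).
        { apply derivable_continuous_pt, derivable_pt_exp. }
        apply continuity_2d_pt_ext with (fun u v => - (u * u) * (1 + v * v) * / 2).
        { intros u v. simpl. unfold Rdiv. ring. }
        repeat first [apply continuity_2d_pt_mult | apply continuity_2d_pt_opp
          | apply continuity_2d_pt_plus | apply continuity_2d_pt_id1 | apply continuity_2d_pt_id2
          | apply continuity_2d_pt_const].
    + apply filter_forall. intros y. apply ex_RInt_Jf.
  - assert (X : ex_RInt (fun t => x * gs (x * t + 0)) 0 1).
    { apply (ex_RInt_continuous (fun t => x * gs (x * t + 0))). intros z _.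
      apply (ex_derive_continuous (fun t => x * gs (x * t + 0))). unfold gs. auto_derive; auto. }
    transitivity (RInt (fun t => - gs x * (x * gs (x * t + 0))) 0 1).
    + apply RInt_ext. intros t _. transitivity (- x * exp (- x ^ 2 * (1 + t ^ 2) / 2)).
      * apply is_derive_unique, Jf_derive.
      * unfold gs. transitivity (- x * exp (- x ^ 2 / 2 + - (x * t + 0) ^ 2 / 2)).
        -- do 2 f_equal. field.
        -- rewrite exp_plus. eqR. ring.
    + transitivity (- gs x * RInt (fun t => x * gs (x * t + 0)) 0 1).
      * exact (RInt_scal (fun t => x * gs (x * t + 0)) 0 1 (- gs x) X).
      * transitivity (- gs x * RInt gs (x * 0 + 0) (x * 1 + 0)).
        -- f_equal. exact (RInt_comp_lin gs x 0 0 1 (ex_RInt_gs _ _)).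
        -- rewrite !Rmult_0_r, Rmult_1_r, !Rplus_0_r. apply Ropp_mult_distr_l_reverse.
Qed.

Lemma Ji_0 : Ji 0 = PI / 4.
Proof.
  unfold Ji. rewrite (RInt_ext _ (fun t => / (1 + t ^ 2))).
  - apply is_RInt_unique. replace (PI / 4) with (minus (atan 1) (atan 0)).
    + apply (is_RInt_derive atan (fun t => / (1 + t ^ 2))).
      * intros t _. apply is_derive_Reals, derivable_pt_lim_atan.
      * intros t _. apply (ex_derive_continuous (fun t => / (1 + t ^ 2))).
        assert (1 + t * (t * 1) <> 0) by (pose proof (Rle_0_sqr t); unfold Rsqr in *; lra).
        auto_derive; auto.
    + rewrite atan_1, atan_0. unfold minus, plus, opp; simpl. eqR. ring.
  - intros t _. unfold Jf. replace (- 0 ^ 2 * (1 + t ^ 2) / 2) with 0 by (simpl; field).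
    rewrite exp_0. unfold Rdiv. eqR. ring.
Qed.

Lemma Gi_sqr x : (Gi x)² = PI / 2 - 2 * Ji x.
Proof.
  enough (E : (Gi x)² / 2 + Ji x = (Gi 0)² / 2 + Ji 0).
  { rewrite Gi_0, Ji_0 in E. unfold Rsqr in *. lra. }
  assert (H : forall y, is_derive (fun x => (Gi x)² / 2 + Ji x) y 0).
  { intros y. replace 0 with (gs y * Gi y + - (gs y * Gi y)) by ring.
    apply (is_derive_plus (fun x => (Gi x)² / 2) Ji); [|apply is_derive_Ji].
    apply (is_derive_ext (fun x => / 2 * (Gi x * Gi x))); [intros; unfold Rsqr; simpl; field|].
    replace (gs y * Gi y) with (/ 2 * (gs y * Gi y + Gi y * gs y)) by field.
    apply (is_derive_scal (fun x => Gi x * Gi x)).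
    apply (is_derive_mult Gi Gi); try apply is_derive_Gi. intros; apply Rmult_comm. }
  destruct (MVT_gen (fun x => (Gi x)² / 2 + Ji x) 0 x (fun _ => 0)) as (c & _ & E).
  - intros y _. apply H.
  - intros y _. apply continuity_pt_filterlim.
    apply (ex_derive_continuous (fun x => (Gi x)² / 2 + Ji x)). eexists; apply H.
  - lra.
Qed.

(** The integral of [gs] over the half line, by [Gi_le_c0] and [Gi_lim]. *)
Definition c0 : R := sqrt (PI / 2).

Lemma c0_pos : 0 < c0.
Proof. apply sqrt_lt_R0. pose proof PI_RGT_0. lra. Qed.

Lemma Gi_mono a b : a <= b -> Gi a <= Gi b.
Proof.
  intros H. enough (0 <= Gi b - Gi a) by lra. rewrite Gi_diff.
  apply RInt_ge_0; [auto|apply ex_RInt_gs|]. intros; left; apply gs_pos.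
Qed.

Lemma Ji_bounds x : 0 <= Ji x <= gs x.
Proof.
  unfold Ji. split.
  - apply RInt_ge_0; [lra|apply ex_RInt_Jf|]. intros t _. unfold Jf. apply Rlt_le, Rdiv_lt_0_compat.
    + apply exp_pos.
    + pose proof (pow2_ge_0 t). lra.
  - replace (gs x) with (RInt (fun _ => gs x) 0 1).
    2:{ rewrite RInt_const. unfold scal; simpl; unfold mult; simpl. eqR. ring. }
    apply RInt_le; [lra|apply ex_RInt_Jf|apply ex_RInt_const|].
    intros t _. unfold Jf, gs. pose proof (pow2_ge_0 t). pose proof (pow2_ge_0 x).
    apply (Rmult_le_reg_r (1 + t ^ 2)); [lra|].
    unfold Rdiv at 1. rewrite Rmult_assoc, Rinv_l, Rmult_1_r by lra.
    apply Rle_trans with (exp (- x ^ 2 / 2)).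
    + apply exp_le_mono. nra.
    + pose proof (exp_pos (- x ^ 2 / 2)). nra.
Qed.

Lemma Gi_le_c0 x : Gi x <= c0.
Proof.
  destruct (Rle_lt_dec (Gi x) 0) as [H|H]; [pose proof c0_pos; lra|].
  unfold c0. rewrite <- (sqrt_Rsqr (Gi x)) by lra. apply sqrt_le_1_alt.
  rewrite Gi_sqr. pose proof (Ji_bounds x). lra.
Qed.

Lemma Gi_lim eps : 0 < eps -> exists K, 0 < K /\ forall x, K <= x -> c0 - eps <= Gi x.
Proof.
  intros He. pose proof c0_pos as Hc. set (K := 2 / (eps * c0) + 1).
  assert (HK : 0 < 2 / (eps * c0)) by (apply Rdiv_lt_0_compat; nra).
  exists K. split; [unfold K; lra|]. intros x Hx.
  assert (HG : 0 <= Gi x) by (rewrite <- Gi_0; apply Gi_mono; unfold K in Hx; lra).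
  assert (H1 : (Gi x)² = c0² - 2 * Ji x).
  { rewrite Gi_sqr. unfold c0. rewrite Rsqr_sqrt; [ring|]. pose proof PI_RGT_0. lra. }
  pose proof (Ji_bounds x) as HJ.
  assert (Hg : gs x <= eps * c0 / 2).
  { apply Rle_trans with (/ (2 / (eps * c0))).
    - apply Rle_trans with (exp (- (2 / (eps * c0)))); [|now apply exp_neg_le].
      unfold gs. apply exp_le_mono. unfold K in Hx. nra.
    - apply Req_le. field. lra. }
  pose proof (Gi_le_c0 x). unfold Rsqr in H1.
  apply Rnot_lt_le. intros Hlt. nra.
Qed.

Lemma gauss_improper x : improper_lower_integral gauss x ((c0 + Gi x) / sqrt (2 * PI)).
Proof.
  pose proof PI_RGT_0. assert (Hs : 0 < sqrt (2 * PI)) by (apply sqrt_lt_R0; lra).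
  assert (Hc : forall t, continuity_pt gauss t).
  { intros t. apply continuity_pt_filterlim. apply (ex_derive_continuous gauss).
    unfold gauss. auto_derive; lra. }
  split.
  - intros a Ha. constructor. apply continuity_implies_RiemannInt; auto.
  - intros eps He. destruct (Gi_lim (eps * sqrt (2 * PI) / 2)) as (K & HK & HL); [nra|].
    exists (- K). intros a pr Ha. rewrite <- RInt_Reals.
    assert (E : RInt gauss a x = (Gi x - Gi a) / sqrt (2 * PI)).
    { rewrite Gi_diff. rewrite (RInt_ext gauss (fun t => scal (/ sqrt (2 * PI)) (gs t))).
      - rewrite (RInt_scal gs) by apply ex_RInt_gs.
        unfold scal; simpl; unfold mult; simpl. unfold Rdiv. eqR. ring.
      - intros t _. unfold gauss, gs, scal; simpl; unfold mult; simpl. unfold Rdiv. eqR. ring. }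
    rewrite E. specialize (HL (- a) ltac:(lra)). rewrite Gi_odd in HL.
    pose proof (Gi_le_c0 (- a)). rewrite Gi_odd in *.
    replace ((Gi x - Gi a) / sqrt (2 * PI) - (c0 + Gi x) / sqrt (2 * PI)) with
      (- ((c0 + Gi a) / sqrt (2 * PI))) by (field; lra).
    rewrite Rabs_Ropp, Rabs_right.
    + apply (Rmult_lt_reg_r (sqrt (2 * PI))); [auto|].
      replace ((c0 + Gi a) / sqrt (2 * PI) * sqrt (2 * PI)) with (c0 + Gi a) by (field; lra). nra.
    + apply Rle_ge, Rmult_le_pos; [lra|left; now apply Rinv_0_lt_compat].
Qed.

(** * Riemann sums *)

Lemma riemann_gs s Y : 0 < s ->
  Gi (INR Y / s) <= rsum (fun r => gs (INR r / s)) Y / s <= Gi (INR Y / s) + / s.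
Proof.
  intros Hs. assert (Hi : 0 < / s) by (now apply Rinv_0_lt_compat).
  assert (B : forall r, gs (INR (S r) / s) / s <= Gi (INR (S r) / s) - Gi (INR r / s) <= gs (INR r / s) / s).
  { intros r. rewrite Gi_diff. pose proof (pos_INR r) as Hr.
    assert (H0 : 0 <= INR r / s) by (apply Rmult_le_pos; lra).
    assert (E : INR (S r) / s = INR r / s + / s) by (rewrite S_INR; field; lra).
    assert (C : forall c, RInt (fun _ => c) (INR r / s) (INR (S r) / s) = c / s).
    { intros c. rewrite RInt_const.
      transitivity ((INR (S r) / s - INR r / s) * c); [reflexivity|]. eqR. rewrite E. field. lra. }
    split.
    - rewrite <- C. apply RInt_le; [lra|apply ex_RInt_const|apply ex_RInt_gs|].
      intros t Ht. apply gs_decr. lra.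
    - rewrite <- (C (gs (INR r / s))). apply RInt_le; [lra|apply ex_RInt_gs|apply ex_RInt_const|].
      intros t Ht. apply gs_decr. lra. }
  (* Strengthened for induction: for the decreasing [gs], the error of the Riemann sum telescopes to
     [(gs 0 - gs (Y / s)) / s]. *)
  enough (HH : forall Y, Gi (INR Y / s) <= rsum (fun r => gs (INR r / s)) Y / s <=
     Gi (INR Y / s) + (1 - gs (INR Y / s)) / s).
  { specialize (HH Y). pose proof (gs_pos (INR Y / s)).
    assert ((1 - gs (INR Y / s)) / s <= / s) by (unfold Rdiv; nra). lra. }
  clear Y. induction Y as [|Y IH].
  - simpl. unfold Rdiv. rewrite !Rmult_0_l, Gi_0. unfold gs.
    replace (- 0 ^ 2 / 2) with 0 by (simpl; field). rewrite exp_0. lra.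
  - cbn [rsum]. specialize (B Y). unfold Rdiv in *. lra.
Qed.

(** Chosen so that the rate [alpha / sqrt n] at [k = r^2 / 2] becomes [(r / sig n)^2 / 2]; it agrees
    with [rk_scale] for [n >= 1]. *)
Definition sig (n : nat) : R := sqrt (sqrt (INR n) / alpha).

Lemma sig_sqr n : alpha * (sig n * sig n) = sqrt (INR n).
Proof.
  unfold sig. pose proof alpha_pos. rewrite sqrt_def; [field; lra|].
  apply Rmult_le_pos; [apply sqrt_pos|left; now apply Rinv_0_lt_compat].
Qed.

Lemma sig_unbounded M : exists N, forall n, (N <= n)%nat -> M <= sig n.
Proof.
  destruct (sqrt_unbounded (alpha * M²)) as [N HN]. exists N. intros n Hn. specialize (HN n Hn).
  destruct (Rle_lt_dec M 0) as [H|H]; [pose proof (sqrt_pos (sqrt (INR n) / alpha)); unfold sig; lra|].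
  rewrite <- (sqrt_Rsqr M) by lra. apply sqrt_le_1_alt. pose proof alpha_pos.
  apply (Rmult_le_reg_l alpha); [auto|].
  replace (alpha * (sqrt (INR n) / alpha)) with (sqrt (INR n)) by (field; lra). auto.
Qed.

(** * Sums of partition numbers along triangular numbers *)

Definition tn (r : nat) : nat := (r * (r + 1) / 2)%nat.

Lemma tn_spec r : (2 * tn r = r * (r + 1))%nat.
Proof.
  unfold tn. symmetry. apply Nat.Div0.div_exact.
  destruct (Nat.Even_or_Odd r) as [[q ->]|[q ->]].
  - replace (2 * q * (2 * q + 1))%nat with (q * (2 * q + 1) * 2)%nat by ring. apply Nat.Div0.mod_mul.
  - replace ((2 * q + 1) * (2 * q + 1 + 1))%nat with ((2 * q + 1) * (q + 1) * 2)%nat by ring.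
    apply Nat.Div0.mod_mul.
Qed.

Lemma tn_INR r : 2 * INR (tn r) = INR r * (INR r + 1).
Proof.
  pose proof (f_equal INR (tn_spec r)) as H. rewrite !mult_INR, plus_INR in H. simpl in H. lra.
Qed.

Definition triS (n Y : nat) : R := rsum (fun r => pn n (tn r)) Y.

Lemma triS_window K eps : 0 < K -> 0 < eps -> exists N, forall n, (N <= n)%nat ->
  0 < sig n /\ forall Y, INR Y <= K * sig n ->
    Rabs (triS n Y / (pn n 0 * sig n) - Gi (INR Y / sig n)) <= eps.
Proof.
  intros HK Heps. pose proof alpha_pos as Hal. pose proof c0_pos as Hc0.
  set (b := Rmin (1 / 4) (eps / (4 * (c0 + 1)))).
  assert (Hb : 0 < b <= 1 / 4).
  { unfold b. split; [|apply Rmin_l]. apply Rmin_glb_lt; [lra|apply Rdiv_lt_0_compat; lra]. }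
  assert (Heb : 4 * b * (c0 + 1) <= eps).
  { apply Rle_trans with (4 * (eps / (4 * (c0 + 1))) * (c0 + 1)).
    - apply Rmult_le_compat_r; [lra|]. apply Rmult_le_compat_l; [lra|]. apply Rmin_r.
    - apply Req_le. field. lra. }
  set (e := Rmin (b / 2) (ln (1 + b))).
  assert (Hln : 0 < ln (1 + b)) by (rewrite <- ln_1; apply ln_increasing; lra).
  assert (He : 0 < e /\ e <= b / 2 /\ e <= ln (1 + b)).
  { unfold e. split; [apply Rmin_glb_lt; lra|]. split; [apply Rmin_l|apply Rmin_r]. }
  assert (He1 : exp e <= 1 + b).
  { rewrite <- (exp_ln (1 + b)) by lra. apply exp_le_mono. lra. }
  destruct (pn_window (K² / alpha + 1) e) as [N1 HN1]; [|lra|].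
  { assert (0 < K² / alpha) by (apply Rdiv_lt_0_compat; [apply Rlt_0_sqr; lra|auto]). lra. }
  destruct (sig_unbounded (1 + K / e + / b)) as [N2 HN2].
  exists (N1 + N2)%nat. intros n Hn. destruct (HN1 n ltac:(lia)) as [Hs HP]. specialize (HN2 n ltac:(lia)).
  assert (0 < K / e) by (apply Rdiv_lt_0_compat; lra).
  assert (0 < / b) by (apply Rinv_0_lt_compat; lra).
  pose proof (sig_sqr n) as Hq. set (g := sig n) in *. split; [lra|].
  intros Y HY. pose proof (pn0_pos n) as HP0.
  pose proof (riemann_gs g Y ltac:(lra)) as HR.
  set (S1 := rsum (fun r => gs (INR r / g)) Y) in *.
  assert (T : forall r, (r < Y)%nat ->
    (1 - b) * pn n 0 * gs (INR r / g) <= pn n (tn r) <= (1 + b) * pn n 0 * gs (INR r / g)).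
  { intros r Hr. assert (HrK : INR r <= K * g) by (apply lt_INR in Hr; lra).
    pose proof (pos_INR r) as Hr0. pose proof (tn_INR r) as HT.
    assert (Hw : INR (tn r) <= (K² / alpha + 1) * sqrt (INR n)).
    { rewrite <- Hq.
      replace ((K² / alpha + 1) * (alpha * (g * g))) with (K² * (g * g) + alpha * (g * g)) by (field; lra).
      assert (INR (tn r) <= INR r * INR r).
      { destruct r as [|r]; [simpl in *; lra|]. rewrite S_INR in *. pose proof (pos_INR r). nra. }
      assert (INR r * INR r <= (K * g) * (K * g)) by (apply Rmult_le_compat; lra).
      unfold Rsqr. nra. }
    destruct (HP (tn r) Hw) as [H1 H2].
    (* The linear part of [r (r + 1) / 2] vanishes in the limit because [r = O(g)]. *)
    assert (E : alpha / sqrt (INR n) * INR (tn r) = (INR r / g) ^ 2 / 2 + INR r / (2 * g * g)).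
    { rewrite <- Hq. replace (INR (tn r)) with (INR r * (INR r + 1) / 2) by lra. field. lra. }
    rewrite E in H1, H2.
    assert (0 <= INR r / (2 * g * g) <= e).
    { split; [apply Rmult_le_pos; [auto|left; apply Rinv_0_lt_compat; nra]|].
      apply (Rmult_le_reg_r (2 * g * g)); [nra|].
      replace (INR r / (2 * g * g) * (2 * g * g)) with (INR r) by (field; lra).
      assert (K <= e * g).
      { replace K with (e * (K / e)) by (field; lra). apply Rmult_le_compat_l; lra. }
      nra. }
    pose proof (gs_pos (INR r / g)) as Hgp. pose proof (exp_ineq1_le (- (2 * e))).
    split.
    - eapply Rle_trans; [|exact H1].
      apply Rle_trans with (exp (- (2 * e)) * gs (INR r / g) * pn n 0).
      + apply Rle_trans with ((1 - b) * (gs (INR r / g) * pn n 0)); [lra|].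
        rewrite Rmult_assoc. apply Rmult_le_compat_r; [nra|lra].
      + apply Rmult_le_compat_r; [lra|]. unfold gs. rewrite <- exp_plus. apply exp_le_mono. lra.
    - eapply Rle_trans; [exact H2|].
      apply Rle_trans with (exp e * gs (INR r / g) * pn n 0).
      + apply Rmult_le_compat_r; [lra|]. unfold gs. rewrite <- exp_plus. apply exp_le_mono. lra.
      + apply Rle_trans with ((1 + b) * (gs (INR r / g) * pn n 0)); [|lra].
        rewrite Rmult_assoc. apply Rmult_le_compat_r; [nra|lra]. }
  assert (TU : triS n Y <= (1 + b) * pn n 0 * S1).
  { unfold triS, S1. rewrite <- rsum_scal. apply rsum_le. intros; now apply T. }
  assert (TL : (1 - b) * pn n 0 * S1 <= triS n Y).
  { unfold triS, S1. rewrite <- rsum_scal. apply rsum_le. intros; now apply T. }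
  set (G := Gi (INR Y / g)) in *.
  assert (HG : 0 <= G <= c0).
  { split; [|apply Gi_le_c0]. rewrite <- Gi_0. apply Gi_mono.
    apply Rmult_le_pos; [apply pos_INR|left; apply Rinv_0_lt_compat; lra]. }
  assert (Hgb : / g <= b).
  { rewrite <- (Rinv_inv b). apply Rinv_le_contravar; lra. }
  assert (HS1 : G <= S1 / g <= G + b) by lra.
  set (q := triS n Y / (pn n 0 * g)).
  assert (QU : q <= (1 + b) * (S1 / g)).
  { unfold q. apply (Rmult_le_reg_r (pn n 0 * g)); [nra|].
    replace (triS n Y / (pn n 0 * g) * (pn n 0 * g)) with (triS n Y) by (field; lra).
    replace ((1 + b) * (S1 / g) * (pn n 0 * g)) with ((1 + b) * pn n 0 * S1) by (field; lra). auto. }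
  assert (QL : (1 - b) * (S1 / g) <= q).
  { unfold q. apply (Rmult_le_reg_r (pn n 0 * g)); [nra|].
    replace (triS n Y / (pn n 0 * g) * (pn n 0 * g)) with (triS n Y) by (field; lra).
    replace ((1 - b) * (S1 / g) * (pn n 0 * g)) with ((1 - b) * pn n 0 * S1) by (field; lra). auto. }
  apply Rabs_le. nra.
Qed.

(** For [r = Y0 + i] with [Y0 >= K * sig n] one has [r (r + 1) >= i * K * sig n], so [pn_exp] gives
    a geometric series. The choice of [K] makes its decay rate [v = 4 / (eps * sig n)]. *)
Lemma triS_tail eps : 0 < eps -> exists K N, 0 < K /\ forall n, (N <= n)%nat ->
  forall Y0 Y, K * sig n <= INR Y0 -> (Y0 <= Y)%nat ->
    triS n Y <= triS n Y0 + eps * (pn n 0 * sig n).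
Proof.
  intros Heps. pose proof alpha_pos as Hal.
  set (K := 48 * alpha / eps). assert (HK : 0 < K) by (apply Rdiv_lt_0_compat; lra).
  destruct (sig_unbounded (1 + 4 / eps)) as [N HN].
  exists K, (S N). split; [auto|]. intros n Hn Y0 Y HY0 HY. specialize (HN n ltac:(lia)).
  assert (0 < 4 / eps) by (apply Rdiv_lt_0_compat; lra).
  pose proof (sig_sqr n) as Hq. pose proof (pn0_pos n) as HP0.
  pose proof (fun k => pn_exp n k ltac:(lia)) as HE. set (g := sig n) in *.
  unfold triS. replace Y with (Y0 + (Y - Y0))%nat by lia. rewrite rsum_add.
  apply Rplus_le_compat_l. set (m := (Y - Y0)%nat).
  assert (0 < alpha * g) by (apply Rmult_lt_0_compat; lra).
  assert (0 < alpha * (g * g)) by (rewrite <- Rmult_assoc; apply Rmult_lt_0_compat; lra).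
  set (v := K / (12 * alpha * g)). assert (Hv : 0 < v) by (apply Rdiv_lt_0_compat; lra).
  apply Rle_trans with (rsum (fun i => 2 * pn n 0 * exp (- v) ^ i) m).
  - apply rsum_le. intros i _. eapply Rle_trans; [apply HE|].
    rewrite (Rmult_comm (2 * exp _)), <- Rmult_assoc, (Rmult_comm (pn n 0)).
    apply Rmult_le_compat_l; [lra|]. rewrite exp_pow. apply exp_le_mono.
    rewrite <- Ropp_mult_distr_r. apply Ropp_le_contravar.
    pose proof (tn_INR (Y0 + i)) as HT. set (r := (Y0 + i)%nat) in *.
    assert (Hr : K * g <= INR r /\ INR i <= INR r).
    { unfold r. rewrite plus_INR. pose proof (pos_INR i). pose proof (pos_INR Y0). lra. }
    rewrite <- Hq. pose proof (pos_INR i).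
    apply (Rmult_le_reg_r (12 * alpha * (g * g))); [nra|].
    replace (INR i * v * (12 * alpha * (g * g))) with (INR i * (K * g)) by (unfold v; field; lra).
    replace (/ (6 * (alpha * (g * g))) * INR (tn r) * (12 * alpha * (g * g))) with (2 * INR (tn r))
      by (field; lra).
    rewrite HT. apply Rle_trans with (INR r * INR r); [apply Rmult_le_compat; nra|nra].
  - rewrite rsum_scal.
    assert (Hx : exp (- v) * (1 + v) <= 1).
    { rewrite exp_Ropp. pose proof (exp_pos v). apply (Rmult_le_reg_l (exp v)); [auto|].
      rewrite <- Rmult_assoc, Rinv_r by lra. pose proof (exp_ineq1_le v). lra. }
    pose proof (exp_pos (- v)) as Hx0. set (x := exp (- v)) in *.
    assert (Hg : forall m, (1 - x) * rsum (fun i => x ^ i) m = 1 - x ^ m).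
    { induction m0 as [|k IH]; [simpl; ring|]. cbn [rsum]. rewrite Rmult_plus_distr_l, IH. simpl. ring. }
    specialize (Hg m). pose proof (pow_lt x m Hx0).
    set (s1 := rsum _ m) in *.
    assert (Hs1 : v * s1 <= 1 + v).
    { assert (0 <= s1) by (apply rsum_nonneg; intros; left; now apply pow_lt).
      assert (v <= (1 + v) * (1 - x)) by nra.
      apply Rle_trans with ((1 + v) * (1 - x) * s1); [apply Rmult_le_compat_r; auto|].
      rewrite Rmult_assoc, Hg. nra. }
    assert (Ev : v = 4 / (eps * g)) by (unfold v, K; field; lra).
    assert (Hge : 4 <= eps * g).
    { replace 4 with (eps * (4 / eps)) by (field; lra). apply Rmult_le_compat_l; lra. }
    assert (Hs2 : 4 * s1 <= eps * g + 4).
    { replace (4 * s1) with (eps * g * (v * s1)) by (rewrite Ev; field; lra).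
      replace (eps * g + 4) with (eps * g * (1 + v)) by (rewrite Ev; field; lra).
      apply Rmult_le_compat_l; [lra|auto]. }
    assert (2 * s1 <= eps * g) by lra. nra.
Qed.

Lemma triS_mono n Y Y' : (Y <= Y')%nat -> triS n Y <= triS n Y'.
Proof. intros H. apply rsum_le_len; [auto|]. intros; apply pn_nonneg. Qed.

Definition wt (n : nat) : R := pn n 0 * sig n.

Lemma triS_lim (Y : nat -> nat) (y : R) :
  is_lim_seq (fun n => INR (Y n) / sig n) y ->
  is_lim_seq (fun n => triS n (Y n) / wt n) (Gi y).
Proof.
  intros HY.
  assert (HG : is_lim_seq (fun n => Gi (INR (Y n) / sig n)) (Gi y)).
  { apply (is_lim_seq_continuous Gi); [|auto]. apply continuity_pt_filterlim.
    apply (ex_derive_continuous Gi). eexists. apply is_derive_Gi. }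
  apply is_lim_seq_spec. intros [e He]. simpl.
  apply is_lim_seq_spec in HG. destruct (HG (pos_div_2 (mkposreal e He))) as [N1 H1]. simpl in H1.
  apply is_lim_seq_spec in HY. destruct (HY (mkposreal 1 Rlt_0_1)) as [N2 H2]. simpl in H2.
  destruct (triS_window (Rabs y + 1) (e / 3)) as [N3 H3]; [pose proof (Rabs_pos y); lra|lra|].
  exists (N1 + N2 + N3)%nat. intros n Hn.
  specialize (H1 n ltac:(lia)). specialize (H2 n ltac:(lia)).
  destruct (H3 n ltac:(lia)) as [Hs H4]. specialize (H4 (Y n)).
  assert (HK : INR (Y n) <= (Rabs y + 1) * sig n).
  { apply Rabs_def2 in H2. pose proof (Rle_abs y).
    apply (Rmult_le_reg_r (/ sig n)); [now apply Rinv_0_lt_compat|].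
    rewrite Rmult_assoc, Rinv_r by lra. unfold Rdiv in H2. lra. }
  specialize (H4 HK). unfold wt.
  replace (triS n (Y n) / (pn n 0 * sig n) - Gi y) with
    ((triS n (Y n) / (pn n 0 * sig n) - Gi (INR (Y n) / sig n)) + (Gi (INR (Y n) / sig n) - Gi y)) by ring.
  eapply Rle_lt_trans; [apply Rabs_triang|]. lra.
Qed.

Lemma triS_lim_infty (Y : nat -> nat) :
  is_lim_seq (fun n => INR (Y n) / sig n) p_infty ->
  is_lim_seq (fun n => triS n (Y n) / wt n) c0.
Proof.
  intros HY. apply is_lim_seq_spec. intros [e He]. simpl.
  destruct (triS_tail (e / 4) ltac:(lra)) as (K1 & N1 & HK1 & H1).
  destruct (Gi_lim (e / 4) ltac:(lra)) as (K2 & HK2 & H2).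
  set (K := K1 + K2).
  destruct (triS_window (K + 1) (e / 4)) as [N3 H3]; [unfold K; lra|lra|].
  destruct (sig_unbounded 1) as [N4 H4].
  apply is_lim_seq_spec in HY. destruct (HY (K + 1)) as [N5 H5].
  exists (N1 + N3 + N4 + N5)%nat. intros n Hn.
  specialize (H4 n ltac:(lia)). specialize (H5 n ltac:(lia)).
  destruct (H3 n ltac:(lia)) as [Hs H6].
  destruct (nat_ceil (K * sig n)) as [Y0 HY0]; [unfold K; nra|].
  assert (HYY : (Y0 <= Y n)%nat).
  { apply INR_le. apply Rle_trans with ((K + 1) * sig n); [lra|].
    apply (Rmult_le_reg_r (/ sig n)); [now apply Rinv_0_lt_compat|].
    rewrite Rmult_assoc, Rinv_r by lra. unfold Rdiv in H5. lra. }
  pose proof (H1 n ltac:(lia) Y0 (Y n) ltac:(unfold K in *; nra) HYY) as HT.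
  pose proof (triS_mono n _ _ HYY) as HM.
  specialize (H6 Y0 ltac:(lra)). fold (wt n) in *.
  assert (Hw : 0 < wt n) by (unfold wt; pose proof (pn0_pos n); nra).
  assert (HG : c0 - e / 4 <= Gi (INR Y0 / sig n) <= c0).
  { split; [|apply Gi_le_c0]. apply H2. apply (Rmult_le_reg_r (sig n)); [auto|].
    replace (INR Y0 / sig n * sig n) with (INR Y0) by (field; lra). unfold K in *. nra. }
  assert (Q1 : triS n Y0 / wt n <= triS n (Y n) / wt n).
  { apply Rmult_le_compat_r; [left; now apply Rinv_0_lt_compat|auto]. }
  assert (Q2 : triS n (Y n) / wt n <= triS n Y0 / wt n + e / 4).
  { replace (triS n Y0 / wt n + e / 4) with ((triS n Y0 + e / 4 * wt n) / wt n) by (field; lra).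
    apply Rmult_le_compat_r; [left; now apply Rinv_0_lt_compat|auto]. }
  apply Rabs_le_between in H6. apply Rabs_def1; lra.
Qed.

(** * Limits of cumulative counts *)

Lemma sig_pos n : (1 <= n)%nat -> 0 < sig n.
Proof.
  intros H. apply sqrt_lt_R0. apply Rdiv_lt_0_compat; [|apply alpha_pos].
  pose proof (sqrt_INR_ge1 n H). lra.
Qed.

Lemma wt_pos n : (1 <= n)%nat -> 0 < wt n.
Proof. intros H. apply Rmult_lt_0_compat; [apply pn0_pos|now apply sig_pos]. Qed.

Lemma sig_ratio : is_lim_seq (fun n => sig (S n) / sig n) 1.
Proof.
  apply is_lim_seq_le_le_loc with (fun _ => 1) (fun n => 1 + / INR n).
  - exists 1%nat. intros n Hn. pose proof (sig_pos n Hn) as H0. pose proof (sig_pos (S n) ltac:(lia)) as H1.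
    pose proof (sig_sqr n) as E0. pose proof (sig_sqr (S n)) as E1. pose proof alpha_pos as Ha.
    pose proof (sqrt_INR_ge1 n Hn). pose proof (sqrt_INR_sqr n) as Q0.
    pose proof (sqrt_INR_sqr (S n)) as Q1. rewrite S_INR in Q1 at 3.
    assert (HN : 1 <= INR n) by (apply (le_INR 1); auto).
    assert (Hi : 0 < / INR n) by (apply Rinv_0_lt_compat; lra).
    assert (Hs : sqrt (INR n) <= sqrt (INR (S n)) <= (1 + / INR n) * sqrt (INR n)).
    { split; [apply sqrt_le_1_alt, le_INR; lia|].
      apply Rsqr_incr_0_var; [|nra]. unfold Rsqr. rewrite Q1.
      replace ((1 + / INR n) * sqrt (INR n) * ((1 + / INR n) * sqrt (INR n))) with
        ((1 + / INR n) * (1 + / INR n) * INR n) by (rewrite <- Q0 at 3; ring).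
      replace ((1 + / INR n) * (1 + / INR n) * INR n) with (INR n + 2 + / INR n) by (field; lra). lra. }
    set (a := sig n) in *. set (b := sig (S n)) in *.
    assert (Hab : a * a <= b * b <= (1 + / INR n) * (a * a)).
    { split; apply (Rmult_le_reg_l alpha); auto; nra. }
    assert (Hb : a <= b <= (1 + / INR n) * a).
    { split; apply Rsqr_incr_0_var; unfold Rsqr; nra. }
    split; apply (Rmult_le_reg_r a); auto; replace (b / a * a) with b by (field; lra); lra.
  - apply is_lim_seq_const.
  - replace (Finite 1) with (Finite (1 + 0)) by (f_equal; ring).
    apply is_lim_seq_plus'; [apply is_lim_seq_const|].
    apply (is_lim_seq_inv INR p_infty); [apply is_lim_seq_INR|discriminate].
Qed.

Lemma sqrt_lim : is_lim_seq (fun n => sqrt (INR n)) p_infty.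
Proof.
  apply is_lim_seq_spec. intros M. destruct (sqrt_unbounded (M + 1)) as [N HN].
  exists N. intros n Hn. specialize (HN n Hn). lra.
Qed.

Lemma sig_lim : is_lim_seq sig p_infty.
Proof.
  apply is_lim_seq_spec. intros M. destruct (sig_unbounded (M + 1)) as [N HN].
  exists N. intros n Hn. specialize (HN n Hn). lra.
Qed.

(** [p(n) / p(n + 1)] is [1 - theta (n + 1) / sqrt (n + 1)], and [theta] converges. *)
Lemma pn_ratio_lim : is_lim_seq (fun n => pn (S n) 0 / pn n 0) 1.
Proof.
  assert (H : is_lim_seq (fun n => / (1 - theta (S n) * / sqrt (INR (S n)))) (/ (1 - alpha * 0))).
  { apply (is_lim_seq_inv (fun n => 1 - theta (S n) * / sqrt (INR (S n))) (1 - alpha * 0)).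
    - apply is_lim_seq_minus'; [apply is_lim_seq_const|].
      apply (is_lim_seq_incr_1 (fun n => theta n * / sqrt (INR n))).
      apply is_lim_seq_mult'; [apply theta_lim|].
      apply (is_lim_seq_inv (fun n => sqrt (INR n)) p_infty); [apply sqrt_lim|discriminate].
    - injection. lra. }
  replace (/ (1 - alpha * 0)) with 1 in H by (field; lra).
  apply is_lim_seq_ext with (2 := H). intros n. unfold theta.
  pose proof (sqrt_INR_ge1 (S n) ltac:(lia)). pose proof (pn0_pos (S n)). pose proof (pn0_pos n).
  replace (pn n 0) with (pn (S n) 0 - dP (S n) 0) in *.
  - field. repeat split; lra.
  - rewrite <- pn_S. rewrite <- (pn_shift n 0 1). f_equal. lia.
Qed.

Lemma ratio_shift (u : nat -> R) (h : nat) : (forall n, (1 <= n)%nat -> 0 < u n) ->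
  is_lim_seq (fun n => u (S n) / u n) 1 -> is_lim_seq (fun n => u (n + h)%nat / u n) 1.
Proof.
  intros Hu H. induction h as [|h IH].
  - apply is_lim_seq_ext_loc with (fun _ => 1); [|apply is_lim_seq_const].
    exists 1%nat. intros n Hn. rewrite Nat.add_0_r. specialize (Hu n Hn). field. lra.
  - replace (Finite 1) with (Finite (1 * 1)) by (f_equal; ring).
    apply is_lim_seq_ext_loc with (fun n => u (S (n + h)) / u (n + h)%nat * (u (n + h)%nat / u n)).
    + exists 1%nat. intros n Hn. pose proof (Hu n Hn). pose proof (Hu (n + h)%nat ltac:(lia)).
      rewrite Nat.add_succ_r. field. lra.
    + apply is_lim_seq_mult'; [|auto].
      apply (is_lim_seq_incr_n (fun n => u (S n) / u n) h). exact H.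
Qed.

Lemma sig_shift h : is_lim_seq (fun n => sig (n + h) / sig n) 1.
Proof. apply ratio_shift; [apply sig_pos|apply sig_ratio]. Qed.

Lemma wt_shift h : is_lim_seq (fun n => wt (n + h) / wt n) 1.
Proof.
  apply ratio_shift; [apply wt_pos|]. replace (Finite 1) with (Finite (1 * 1)) by (f_equal; ring).
  apply is_lim_seq_ext_loc with (fun n => pn (S n) 0 / pn n 0 * (sig (S n) / sig n)).
  - exists 1%nat. intros n Hn. unfold wt. pose proof (pn0_pos n). pose proof (sig_pos n Hn). field. lra.
  - apply is_lim_seq_mult'; [apply pn_ratio_lim|apply sig_ratio].
Qed.

(** The integral of [gs] from minus infinity to [x]. *)
Definition Lval (x : Rbar) : R :=
  match x with Finite r => c0 + Gi r | p_infty => 2 * c0 | m_infty => 0 end.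

(** Stated along arbitrary sequences [X] so that it survives the bounded shifts of [n] and of the
    rank in the recursion on [c]. The value [p_infty] covers the full count. *)
Definition conv (f : nat -> Z -> R) (kappa : R) : Prop :=
  forall (X : nat -> Z) (x : Rbar), x <> m_infty ->
    is_lim_seq (fun n => IZR (X n) / sig n) x ->
    is_lim_seq (fun n => f n (X n) / wt n) (kappa * Lval x).

Lemma mult_one_lim (u v : nat -> R) (x : Rbar) : is_lim_seq u x -> is_lim_seq v 1 ->
  is_lim_seq (fun n => u n * v n) x.
Proof.
  intros Hu Hv. apply (is_lim_seq_mult u v x 1 x Hu Hv).
  destruct x as [x| |].
  - unfold is_Rbar_mult. simpl. do 2 f_equal. ring.
  - unfold is_Rbar_mult. simpl. destruct (Rle_dec 0 1) as [H|H]; [|lra].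
    destruct (Rle_lt_or_eq_dec 0 1 H); [reflexivity|lra].
  - unfold is_Rbar_mult. simpl. destruct (Rle_dec 0 1) as [H|H]; [|lra].
    destruct (Rle_lt_or_eq_dec 0 1 H); [reflexivity|lra].
Qed.

Lemma bounded_shift_lim (X : nat -> Z) (e : Z) (x : Rbar) :
  is_lim_seq (fun n => IZR (X n) / sig n) x ->
  is_lim_seq (fun n => IZR (X n + e) / sig n) x.
Proof.
  intros H. apply is_lim_seq_ext with (fun n => IZR (X n) / sig n + IZR e * / sig n).
  { intros n. rewrite plus_IZR. unfold Rdiv. ring. }
  apply (is_lim_seq_plus _ _ x 0 x H).
  - replace (Finite 0) with (Finite (IZR e * 0)) by (f_equal; ring).
    apply is_lim_seq_mult'; [apply is_lim_seq_const|].
    apply (is_lim_seq_inv sig p_infty); [apply sig_lim|discriminate].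
  - destruct x; unfold is_Rbar_plus; simpl; auto. do 2 f_equal. ring.
Qed.

(** [sig] and [wt] change by a factor tending to 1 under [n -> n + h]; [conv] is applied to [X]
    reindexed by [m = n + h]. *)
Lemma conv_up f kappa h e X x : conv f kappa -> x <> m_infty ->
  is_lim_seq (fun n => IZR (X n) / sig n) x ->
  is_lim_seq (fun n => f (n + h)%nat (X n + e)%Z / wt n) (kappa * Lval x).
Proof.
  intros Hf Hx HX.
  assert (H : is_lim_seq (fun m => f m (X (m - h)%nat + e)%Z / wt m) (kappa * Lval x)).
  { apply (Hf (fun m => (X (m - h)%nat + e)%Z)); [auto|].
    apply bounded_shift_lim. apply (is_lim_seq_incr_n _ h).
    apply is_lim_seq_ext_loc with (fun n => IZR (X n) / sig n * / (sig (n + h) / sig n)).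
    - exists 1%nat. intros n Hn. pose proof (sig_pos n Hn). pose proof (sig_pos (n + h) ltac:(lia)).
      replace (n + h - h)%nat with n by lia. field. lra.
    - apply mult_one_lim; [auto|]. replace (Finite 1) with (Rbar_inv 1) by (simpl; f_equal; field).
      apply is_lim_seq_inv; [apply sig_shift|]. injection; lra. }
  apply (is_lim_seq_incr_n _ h) in H.
  apply is_lim_seq_ext_loc with
    (fun n => f (n + h)%nat (X (n + h - h)%nat + e)%Z / wt (n + h) * (wt (n + h) / wt n)).
  - exists 1%nat. intros n Hn. pose proof (wt_pos n Hn). pose proof (wt_pos (n + h) ltac:(lia)).
    replace (n + h - h)%nat with n by lia. field. lra.
  - apply mult_one_lim; [auto|apply wt_shift].
Qed.

Lemma conv_down f kappa h X x : conv f kappa -> x <> m_infty ->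
  is_lim_seq (fun n => IZR (X n) / sig n) x ->
  is_lim_seq (fun n => f (n - h)%nat (X n) / wt n) (kappa * Lval x).
Proof.
  intros Hf Hx HX. apply (is_lim_seq_incr_n _ h).
  assert (H : is_lim_seq (fun m => f m (X (m + h)%nat) / wt m) (kappa * Lval x)).
  { apply (Hf (fun m => X (m + h)%nat)); [auto|].
    apply (is_lim_seq_incr_n _ h) in HX.
    apply is_lim_seq_ext_loc with (fun n => IZR (X (n + h)%nat) / sig (n + h) * (sig (n + h) / sig n)).
    - exists 1%nat. intros n Hn. pose proof (sig_pos n Hn). pose proof (sig_pos (n + h) ltac:(lia)).
      field. lra.
    - apply mult_one_lim; [auto|apply sig_shift]. }
  apply is_lim_seq_ext_loc with
    (fun n => f n (X (n + h)%nat) / wt n * / (wt (n + h) / wt n)).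
  - exists 1%nat. intros n Hn. pose proof (wt_pos n Hn). pose proof (wt_pos (n + h) ltac:(lia)).
    replace (n + h - h)%nat with n by lia. field. lra.
  - apply mult_one_lim; [auto|]. replace (Finite 1) with (Rbar_inv 1) by (simpl; f_equal; field).
    apply is_lim_seq_inv; [apply wt_shift|]. injection; lra.
Qed.

(** * Limit law for pairs with parts above [c] *)

Definition cumR (c : Z) (n : nat) (X : Z) : R := IZR (cum c (Z.of_nat n) X).
Definition cumJ (n : nat) (X : Z) : R := cumR 0 n X + cumR 0 n (X + 1).

Lemma cumJ_diff n X : cumJ n X = cumJ n (X - 1) + IZR (part (Z.of_nat n - tri X)).
Proof.
  unfold cumJ, cumR. replace (X - 1 + 1)%Z with X by lia. rewrite <- !plus_IZR.
  f_equal. apply cum_jacobi.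
Qed.

Lemma pn_tn n (r : nat) : IZR (part (Z.of_nat n - tri (Z.of_nat r))) = pn n (tn r).
Proof.
  unfold pn. do 3 f_equal. pose proof (tri_spec (Z.of_nat r)). pose proof (tn_spec r). nia.
Qed.

Lemma cumJ_up n Y : cumJ n (Z.of_nat Y - 1) = cumJ n (-1) + triS n Y.
Proof.
  unfold triS. induction Y as [|Y IH]; [simpl; ring|].
  rewrite cumJ_diff. replace (Z.of_nat (S Y) - 1)%Z with (Z.of_nat Y) by lia.
  rewrite IH, pn_tn. simpl. ring.
Qed.

(** [tri (-1 - r) = tri r], so the increments below [-1] mirror those from 0 upwards. *)
Lemma cumJ_down n Y : cumJ n (-1 - Z.of_nat Y) = cumJ n (-1) - triS n Y.
Proof.
  unfold triS. induction Y as [|Y IH]; [simpl; ring|].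
  rewrite cumJ_diff in IH. replace (-1 - Z.of_nat Y - 1)%Z with (-1 - Z.of_nat (S Y))%Z in IH by lia.
  replace (tri (-1 - Z.of_nat Y)) with (tri (Z.of_nat Y)) in IH.
  - rewrite pn_tn in IH. simpl rsum. lra.
  - pose proof (tri_spec (-1 - Z.of_nat Y)). pose proof (tri_spec (Z.of_nat Y)). nia.
Qed.

Lemma cumJ_triS n X :
  cumJ n X = triS n (n + 1) + triS n (Z.to_nat (X + 1)) - triS n (Z.to_nat (- 1 - X)).
Proof.
  (* Going [n + 1] steps below [-1] reaches ranks that no pair of total [n] has, where [cumJ] is
     0. *)
  assert (E : cumJ n (-1) = triS n (n + 1)).
  { pose proof (cumJ_down n (n + 1)) as H. unfold cumJ at 1, cumR in H.
    rewrite !cum_low in H by lia. lra. }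
  rewrite <- E. destruct (Z.le_gt_cases (-1) X).
  - replace (Z.to_nat (-1 - X)) with O by lia.
    pose proof (cumJ_up n (Z.to_nat (X + 1))) as H1.
    replace (Z.of_nat (Z.to_nat (X + 1)) - 1)%Z with X in H1 by lia.
    rewrite H1. unfold triS at 3. simpl. ring.
  - replace (Z.to_nat (X + 1)) with O by lia.
    pose proof (cumJ_down n (Z.to_nat (-1 - X))) as H1.
    replace (-1 - Z.of_nat (Z.to_nat (-1 - X)))%Z with X in H1 by lia.
    rewrite H1. unfold triS at 2. simpl. ring.
Qed.

Lemma INR_to_nat z : INR (Z.to_nat z) = (IZR z + Rabs (IZR z)) / 2.
Proof.
  destruct (Z.le_gt_cases 0 z) as [H|H].
  - rewrite INR_IZR_INZ, Z2Nat.id by auto. apply IZR_le in H. rewrite Rabs_right by lra. field.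
  - replace (Z.to_nat z) with O by lia. apply IZR_lt in H. rewrite Rabs_left by auto. simpl. field.
Qed.

Lemma to_nat_lim (X : nat -> Z) (x : R) : is_lim_seq (fun n => IZR (X n) / sig n) x ->
  is_lim_seq (fun n => INR (Z.to_nat (X n)) / sig n) ((x + Rabs x) / 2).
Proof.
  intros H.
  apply is_lim_seq_ext_loc with (fun n => (IZR (X n) / sig n + Rabs (IZR (X n) / sig n)) * / 2).
  - exists 1%nat. intros n Hn. pose proof (sig_pos n Hn). rewrite INR_to_nat.
    unfold Rdiv at 2. rewrite Rabs_mult, (Rabs_right (/ sig n)); [field; lra|].
    apply Rle_ge. left. now apply Rinv_0_lt_compat.
  - apply is_lim_seq_mult'; [|apply is_lim_seq_const].
    apply is_lim_seq_plus'; [auto|]. apply (is_lim_seq_abs _ x H).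
Qed.

Lemma conv_cumJ : conv cumJ 1.
Proof.
  intros X x Hx HX.
  assert (L1 : is_lim_seq (fun n => triS n (n + 1) / wt n) c0).
  { apply triS_lim_infty. apply is_lim_seq_le_p_loc with (fun n => alpha * sig n).
    - exists 1%nat. intros n Hn. pose proof (sig_pos n Hn) as Hs. pose proof (sig_sqr n) as E.
      pose proof (sqrt_INR_sqr n) as Q. pose proof (sqrt_INR_ge1 n Hn).
      apply (Rmult_le_reg_r (sig n)); [auto|].
      replace (INR (n + 1) / sig n * sig n) with (INR (n + 1)) by (field; lra).
      rewrite Rmult_assoc, E, plus_INR. simpl. nra.
    - replace p_infty with (Rbar_mult alpha p_infty).
      + apply (is_lim_seq_scal_l sig alpha p_infty), sig_lim.
      + pose proof alpha_pos. simpl. destruct (Rle_dec 0 alpha) as [H'|H']; [|lra].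
        destruct (Rle_lt_or_eq_dec 0 alpha H'); [reflexivity|lra]. }
  assert (L : forall l1 l2, is_lim_seq (fun n => triS n (Z.to_nat (X n + 1)) / wt n) (Finite l1) ->
     is_lim_seq (fun n => triS n (Z.to_nat (-1 - X n)) / wt n) (Finite l2) ->
     is_lim_seq (fun n => cumJ n (X n) / wt n) (c0 + l1 - l2)).
  { intros l1 l2 H1 H2. apply is_lim_seq_ext with (fun n => triS n (n + 1) / wt n +
      triS n (Z.to_nat (X n + 1)) / wt n - triS n (Z.to_nat (-1 - X n)) / wt n).
    - intros n. rewrite cumJ_triS. unfold Rdiv. ring.
    - apply is_lim_seq_minus'; [apply is_lim_seq_plus'|]; auto. }
  rewrite Rmult_1_l. destruct x as [x| |]; [| |congruence].
  - simpl. replace (c0 + Gi x) with (c0 + Gi ((x + Rabs x) / 2) - Gi ((- x + Rabs (- x)) / 2)).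
    + apply L; apply triS_lim, to_nat_lim.
      * now apply bounded_shift_lim.
      * apply (is_lim_seq_ext (fun n => IZR (- X n + -1) / sig n)).
        { intros n. replace (-1 - X n)%Z with (- X n + -1)%Z by lia. reflexivity. }
        apply bounded_shift_lim. apply is_lim_seq_ext with (fun n => - (IZR (X n) / sig n)).
        { intros n. rewrite opp_IZR. unfold Rdiv. ring. }
        apply (proj1 (is_lim_seq_opp _ x) HX).
    + rewrite Rabs_Ropp. destruct (Rle_lt_dec 0 x).
      * rewrite Rabs_right by lra. replace ((x + x) / 2) with x by field.
        replace ((- x + x) / 2) with 0 by field. rewrite Gi_0. ring.
      * rewrite Rabs_left by lra. replace ((x + - x) / 2) with 0 by field.
        replace ((- x + - x) / 2) with (- x) by field. rewrite Gi_0, Gi_odd. ring.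
  - simpl. replace (2 * c0) with (c0 + c0 - 0) by ring. apply L.
    + apply triS_lim_infty. apply is_lim_seq_le_p_loc with (fun n => IZR (X n + 1) / sig n).
      * exists 1%nat. intros n Hn. pose proof (sig_pos n Hn).
        apply Rmult_le_compat_r; [left; now apply Rinv_0_lt_compat|].
        rewrite INR_to_nat. pose proof (Rle_abs (IZR (X n + 1))). lra.
      * now apply bounded_shift_lim.
    + apply is_lim_seq_ext_loc with (fun _ => 0); [|apply is_lim_seq_const].
      apply is_lim_seq_spec in HX. destruct (HX 0) as [N HN]. exists (N + 1)%nat. intros n Hn.
      specialize (HN n ltac:(lia)). pose proof (sig_pos n ltac:(lia)) as Hs.
      assert (0 < IZR (X n)).
      { apply (Rmult_lt_reg_r (/ sig n)); [now apply Rinv_0_lt_compat|]. unfold Rdiv in HN. lra. }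
      apply lt_IZR in H. replace (Z.to_nat (-1 - X n)) with O by lia.
      unfold triS. simpl. unfold Rdiv. ring.
Qed.

Lemma conv_sandwich f g1 g2 kappa :
  (forall X x, x <> m_infty -> is_lim_seq (fun n => IZR (X n) / sig n) x ->
    is_lim_seq (fun n => g1 n (X n) / wt n) (kappa * Lval x) /\
    is_lim_seq (fun n => g2 n (X n) / wt n) (kappa * Lval x)) ->
  eventually (fun n => forall X, g1 n X <= f n X <= g2 n X) -> conv f kappa.
Proof.
  intros Hg [N HN] X x Hx HX. destruct (Hg X x Hx HX) as [H1 H2].
  apply is_lim_seq_le_le_loc with (fun n => g1 n (X n) / wt n) (fun n => g2 n (X n) / wt n); auto.
  exists (N + 1)%nat. intros n Hn. specialize (HN n ltac:(lia) (X n)).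
  pose proof (Rinv_0_lt_compat _ (wt_pos n ltac:(lia))). unfold Rdiv. nra.
Qed.

Lemma scale_lim (f : nat -> R) (a l : R) : is_lim_seq (fun n => f n / wt n) l ->
  is_lim_seq (fun n => a * f n / wt n) (a * l).
Proof.
  intros H. apply is_lim_seq_ext with (fun n => a * (f n / wt n)); [intros; unfold Rdiv; ring|].
  apply is_lim_seq_mult'; [apply is_lim_seq_const|exact H].
Qed.

(** By monotonicity in the rank, [2 * cumR 0 n X] lies between [cumJ n (X - 1)] and [cumJ n X],
    which have the same limit. *)
Lemma conv_cum0 : conv (cumR 0) (/ 2).
Proof.
  apply conv_sandwich with (fun n X => / 2 * cumJ n (X - 1)) (fun n X => / 2 * cumJ n X).
  - intros X x Hx HX. pose proof (conv_up cumJ 1 0 (-1) X x conv_cumJ Hx HX) as H1.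
    pose proof (conv_cumJ X x Hx HX) as H2. split.
    + rewrite <- (Rmult_1_l (Lval x)). apply scale_lim.
      apply is_lim_seq_ext with (2 := H1). intros n. rewrite Nat.add_0_r. do 2 f_equal.
    + rewrite <- (Rmult_1_l (Lval x)). apply scale_lim. auto.
  - exists O. intros n _ X. unfold cumJ, cumR. replace (X - 1 + 1)%Z with X by lia.
    pose proof (IZR_le _ _ (cum_mono_rank 0 (Z.of_nat n) (X - 1) X ltac:(lia))).
    pose proof (IZR_le _ _ (cum_mono_rank 0 (Z.of_nat n) X (X + 1) ltac:(lia))). lra.
Qed.

(** Each of the four terms of [cum_step] is at most [cum c] at its largest total and rank, and at
    least [cum c] at its smallest; shifting the arguments once gives each half of the sandwich. *)
Lemma conv_cum_step (c : Z) kappa : (1 <= c)%Z -> conv (cumR (c - 1)) kappa ->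
  conv (cumR c) (kappa / 4).
Proof.
  intros Hc H. set (h := Z.to_nat (2 * c)).
  apply conv_sandwich with (fun n X => / 4 * cumR (c - 1) n (X - 1))
    (fun n X => / 4 * cumR (c - 1) (n + h) (X + 1)).
  - intros X x Hx HX. pose proof (conv_up _ _ 0 (-1) X x H Hx HX) as H1.
    pose proof (conv_up _ _ h 1 X x H Hx HX) as H2.
    replace (kappa / 4 * Lval x) with (/ 4 * (kappa * Lval x)) by field. split; apply scale_lim; auto.
    apply is_lim_seq_ext with (2 := H1). intros n. rewrite Nat.add_0_r. do 2 f_equal.
  - exists (S h). intros n Hn X. unfold cumR. 
    (* Keeps the totals [N - c] and [N - 2 * c] positive, away from the exceptional total 0 of
       [cum_mono]. *)
    assert (HN : (2 * c < Z.of_nat n)%Z) by (unfold h in Hn; lia).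
    replace (Z.of_nat (n + h)) with (Z.of_nat n + 2 * c)%Z by (unfold h; lia).
    set (N := Z.of_nat n) in *. split.
    + assert (Q : (cum (c - 1) N (X - 1) <= 4 * cum c N X)%Z).
      { rewrite cum_step by auto.
        pose proof (cum_mono c N N (X - 1) X ltac:(lia) ltac:(lia) ltac:(lia) ltac:(lia)).
        pose proof (cum_mono c (N - c) N (X - 1 - 1) X ltac:(lia) ltac:(lia) ltac:(lia) ltac:(lia)).
        pose proof (cum_mono c (N - c) N (X - 1 + 1) X ltac:(lia) ltac:(lia) ltac:(lia) ltac:(lia)).
        pose proof (cum_mono c (N - 2 * c) N (X - 1) X ltac:(lia) ltac:(lia) ltac:(lia) ltac:(lia)). lia. }
      apply IZR_le in Q. rewrite mult_IZR in Q. lra.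
    + assert (Q : (4 * cum c N X <= cum (c - 1) (N + 2 * c) (X + 1))%Z).
      { rewrite cum_step by auto.
        pose proof (cum_mono c N (N + 2 * c) X (X + 1) ltac:(lia) ltac:(lia) ltac:(lia) ltac:(lia)).
        pose proof (cum_mono c N (N + 2 * c - c) X (X + 1 - 1) ltac:(lia) ltac:(lia) ltac:(lia) ltac:(lia)).
        pose proof (cum_mono c N (N + 2 * c - c) X (X + 1 + 1) ltac:(lia) ltac:(lia) ltac:(lia) ltac:(lia)).
        pose proof (cum_mono c N (N + 2 * c - 2 * c) X (X + 1) ltac:(lia) ltac:(lia) ltac:(lia) ltac:(lia)). lia. }
      apply IZR_le in Q. rewrite mult_IZR in Q. lra.
Qed.

Lemma conv_cum (c : nat) : conv (cumR (Z.of_nat c)) (/ 2 * (/ 4) ^ c).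
Proof.
  induction c as [|c IH]; [simpl; rewrite Rmult_1_r; apply conv_cum0|].
  replace (/ 2 * (/ 4) ^ S c) with (/ 2 * (/ 4) ^ c / 4) by (simpl; field; apply pow_nonzero; lra).
  apply conv_cum_step; [lia|]. replace (Z.of_nat (S c) - 1)%Z with (Z.of_nat c) by lia. exact IH.
Qed.

(** * The rank distribution *)

Definition total (N : nat) (X : Z) : Z :=
  zsum (fun c => cum (Z.of_nat c) (Z.of_nat N - Z.of_nat c) X) (S N).

(** By [central_tail] all central parts above [C] together cost at most one cumulative count,
    asymptotically of order [4^(- C)]. So the sum over [c] needs no uniformity in the limits for
    fixed [c]. *)
Lemma total_bounds C N X : (C <= N)%nat ->
  rsum (fun c => cumR (Z.of_nat c) (N - c) X) (S C) <= IZR (total N X) <=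
  rsum (fun c => cumR (Z.of_nat c) (N - c) X) (S C) + cumR (Z.of_nat C) N X.
Proof.
  intros H.
  assert (E : rsum (fun c => cumR (Z.of_nat c) (N - c) X) (S C) =
    IZR (zsum (fun c => cum (Z.of_nat c) (Z.of_nat N - Z.of_nat c) X) (S C))).
  { rewrite IZR_zsum. apply rsum_ext. intros c Hc. unfold cumR. do 2 f_equal. lia. }
  assert (T : total N X = (zsum (fun c => cum (Z.of_nat c) (Z.of_nat N - Z.of_nat c) X) (S C) +
    zsum (fun i => cum (Z.of_nat (S C + i)) (Z.of_nat N - Z.of_nat (S C + i)) X) (N - C))%Z).
  { unfold total. replace (S N) with (S C + (N - C))%nat by lia. generalize (N - C)%nat as j.
    induction j as [|j IH]; [rewrite Nat.add_0_r; simpl zsum at 3; lia|].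
    rewrite Nat.add_succ_r. cbn [zsum] in *. rewrite IH. simpl (S C + j)%nat. lia. }
  pose proof (central_tail C (N - C) (Z.of_nat N) X) as HT.
  pose proof (cum_nonneg (Z.of_nat (C + (N - C))) (Z.of_nat N) X).
  rewrite E. unfold cumR. rewrite <- plus_IZR. split; apply IZR_le; rewrite T; [|lia].
  assert (0 <= zsum (fun i => cum (Z.of_nat (S C + i)) (Z.of_nat N - Z.of_nat (S C + i)) X) (N - C))%Z
    by (apply zsum_nonneg; intros; apply cum_nonneg). lia.
Qed.

Lemma Lval_bounds x : 0 <= Lval x <= 2 * c0.
Proof.
  pose proof c0_pos. destruct x as [x| |]; simpl; try lra.
  pose proof (Gi_le_c0 x). pose proof (Gi_le_c0 (- x)). rewrite Gi_odd in *. lra.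
Qed.

(** The constant is the geometric series of [/ 2 * (/ 4) ^ c]. *)
Lemma conv_total : conv (fun N X => IZR (total N X)) (2 / 3).
Proof.
  intros X x Hx HX. pose proof (Lval_bounds x) as HL. pose proof c0_pos as Hc0.
  set (l := Lval x) in *.
  assert (S1 : forall C, is_lim_seq (fun n => rsum (fun c => cumR (Z.of_nat c) (n - c) (X n)) (S C) / wt n)
     (2 / 3 * (1 - (/ 4) ^ S C) * l)).
  { induction C as [|C IH].
    - apply is_lim_seq_ext with (fun n => cumR (Z.of_nat 0) (n - 0) (X n) / wt n).
      + intros n. simpl rsum. now rewrite Rplus_0_l.
      + replace (2 / 3 * (1 - (/ 4) ^ 1) * l) with (/ 2 * (/ 4) ^ 0 * l) by (simpl; field).
        apply conv_down; auto. apply conv_cum.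
    - apply is_lim_seq_ext with (fun n => rsum (fun c => cumR (Z.of_nat c) (n - c) (X n)) (S C) / wt n +
        cumR (Z.of_nat (S C)) (n - S C) (X n) / wt n).
      + intros n. cbn [rsum]. unfold Rdiv. ring.
      + replace (2 / 3 * (1 - (/ 4) ^ S (S C)) * l) with
          (2 / 3 * (1 - (/ 4) ^ S C) * l + / 2 * (/ 4) ^ S C * l) by (simpl; field).
        apply is_lim_seq_plus'; [auto|]. apply conv_down; auto. apply conv_cum. }
  assert (S2 : forall C, is_lim_seq (fun n => cumR (Z.of_nat C) n (X n) / wt n) (/ 2 * (/ 4) ^ C * l)).
  { intros C. apply (conv_cum C); auto. }
  apply is_lim_seq_spec. intros [e He]. simpl.
  assert (HC : exists C, (/ 4) ^ C * l < e / 2).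
  { assert (G : is_lim_seq (fun C => (/ 4) ^ C * l) (0 * l)).
    { apply is_lim_seq_mult'; [apply is_lim_seq_geom; rewrite Rabs_right; lra|apply is_lim_seq_const]. }
    apply is_lim_seq_spec in G. destruct (G (pos_div_2 (mkposreal e He))) as [C HC]. exists C.
    specialize (HC C (le_n _)). simpl in HC. apply Rabs_def2 in HC. lra. }
  destruct HC as [C HC].
  pose proof (S1 C) as L1. pose proof (S2 C) as L2. apply is_lim_seq_spec in L1, L2.
  assert (He8 : 0 < e / 8) by lra.
  destruct (L1 (mkposreal _ He8)) as [N1 H1]. destruct (L2 (mkposreal _ He8)) as [N2 H2].
  simpl in H1, H2. exists (N1 + N2 + C + 1)%nat. intros n Hn.
  specialize (H1 n ltac:(lia)). specialize (H2 n ltac:(lia)).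
  pose proof (total_bounds C n (X n) ltac:(lia)) as HT.
  pose proof (Rinv_0_lt_compat _ (wt_pos n ltac:(lia))) as Hw.
  apply Rabs_def2 in H1, H2. unfold Rdiv in H1 at 1 3, H2 at 1 3.
  cbn [rsum] in *. set (s1 := rsum _ C + _) in *.
  assert (s1 * / wt n <= IZR (total n (X n)) / wt n) by (apply Rmult_le_compat_r; lra).
  assert (IZR (total n (X n)) / wt n <= s1 * / wt n + cumR (Z.of_nat C) n (X n) * / wt n).
  { rewrite <- Rmult_plus_distr_r. apply Rmult_le_compat_r; lra. }
  assert (Hp : 0 < (/ 4) ^ C) by (apply pow_lt; lra).
  simpl pow in H1. assert (0 <= (/ 4) ^ C * l) by (apply Rmult_le_pos; lra).
  set (p := (/ 4) ^ C) in *. apply Rabs_def1; lra.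
Qed.

Lemma rk_scale_sig N : (1 <= N)%nat -> rk_scale N = sig N.
Proof.
  intros HN. assert (HR : 1 <= INR N) by (apply (le_INR 1); auto). pose proof PI_RGT_0 as HP.
  unfold rk_scale, sig.
  assert (Hb : 0 < 6 * INR N / PI ^ 2) by (apply Rdiv_lt_0_compat; [lra|apply pow_lt; auto]).
  replace (1 / 4) with (/ 2 * / 2) by field. rewrite <- Rpower_mult.
  rewrite (Rpower_sqrt (6 * INR N / PI ^ 2)) by auto.
  rewrite Rpower_sqrt by (now apply sqrt_lt_R0). f_equal.
  unfold alpha. rewrite <- sqrt_div_alt by apply zeta2_pos. f_equal.
  unfold zeta2, Rsqr. field. lra.
Qed.

Lemma floor_spec y z : IZR z <= y <-> (z <= Int_part y)%Z.
Proof.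
  destruct (base_Int_part y) as [H1 H2]. split; intros H.
  - assert (z < Int_part y + 1)%Z; [|lia]. apply lt_IZR. rewrite plus_IZR. lra.
  - apply IZR_le in H. lra.
Qed.

Lemma Int_part_lim x : is_lim_seq (fun n => IZR (Int_part (x * rk_scale n)) / sig n) x.
Proof.
  apply is_lim_seq_le_le_loc with (fun n => x - / sig n) (fun _ => x).
  - exists 1%nat. intros n Hn. rewrite rk_scale_sig by auto. pose proof (sig_pos n Hn) as Hs.
    destruct (base_Int_part (x * sig n)) as [H1 H2].
    split; apply (Rmult_le_reg_r (sig n)); auto;
      replace (IZR (Int_part (x * sig n)) / sig n * sig n) with (IZR (Int_part (x * sig n)))
        by (field; lra); [|lra].
    replace ((x - / sig n) * sig n) with (x * sig n - 1) by (field; lra). lra.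
  - replace (Finite x) with (Finite (x - 0)) by (f_equal; ring).
    apply is_lim_seq_minus'; [apply is_lim_seq_const|].
    apply (is_lim_seq_inv sig p_infty); [apply sig_lim|discriminate].
  - apply is_lim_seq_const.
Qed.

Lemma INR_sig_lim : is_lim_seq (fun n => IZR (Z.of_nat n) / sig n) p_infty.
Proof.
  apply is_lim_seq_le_p_loc with (fun n => alpha * sig n).
  - exists 1%nat. intros n Hn. pose proof (sig_pos n Hn) as Hs. pose proof (sig_sqr n) as E.
    pose proof (sqrt_INR_sqr n) as Q. pose proof (sqrt_INR_ge1 n Hn).
    apply (Rmult_le_reg_r (sig n)); [auto|].
    replace (IZR (Z.of_nat n) / sig n * sig n) with (IZR (Z.of_nat n)) by (field; lra).
    rewrite Rmult_assoc, E, <- INR_IZR_INZ. nra.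
  - replace p_infty with (Rbar_mult alpha p_infty).
    + apply (is_lim_seq_scal_l sig alpha p_infty), sig_lim.
    + pose proof alpha_pos. simpl. destruct (Rle_dec 0 alpha) as [H'|H']; [|lra].
      destruct (Rle_lt_or_eq_dec 0 alpha H'); [reflexivity|lra].
Qed.

Theorem corollary1 :
  forall (x : R) (V A : nat -> nat),
    (forall N, is_card (scc N) (V N)) ->
    (forall N, is_card (fun l => exists j, scc_at N l j /\
                           IZR (rank_at l j) / rk_scale N <= x) (A N)) ->
    exists Psi : R,
      Un_cv (fun N => INR (A N) / INR (V N)) Psi /\
      improper_lower_integral gauss x Psi.
Proof.
  intros x V A HV HA. pose proof PI_RGT_0 as HPI. pose proof c0_pos as Hc0.
  exists ((c0 + Gi x) / sqrt (2 * PI)). split; [|apply gauss_improper].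
  assert (EV : forall N, INR (V N) = IZR (total N (Z.of_nat N))).
  { intros N. rewrite INR_IZR_INZ. f_equal. apply scc_card_all_cum, HV. }
  assert (EA : forall N, INR (A N) = IZR (total N (Int_part (x * rk_scale N)))).
  { intros N. rewrite INR_IZR_INZ. f_equal.
    apply (scc_card_cum N (fun z => IZR z / rk_scale N <= x)); [|apply HA].
    intros z. rewrite <- floor_spec.
    assert (Hs : 0 < rk_scale N) by apply exp_pos. split; intros H.
    - apply (Rmult_le_compat_r (rk_scale N)) in H; [|lra].
      replace (IZR z / rk_scale N * rk_scale N) with (IZR z) in H by (field; lra). lra.
    - apply (Rmult_le_reg_r (rk_scale N)); [auto|].
      replace (IZR z / rk_scale N * rk_scale N) with (IZR z) by (field; lra). lra. }
  pose proof (conv_total (fun n => Int_part (x * rk_scale n)) (Finite x) ltac:(discriminate)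
    (Int_part_lim x)) as LA.
  pose proof (conv_total Z.of_nat p_infty ltac:(discriminate) INR_sig_lim) as LV.
  apply is_lim_seq_Reals. simpl Lval in LA, LV.
  (* Numerator and denominator are the limits of [A N / wt N] and [V N / wt N], and
     [sqrt (2 * PI) = 2 * c0]. *)
  replace ((c0 + Gi x) / sqrt (2 * PI)) with ((2 / 3 * (c0 + Gi x)) / (2 / 3 * (2 * c0))).
  - apply is_lim_seq_ext_loc with
      (fun N => (IZR (total N (Int_part (x * rk_scale N))) / wt N) / (IZR (total N (Z.of_nat N)) / wt N)).
    + assert (HP : 0 < 2 / 3 * (2 * c0)) by lra.
      apply is_lim_seq_spec in LV. destruct (LV (mkposreal _ HP)) as [N0 HN0]. simpl in HN0.
      exists (N0 + 1)%nat. intros N HN. specialize (HN0 N ltac:(lia)).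
      pose proof (wt_pos N ltac:(lia)) as Hw. rewrite EV, EA.
      assert (IZR (total N (Z.of_nat N)) <> 0).
      { intros E. apply Rabs_def2 in HN0. rewrite E in HN0.
        replace (0 / wt N) with 0 in HN0 by (field; lra). lra. }
      field. repeat split; auto; lra.
    + apply is_lim_seq_div'; [exact LA|exact LV|lra].
  - assert (E : sqrt (2 * PI) = 2 * c0).
    { unfold c0. replace (2 * PI) with (2 * 2 * (PI / 2)) by field.
      rewrite sqrt_mult_alt, sqrt_square by lra. reflexivity. }
    rewrite E. field. lra.
Qed.
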